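(* For $\lambda\in\mathbb C$ with $\mathrm{Re}\,\lambda>\rho$ and $f\in C^\infty(\mathcal B)$, the $\mathrm{Cos}^\lambda$-transform on the Grassmann manifold $\mathcal B=\mathrm{Gr}_p(\mathbb K)$ coincides with the standard intertwining operator: $\mathcal C^\lambda f=J(\lambda)f$.
   Context: $\mathbb K$ is $\mathbb R$, $\mathbb C$ or the quaternions $\mathbb H$, $d=\dim_{\mathbb R}\mathbb K$, $p,q\ge1$, $p\le q$, $p+q=n+1$. For a square matrix $x$ over $\mathbb K$, $|\det x|=|\det_{\mathbb R}x|^{1/d}$. $G=\mathrm{SL}(n+1,\mathbb K)$, $\theta(x)=(x^* )^{-1}$ with $x^*=\overline x^{\,t}$, $K=\mathrm{SU}(n+1,\mathbb K)=\{x\in G: x^*=x^{-1}\}$. $H_o=\mathrm{diag}(\tfrac{q}{n+1}I_p,-\tfrac{p}{n+1}I_q)$, $A=\exp(\mathbb RH_o)$, $M$ is the group of block diagonal matrices $\mathrm{diag}(a,b)\in G$, $a\in\mathrm{GL}(p,\mathbb K)$, $b\in\mathrm{GL}(q,\mathbb K)$, with $|\det a|=|\det b|=1$, $N=\left\{\begin{pmatrix}I_p&X\\ 0&I_q\end{pmatrix}\right\}$, $\overline N=\theta(N)=\left\{\begin{pmatrix}I_p&0\\ Y&I_q\end{pmatrix}\right\}$, $P=MAN$. $\mathcal B=\mathrm{Gr}_p(\mathbb K)$ is the manifold of $p$-dimensional $\mathbb K$-subspaces of $\mathbb K^{n+1}$ (right subspaces when $\mathbb K=\mathbb H$), $b_o=\mathbb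 Ke_1\oplus\dots\oplus\mathbb Ke_p$, $L=K\cap P$, so $\mathcal B=K/L=G/P$. Each $g\in G$ is written $g=k(g)m(g)a(g)n(g)\in KMAN$ with $a(g)\in A$ unique. For $\lambda\in\mathbb C$ and $a=\exp(sH_o)\in A$ put $a^\lambda=\exp\!\big(s\lambda\tfrac{pq}{n+1}\big)$ (this identifies $\mathfrak a_{\mathbb C}^*$ with $\mathbb C$); under it half the sum of the positive roots becomes $\rho=d(n+1)/2$. $db$ is the $K$-invariant probability measure on $\mathcal B$; Haar measure on $\overline N$ satisfies $\int_{\overline N}a(\bar n)^{-2\rho}d\bar n=1$. The standard intertwining operator is $$J(\lambda)f(k\cdot b_o)=\int_{\overline N}a(\bar n)^{-\lambda-\rho}f(k\bar n\cdot b_o)\,d\bar n .$$ For $b,c\in\mathrm{Gr}_p(\mathbb K)$ put $|\mathrm{Cos}(b,c)|:=\mathrm{Vol}_{\mathbb R}(P_c(E))^{1/d}$, where $E\subset b$ is a convex subset containing $0$ of ($dp$-dimensional Euclidean) volume one and $P_c:\mathbb K^{n+1}\to c$ is the orthogonal projection (this is independent of $E$). The $\mathrm{Cos}^\lambda$-transform is $$\mathcal C^\lambda(f)(c)=\int_{\mathcal B}|\mathrm{Cos}(b,c)|^{\lambda-\rho}f(b)\,db,\qquad \mathrm{Re}\,\lambda>\rho.$$ *)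

(* Defs.v *)
From HB Require Import structures.
From mathcomp Require Import all_boot all_order all_algebra.
From mathcomp Require Import complex ring.
From mathcomp Require Import all_classical all_reals all_analysis.

Set Implicit Arguments.
Unset Strict Implicit.
Unset Printing Implicit Defensive.

Import Order.TTheory GRing.Theory Num.Theory.
Import numFieldNormedType.Exports.

Local Open Scope classical_set_scope.
Local Open Scope ring_scope.

(* [Quat a b c d] is a + b i + c j + d k. *)
Record quat (R : Type) := Quat { qre : R; qi : R; qj : R; qk : R }.

Section Quaternions.
Variable R : comNzRingType.

Definition quat_tuple (x : quat R) := (qre x, qi x, qj x, qk x).
Definition tuple_quat (t : R * R * R * R) :=
  Quat t.1.1.1 t.1.1.2 t.1.2 t.2.

Lemma quat_tupleK : cancel quat_tuple tuple_quat.
Proof. by case. Qed.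

HB.instance Definition _ := Choice.copy (quat R) (can_type quat_tupleK).

Definition addq (x y : quat R) :=
  Quat (qre x + qre y) (qi x + qi y) (qj x + qj y) (qk x + qk y).
Definition oppq (x : quat R) := Quat (- qre x) (- qi x) (- qj x) (- qk x).
Definition mulq (x y : quat R) :=
  Quat (qre x * qre y - qi x * qi y - qj x * qj y - qk x * qk y)
       (qre x * qi y + qi x * qre y + qj x * qk y - qk x * qj y)
       (qre x * qj y - qi x * qk y + qj x * qre y + qk x * qi y)
       (qre x * qk y + qi x * qj y - qj x * qi y + qk x * qre y).

Let quat0 : quat R := Quat 0 0 0 0.
Let quat1 : quat R := Quat 1 0 0 0.

Fact addqA : associative addq.
Proof. by move=> [????] [????] [????]; rewrite /addq /= !addrA. Qed.
Fact addqC : commutative addq.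
Proof. by move=> [????] [????]; congr Quat; exact: addrC. Qed.
Fact add0q : left_id quat0 addq.
Proof. by move=> [????]; rewrite /addq /= !add0r. Qed.
Fact addNq : left_inverse quat0 oppq addq.
Proof. by move=> [????]; rewrite /addq /= !addNr. Qed.

HB.instance Definition _ :=
  GRing.isZmodule.Build (quat R) addqA addqC add0q addNq.

Fact mulqA : associative mulq.
Proof. by move=> [????] [????] [????]; congr Quat => /=; ring. Qed.
Fact mul1q : left_id quat1 mulq.
Proof. by move=> [????]; congr Quat => /=; ring. Qed.
Fact mulq1 : right_id quat1 mulq.
Proof. by move=> [????]; congr Quat => /=; ring. Qed.
Fact mulqDl : left_distributive mulq addq.
Proof. by move=> [????] [????] [????]; congr Quat => /=; ring. Qed.
Fact mulqDr : right_distributive mulq addq.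
Proof. by move=> [????] [????] [????]; congr Quat => /=; ring. Qed.
Fact oneq_neq0 : quat1 != 0.
Proof. by apply/eqP => -[/eqP]; rewrite oner_eq0. Qed.

HB.instance Definition _ :=
  GRing.Zmodule_isNzRing.Build (quat R) mulqA mul1q mulq1 mulqDl mulqDr
    oneq_neq0.

Definition conjq (x : quat R) := Quat (qre x) (- qi x) (- qj x) (- qk x).

End Quaternions.

(* The value F i, for i in P, if P is nonempty and this value does not depend
   on i; t0 otherwise. *)
Definition common_value (I : Type) (T : choiceType) (t0 : T) (P : set I)
    (F : I -> T) : T :=
  xget t0 [set t | F @` P = [set t]].

Variant scalar_kind := RealS | ComplexS | QuaternionS.

Definition scalars_ring (R : realType) (k : scalar_kind) : nzRingType :=
  match k with
  | RealS => R
  | ComplexS => R[i]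
  | QuaternionS => quat R
  end.

Definition scalars (R : realType) (k : scalar_kind) : Type :=
  scalars_ring R k.

HB.instance Definition _ R k := GRing.NzRing.copy (scalars R k) (scalars_ring R k).
HB.instance Definition _ R k := isPointed.Build (scalars R k) 0.

Definition dimR (k : scalar_kind) : nat :=
  match k with RealS => 1 | ComplexS => 2 | QuaternionS => 4 end.

Section Scalars.
Variable R : realType.

Definition of_real (k : scalar_kind) : R -> scalars R k :=
  match k with
  | RealS => fun x => x
  | ComplexS => fun x => (x%:C)%C
  | QuaternionS => fun x => Quat x 0 0 0
  end.

Definition conjs (k : scalar_kind) : scalars R k -> scalars R k :=
  match k with
  | RealS => fun x => x
  | ComplexS => fun x => (conjc x)
  | QuaternionS => fun x => conjq x
  end.

Definition scoord (k : scalar_kind) : scalars R k -> 'rV[R]_(dimR k) :=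
  match k with
  | RealS => fun x => \row_j x
  | ComplexS => fun x => \row_j [:: complex.Re x; complex.Im x]`_j
  | QuaternionS => fun x => \row_j [:: qre x; qi x; qj x; qk x]`_j
  end.

Definition of_scoord (k : scalar_kind) : 'rV[R]_(dimR k) -> scalars R k :=
  match k with
  | RealS => fun v => v 0 0
  | ComplexS => fun v => (v 0 0 +i* v 0 1)%C
  | QuaternionS => fun v => Quat (v 0 0) (v 0 1) (v 0 2) (v 0 3)
  end.

Lemma scoordK k : cancel (@scoord k) (@of_scoord k).
Proof. by case: k => [x|[x y]|[x y z t]] /=; rewrite !mxE. Qed.

Lemma of_scoordK k : cancel (@of_scoord k) (@scoord k).
Proof.
case: k => v; apply/rowP => -[i iP]; rewrite !mxE.
- by case: i iP => // iP; congr (v 0 _); exact: val_inj.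
- by case: i iP => [|[|//]] iP; congr (v 0 _); exact: val_inj.
- by case: i iP => [|[|[|[|//]]]] iP; congr (v 0 _); exact: val_inj.
Qed.

Variable k : scalar_kind.
Local Notation K := (scalars R k).
Local Notation d := (dimR k).

(* The real coordinates of a K-matrix: an R-linear bijection onto R^(mnd),
   isometric for the Euclidean norm. *)
Definition toR m n (X : 'M[K]_(m, n)) : 'rV[R]_(m * n * d) :=
  mxvec (\matrix_(i < m * n) scoord (mxvec X 0 i)).

Definition ofR m n (v : 'rV[R]_(m * n * d)) : 'M[K]_(m, n) :=
  vec_mx (\row_(i < m * n) of_scoord (row i (vec_mx v))).

Lemma toRK m n : cancel (@toR m n) (@ofR m n).
Proof.
move=> X; rewrite /ofR /toR mxvecK -[RHS]mxvecK; congr vec_mx.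
by apply/rowP => i; rewrite mxE rowK scoordK.
Qed.

Lemma ofRK m n : cancel (@ofR m n) (@toR m n).
Proof.
move=> v; rewrite /ofR /toR -[RHS]vec_mxK; congr mxvec.
by apply/row_matrixP => i; rewrite rowK vec_mxK mxE of_scoordK.
Qed.

Definition adj m n (x : 'M[K]_(m, n)) : 'M[K]_(n, m) := map_mx (@conjs k) x^T.

Definition detR n (x : 'M[K]_n) : R :=
  \det (lin1_mx (fun v : 'rV[R]_(n * 1 * d) => toR (x *m ofR v))).

Definition absdet n (x : 'M[K]_n) : R := `|detR x| `^ d%:R^-1.

Definition GL n : set 'M[K]_n :=
  [set x | exists y, x *m y = 1%:M /\ y *m x = 1%:M].

End Scalars.

(* Over the quaternions SL is cut out by |det x| = 1, the ordinary determinant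
   being unavailable. *)
Definition det_is_one (R : realType) (k : scalar_kind) :
    forall n, 'M[scalars R k]_n -> Prop :=
  match k with
  | RealS => fun n x => \det (x : 'M[R]_n) = 1
  | ComplexS => fun n x => \det (x : 'M[R[i]]_n) = 1
  | QuaternionS => fun n x => @absdet R QuaternionS n x = 1
  end.

Definition SL (R : realType) (k : scalar_kind) n : set 'M[scalars R k]_n :=
  [set x | GL x /\ det_is_one x].

Definition SU (R : realType) (k : scalar_kind) n : set 'M[scalars R k]_n :=
  [set x | SL x /\ (adj x *m x = 1%:M /\ x *m adj x = 1%:M)].

Section EuclideanVolume.
Variable R : realType.

Definition box m (a b : 'rV[R]_m) : set 'rV[R]_m :=
  [set x | forall i, a 0 i <= x 0 i <= b 0 i].

Definition box_volume m (a b : 'rV[R]_m) : R :=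
  \prod_(i < m) Num.max 0 (b 0 i - a 0 i).

(* m-dimensional Lebesgue outer measure, which is the Lebesgue measure on
   Lebesgue measurable sets, in particular on convex sets. *)
Definition lebesgue_outer m (E : set 'rV[R]_m) : \bar R :=
  ereal_inf [set (\sum_(0 <= j <oo) (box_volume (A j).1 (A j).2)%:E)%E
            | A in [set A : nat -> 'rV[R]_m * 'rV[R]_m |
                    E `<=` \bigcup_j box (A j).1 (A j).2]].

(* m-dimensional Euclidean volume of a subset of R^N lying in an m-dimensional
   linear subspace: the rows of U are an orthonormal basis of such a
   subspace. *)
Definition subspace_volume m N (E : set 'rV[R]_N) : \bar R :=
  common_value 0%E
    [set U : 'M[R]_(m, N) | U *m U^T = 1%:M /\
                            E `<=` range (fun x : 'rV[R]_m => x *m U)]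
    (fun U => lebesgue_outer [set x : 'rV[R]_m | E (x *m U)]).

End EuclideanVolume.

Section ComplexAnalysis.
Variable R : realType.

Definition cexp (z : R[i]) : R[i] :=
  ((expR (complex.Re z) * cos (complex.Im z)) +i*
   (expR (complex.Re z) * sin (complex.Im z)))%C.

(* r ^ z for r >= 0; at r = 0 it is meant for 0 < Re z only. *)
Definition cpow (r : R) (z : R[i]) : R[i] :=
  if r == 0 then 0 else cexp ((ln r)%:C%C * z).

Definition cintegral dT (T : measurableType dT)
    (mu : {measure set T -> \bar R}) (F : T -> R[i]) : R[i] :=
  ((\int[mu]_(x in setT) complex.Re (F x)) +i*
   (\int[mu]_(x in setT) complex.Im (F x)))%C.

Fixpoint Ck m (r : nat) (F : 'rV[R]_m -> R) : Prop :=
  match r with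
  | 0%N => continuous F
  | r'.+1 => (forall x v, derivable F x v) /\ (forall v, Ck r' ('D_v F))
  end.

Definition Cinfty m (F : 'rV[R]_m -> R) : Prop := forall r, Ck r F.

End ComplexAnalysis.

(* Vectors of K^(n+1), n + 1 = p + q, are columns; they are multiplied by
   matrices on the left and by scalars on the right. *)
Section Grassmannian.
Variables (R : realType) (k : scalar_kind) (p q : nat).
Local Notation K := (scalars R k).
Local Notation d := (dimR k).

(* The columns of u are a basis of b as a right K-vector space. *)
Definition is_basis (u : 'M[K]_(p + q, p)) (b : set 'cV[K]_(p + q)) : Prop :=
  (forall x : 'cV[K]_p, u *m x = 0 -> x = 0) /\
  b = range (fun x : 'cV[K]_p => u *m x).

Record Gr := MkGr {
  gr_set :> set 'cV[K]_(p + q);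
  gr_basis : exists u, is_basis u gr_set }.

HB.instance Definition _ := gen_eqMixin Gr.
HB.instance Definition _ := gen_choiceMixin Gr.

Fact b_o_basis : exists u : 'M[K]_(p + q, p),
  is_basis u [set v : 'cV[K]_(p + q) | dsubmx v = 0].
Proof.
exists (col_mx 1%:M 0); split=> [x|].
  by rewrite mul_col_mx mul1mx mul0mx -[RHS]col_mx0 => /eq_col_mx[].
apply/seteqP; split=> v /=.
  move=> v0; exists (usubmx v) => //.
  by rewrite mul_col_mx mul1mx mul0mx -v0 vsubmxK.
by move=> [x _ <-]; rewrite mul_col_mx mul1mx mul0mx col_mxKd.
Qed.

Definition b_o : Gr := MkGr b_o_basis.

HB.instance Definition _ := isPointed.Build Gr b_o.

(* The translate g . b = {g v | v in b}; the default b is never used for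
   invertible g, see [act_set]. *)
Definition act (g : 'M[K]_(p + q)) (b : Gr) : Gr :=
  match pselect (exists u, is_basis u ((fun v => g *m v) @` gr_set b)) with
  | left h => MkGr h
  | right _ => b
  end.

Lemma act_set g b : GL g -> gr_set (act g b) = (fun v => g *m v) @` gr_set b.
Proof.
move=> [h [_ hg]]; rewrite /act; case: pselect => //= -[].
case: b => _ /= [u [u0 ->]]; exists (g *m u); split=> [x|].
  by rewrite -mulmxA => /(congr1 (mulmx h)); rewrite mulmxA hg mul1mx mulmx0 => /u0.
apply/seteqP; split=> v /=.
  by move=> [_ [x _ <-] <-]; exists x; rewrite // mulmxA.
by move=> [x _ <-]; exists (u *m x); [exists x | rewrite mulmxA].
Qed.

Definition nX (X : 'M[K]_(p, q)) : 'M[K]_(p + q) := block_mx 1%:M X 0 1%:M.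
Definition nbar (Y : 'M[K]_(q, p)) : 'M[K]_(p + q) := block_mx 1%:M 0 Y 1%:M.

(* The manifold structure of Gr is given by the charts
   Y |-> g (1 0 \\ Y 1) . b_o, for g in G: the subspaces complementary to
   g (K e_(p+1) + ... + K e_(p+q)). *)
Definition chart (g : 'M[K]_(p + q)) (x : 'rV[R]_(q * p * d)) : Gr :=
  act (g *m nbar (ofR x)) b_o.

Definition gr_open : set (set Gr) :=
  [set U | forall g, SL g -> open (chart g @^-1` U)].

Definition smooth (f : Gr -> R[i]) : Prop :=
  forall g, SL g -> Cinfty (fun x => complex.Re (f (chart g x))) /\
                    Cinfty (fun x => complex.Im (f (chart g x))).

Definition GrBorel := g_sigma_algebraType gr_open.

Definition K_invariant (mu : set GrBorel -> \bar R) : Prop :=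
  forall g, SU g -> forall E : set GrBorel, measurable E ->
    mu [set b | E (act g b)] = mu E.

(* Nbar is identified with the additive group of q x p matrices:
   nbar Y *m nbar Y' = nbar (Y + Y'). *)
Definition NbarBorel :=
  g_sigma_algebraType [set U : set 'M[K]_(q, p) | open (@ofR R k q p @^-1` U)].

Definition is_haar (nu : set NbarBorel -> \bar R) : Prop :=
  [/\ forall (Z : 'M[K]_(q, p)) (E : set NbarBorel), measurable E ->
        nu [set Y : 'M[K]_(q, p) | E (Z + Y)] = nu E,
      forall C : set 'M[K]_(q, p), compact (@ofR R k q p @^-1` C) ->
        (nu C < +oo)%E
    & nu setT != 0%E].

Lemma nbarD Y Y' : nbar Y *m nbar Y' = nbar (Y + Y').
Proof.
by rewrite /nbar mulmx_block !mulmx1 !mul0mx !mul1mx !mulmx0 !addr0 !add0r.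
Qed.

(* exp (s H_o) *)
Definition expH (s : R) : 'M[K]_(p + q) :=
  block_mx (of_real k (expR (s * (q%:R / (p + q)%:R))))%:M 0
           0 (of_real k (expR (- (s * (p%:R / (p + q)%:R)))))%:M.

Definition Mgroup : set 'M[K]_(p + q) :=
  [set x | SL x /\ exists (a : 'M[K]_p) (b : 'M[K]_q),
    [/\ x = block_mx a 0 0 b, GL a, GL b, absdet a = 1 & absdet b = 1]].

(* The real s such that a(g) = exp (s H_o). *)
Definition log_a (g : 'M[K]_(p + q)) : R :=
  xget 0 [set s | exists u m X,
    [/\ SU u, Mgroup m & g = u *m m *m expH s *m nX X]].

(* a ^ lambda for a = exp (s H_o) *)
Definition apow (s : R) (lambda : R[i]) : R[i] :=
  cexp ((s * ((p * q)%:R / (p + q)%:R))%:C%C * lambda).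

Definition rho : R := (d * (p + q))%:R / 2.

Definition intertwining (nu : {measure set NbarBorel -> \bar R})
    (lambda : R[i]) (f : Gr -> R[i]) (b : Gr) : R[i] :=
  common_value 0
    [set u : 'M[K]_(p + q) | SU u /\ b = act u b_o]
    (fun u => cintegral nu (fun Y : 'M[K]_(q, p) =>
       apow (log_a (nbar Y)) (- lambda - rho%:C%C) * f (act (u *m nbar Y) b_o))).

Definition orth_proj (c : Gr) (v : 'cV[K]_(p + q)) : 'cV[K]_(p + q) :=
  xget 0 [set w | gr_set c w /\
                  forall u, gr_set c u -> adj u *m (v - w) = 0].

Definition convexK (E : set 'cV[K]_(p + q)) : Prop :=
  convex_set (@toR R k (p + q) 1 @` E : set (convex_lmodType _)).

(* (d p)-dimensional Euclidean volume *)
Definition VolR (E : set 'cV[K]_(p + q)) : \bar R :=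
  subspace_volume (d * p) (@toR R k (p + q) 1 @` E).

Definition abs_Cos (b c : Gr) : R :=
  common_value 0
    [set E : set 'cV[K]_(p + q) |
      [/\ E `<=` gr_set b, convexK E, E 0 & VolR E = 1%E]]
    (fun E => fine (VolR (orth_proj c @` E)) `^ d%:R^-1).

Definition cos_transform (mu : {measure set GrBorel -> \bar R})
    (lambda : R[i]) (f : Gr -> R[i]) (c : Gr) : R[i] :=
  cintegral mu (fun b : Gr => cpow (abs_Cos b c) (lambda - rho%:C%C) * f b).

End Grassmannian.

Arguments rho : clear implicits.

(* Main.v *)
Require Import Defs.
From HB Require Import structures.
From mathcomp Require Import all_boot all_order all_algebra.
From mathcomp Require Import fingroup perm.
From mathcomp Require Import complex ring lra.
From mathcomp Require Import all_classical all_reals all_analysis.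
From mathcomp Require Import measurable_realfun.

Set Implicit Arguments.
Unset Strict Implicit.
Unset Printing Implicit Defensive.

Import Order.TTheory GRing.Theory Num.Theory.
Import numFieldNormedType.Exports.

Local Open Scope classical_set_scope.
Local Open Scope ring_scope.

(** The theorem is a change of variables from Gr to its big cell:
    [[
      \int_Gr F dmu = \int_Nbar F (nbar . b_o) a(nbar)^(-2 rho) dnu(nbar)
    ]]
    for every continuous F ([Gr_integral]). To compute the cosine transform at
    c = u . b_o with u in SU, rotate by u ([integral_act_SU], [abs_Cos_act])
    and apply the formula to |Cos (b, b_o)|^(lambda - rho) f (u . b).
    The first p columns of nbar are u_p a, with u_p the first p columns of a
    matrix in SU and |det a| = a(nbar) for the Iwasawa component
    ([iwasawaP]). Since |Cos| of two subspaces is the absolute determinant of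
    the matrix of inner products of their orthonormal frames ([abs_CosE]),
    |Cos (nbar . b_o, b_o)| is a(nbar)^(-1), and the powers combine to
    a(nbar)^(-lambda - rho) ([cpow_cell]).

    The change of variables is obtained without computing the Jacobian of the
    map from SU to the cell, by integrating over an auxiliary space, that of
    all pairs (A, B) of a p x p and a q x p matrix with Lebesgue measure. Such
    a pair is a frame (A; B) of a subspace, namely of the point of the cell
    with coordinate B A^(-1). Let F be evaluated at the subspace spanned by the
    frame, and let the kernel [near_set] select the pairs of a frame and a
    subspace b such that the frame is within a bounded region along b and at a
    small distance from b. The integral of F times the kernel is evaluated in
    two ways.
     - Integrating over b first, the invariance of mu makes the inner integral
       a function of the orbit of the frame under SU. The substitution
       B = Y A and the Iwasawa decomposition separate the variables; the result
       is a constant times the integral of F over the cell with the weight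
       a^(-2 rho) ([frame_int_eq]).
     - Integrating over the frame first, the invariance of Lebesgue measure
       under SU moves b to b_o. As the distance shrinks, the rescaled inner
       integral averages F over subspaces tending to b, and converges to a
       constant times F b ([kernel_int_mean], [mean_int_cvg]).
    Comparing F with the constant 1, the weighted integral over the cell is
    proportional to the integral against mu ([cell_int_eq]). Haar measure is
    unique up to a factor ([haar_integral]), and the normalization of nu makes
    the factor 1.

    Two facts about Lebesgue outer measure support this: it restricts to a
    translation invariant measure on Borel sets, and x |-> x T multiplies it by
    |det T| for arbitrary sets ([lebesgue_outer_lin]). Matrices over the
    quaternions are handled through their real forms, in which the adjoint is
    the transpose ([iota_adj]). *)

(** * Covers of boxes *)

Section BoxCovers.
Variable R : realType.
Local Open Scope ereal_scope.

Lemma lebesgue_segment (a b : R) :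
  lebesgue_measure (`[a, b]%classic : set R) = (Num.max 0 (b - a))%:E.
Proof.
rewrite lebesgue_measure_itv /= lte_fin; case: ltP => ab.
  by rewrite -EFinB; congr EFin; rewrite max_r// subr_ge0 ltW.
by rewrite max_l// subr_le0.
Qed.

(** Induction on the dimension: at height t in the first coordinate the slices
    of the covering boxes cover the slice of the box, and integrating this
    inequality in t against Lebesgue measure on the line gives the next
    dimension. The predicate P keeps only the boxes met at the given height. *)
Lemma box_cover_le n (a b : 'I_n -> R) (A B : nat -> 'I_n -> R) (P : pred nat) :
  (forall x : 'I_n -> R, (forall i, (a i <= x i <= b i)%R) ->
     exists2 j, P j & forall i, (A j i <= x i <= B j i)%R) ->
  (\prod_(i < n) Num.max 0 (b i - a i)%R)%:E <=
  \sum_(0 <= j <oo) (if P j then \prod_(i < n) Num.max 0 (B j i - A j i) else 0)%R%:E.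
Proof.
elim: n a b A B P => [|n IH] a b A B P cov.
  have [|j Pj _] := cov (fun i => 0%R); first by case.
  rewrite big_ord0 (le_trans _ (nneseries_lim_ge j.+1 _))//; last first.
    by move=> i _ _; rewrite lee_fin; case: ifP => // _; rewrite big_ord0.
  rewrite big_nat_recr//= Pj big_ord0 leeDr// sume_ge0// => i _.
  by rewrite lee_fin; case: ifP => // _; rewrite big_ord0.
set V := (\prod_(i < n) Num.max 0 (b (lift ord0 i) - a (lift ord0 i)))%R.
pose W j := (if P j then \prod_(i < n) Num.max 0 (B j (lift ord0 i) - A j (lift ord0 i)) else 0)%R.
have V0 : (0 <= V)%R by apply: prodr_ge0 => i _; rewrite le_max lexx.
have W0 j : (0 <= W j)%R.
  by rewrite /W; case: ifP => // _; apply: prodr_ge0 => i _; rewrite le_max lexx.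
pose f (t : R) := V%:E * (\1_(`[a ord0, b ord0]%classic) t)%:E.
pose g j (t : R) := (W j)%:E * (\1_(`[A j ord0, B j ord0]%classic) t)%:E.
have g0 j t : 0 <= g j t by rewrite mule_ge0 ?lee_fin.
have mi (c : R) (D : set R) : measurable D ->
    measurable_fun [set: R] (fun t : R => c%:E * (\1_D t)%:E).
  move=> mD; apply: measurable_funeM; exact/measurable_EFinP/measurable_indic.
have int (c : R) x y : (0 <= c)%R ->
    \int[lebesgue_measure]_(t in [set: R]) (c%:E * (\1_(`[x, y]%classic) t)%:E) =
    (Num.max 0 (y - x) * c)%R%:E.
  move=> c0; rewrite ge0_integralZl_EFin//; last first.
    by apply/measurable_EFinP/measurable_indic.
  rewrite integral_indic// setIT; transitivity (c%:E * (Num.max 0 (y - x))%:E); last by rewrite -EFinM mulrC.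
  congr (_ * _); exact: lebesgue_segment.
have pt (t : R) : f t <= \sum_(0 <= j <oo) g j t.
  rewrite /f indicE; case: (boolP (t \in _)) => [|_]; last first.
    by rewrite mule0; apply: nneseries_ge0.
  rewrite inE /= in_itv /= => tab; rewrite mule1.
  pose P' j := P j && (A j ord0 <= t <= B j ord0)%R.
  apply: le_trans (IH _ _ (fun j i => A j (lift ord0 i)) (fun j i => B j (lift ord0 i)) P' _) _.
    move=> x xab.
    pose y (i : 'I_n.+1) := if unlift ord0 i is Some i' then x i' else t.
    have [i|j Pj yj] := cov y.
      by rewrite /y; case: unliftP => [i' ->|->].
    exists j; first by rewrite /P' Pj; have := yj ord0; rewrite /y unlift_none.
    by move=> i; have := yj (lift ord0 i); rewrite /y liftK.
  apply: lee_nneseries => j _ => [_|].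
    by rewrite lee_fin /P'; case: ifP => // _; apply: prodr_ge0 => i _; rewrite le_max lexx.
  rewrite /g /W /P'; case: (P j) => /=; last by rewrite mul0e.
  rewrite indicE mem_setE in_itv /= -EFinM lee_fin.
  by case: ifP => _; rewrite ?mulr1 ?mulr0.
rewrite big_ord_recl -/V -int//.
apply: (@le_trans _ _ (\int[lebesgue_measure]_(t in [set: R]) \sum_(0 <= j <oo) g j t)).
  apply: ge0_le_integral => //.
  - by move=> t _; rewrite mule_ge0 ?lee_fin.
  - exact: mi.
  - by apply: ge0_emeasurable_sum => // j _; exact: mi.
  - by move=> t _; exact: pt.
rewrite integral_nneseries//; last by move=> j; exact: mi.
apply: lee_nneseries => j _ => [_|]; first by apply: integral_ge0.
rewrite int// lee_fin /W; case: ifP => _; last by rewrite mulr0.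
by rewrite big_ord_recl.
Qed.
End BoxCovers.

(** * Lebesgue outer measure of row vectors *)

Section OuterMeasure.
Variable R : realType.
Local Open Scope ereal_scope.

Lemma box_volume_ge0 n (a b : 'rV[R]_n) : (0 <= box_volume a b)%R.
Proof. by apply: prodr_ge0 => i _; rewrite le_max lexx. Qed.

Lemma lebesgue_outer_ge0 n (E : set 'rV[R]_n) : 0 <= lebesgue_outer E.
Proof.
apply: le_ereal_inf_tmp => _ [A _ <-]; apply: nneseries_ge0 => j _ _.
by rewrite lee_fin box_volume_ge0.
Qed.

Lemma le_lebesgue_outer n (E F : set 'rV[R]_n) :
  E `<=` F -> lebesgue_outer E <= lebesgue_outer F.
Proof.
move=> EF; apply: ereal_inf_le_tmp => _ [A FA <-]; exists A => //.
exact: subset_trans FA.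
Qed.

Lemma lebesgue_outer_cover n (E : set 'rV[R]_n) (A : nat -> 'rV[R]_n * 'rV[R]_n) :
  E `<=` \bigcup_j box (A j).1 (A j).2 ->
  lebesgue_outer E <= \sum_(0 <= j <oo) (box_volume (A j).1 (A j).2)%:E.
Proof. by move=> EA; apply: ereal_inf_lbound; exists A. Qed.

Lemma box_le_lebesgue_outer n (a b : 'rV[R]_n) :
  (box_volume a b)%:E <= lebesgue_outer (box a b).
Proof.
apply: le_ereal_inf_tmp => _ [A cov <-].
apply: (box_cover_le (a := a 0%R) (b := b 0%R)
   (A := fun j i => (A j).1 0%R i) (B := fun j i => (A j).2 0%R i) (P := xpredT)).
move=> x xab; have [|j _ xj] := cov (\row_i x i).
  by move=> i; rewrite mxE.
by exists j => // i; have := xj i; rewrite mxE.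
Qed.

(** In dimension 0 every box has volume 1, so that the empty set has infinite outer
    measure; hence the successors here and below. *)
Lemma lebesgue_outer_box n (a b : 'rV[R]_n.+1) :
  lebesgue_outer (box a b) = (box_volume a b)%:E.
Proof.
apply/eqP; rewrite eq_le box_le_lebesgue_outer andbT.
pose A j : 'rV[R]_n.+1 * 'rV[R]_n.+1 := if j is 0%N then (a, b) else (0, 0)%R.
apply: le_trans (lebesgue_outer_cover (A := A) _) _; first by move=> x xab; exists 0%N.
rewrite (nneseries_split 0%N 1%N)//; last by move=> j _; rewrite lee_fin box_volume_ge0.
rewrite add0n big_nat1 /= eseries0 ?adde0//= => -[//|j] _ _ /=.
by rewrite /box_volume big_ord_recl subrr max_l// mul0r.
Qed.

Lemma lebesgue_outer0 n : lebesgue_outer (@set0 'rV[R]_n.+1) = 0.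
Proof.
apply/eqP; rewrite eq_le lebesgue_outer_ge0 andbT.
have -> : 0 = (box_volume (0%R : 'rV[R]_n.+1) 0%R)%:E.
  by rewrite /box_volume big_ord_recl subrr max_l// mul0r.
by rewrite -lebesgue_outer_box; apply: le_lebesgue_outer.
Qed.

Lemma lebesgue_outer_sigma_subadditive n :
  sigma_subadditive (@lebesgue_outer R n.+1).
Proof.
move=> E; have [[i Ei]|fin] := pselect (exists i, lebesgue_outer (E i) = +oo).
  rewrite (eseries_pinfty _ _ Ei) ?leey// => j _.
  by rewrite -ltNye (lt_le_trans _ (lebesgue_outer_ge0 _)).
pose vol (B : 'rV[R]_n.+1 * 'rV[R]_n.+1) : \bar R := (box_volume B.1 B.2)%:E.
have vol0 B : 0 <= vol B by rewrite lee_fin box_volume_ge0.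
apply/lee_addgt0Pr => e e0.
apply: le_trans (epsilon_trick xpredT (fun m => lebesgue_outer_ge0 (E m)) (ltW e0)).
have cover m : exists B : nat -> 'rV[R]_n.+1 * 'rV[R]_n.+1,
    E m `<=` \bigcup_j box (B j).1 (B j).2 /\
    \sum_(0 <= j <oo) vol (B j) <= lebesgue_outer (E m) + (e / (2 ^ m.+1)%:R)%:E.
  have em0 : (0 < e / (2 ^ m.+1)%:R)%R by rewrite divr_gt0// ltr0n expn_gt0.
  have Em : lebesgue_outer (E m) \is a fin_num.
    by rewrite ge0_fin_numE ?lebesgue_outer_ge0// ltey; apply/eqP => Em; apply: fin; exists m.
  have [_ [B EB <-] /ltW leB] := lb_ereal_inf_adherent em0 Em.
  by exists B.
have [G PG] := choice cover.
have [f bf] : exists f : nat -> nat * nat, set_bij setT setT f.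
  by apply/card_set_bijP; rewrite card_eq_sym; exact: card_nat2.
apply: le_trans (lebesgue_outer_cover (A := fun k => G (f k).1 (f k).2) _) _.
  move=> x [m _ /(proj1 (PG m)) [j _ xj]].
  have [_ _ /(_ (m, j) Logic.I) [k _ fk]] := bf.
  by exists k => //; rewrite fk.
rewrite nneseries_esumT; last by move=> k; exact: vol0.
rewrite -(reindex_esum setT setT f (fun ij => vol (G ij.1 ij.2)) bf).
have -> : [set: nat * nat] = [set: nat] `*`` (fun=> [set: nat]) by apply/seteqP.
rewrite -(esum_esum (a := fun i j => vol (G i j)))//.
rewrite -nneseries_esumT => [|i]; last exact: esum_ge0.
apply: lee_nneseries => i _ => [_|]; first exact: esum_ge0.
by rewrite -nneseries_esumT//; exact: (PG i).2.
Qed.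

HB.instance Definition _ n := isOuterMeasure.Build R 'rV[R]_n.+1
  (@lebesgue_outer R n.+1) (lebesgue_outer0 n) (@lebesgue_outer_ge0 n.+1)
  (@le_lebesgue_outer n.+1) (@lebesgue_outer_sigma_subadditive n).

Lemma lebesgue_outer_translate n (v : 'rV[R]_n) (E : set 'rV[R]_n) :
  lebesgue_outer [set x | E (x + v)%R] = lebesgue_outer E.
Proof.
suff le v' E' : lebesgue_outer E' <= lebesgue_outer [set x : 'rV[R]_n | E' (x + v')%R].
  apply/eqP; rewrite eq_le le andbT (le_trans (le (- v)%R _))//.
  by apply: le_lebesgue_outer => x /=; rewrite subrK.
apply: le_ereal_inf_tmp => _ [A cov <-].
apply: (le_trans (lebesgue_outer_cover (A := fun j => ((A j).1 + v', (A j).2 + v')%R) _)).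
  move=> x Ex; have [|j _ xj] := cov (x - v')%R; first by rewrite /= subrK.
  by exists j => // i /=; have := xj i; rewrite !mxE lerBlDr lerBrDr.
apply: lee_nneseries => j _ => [_|]; first by rewrite lee_fin box_volume_ge0.
rewrite lee_fin le_eqVlt; apply/orP; left; apply/eqP; apply: eq_bigr => i _.
by rewrite !mxE opprD addrACA subrr addr0.
Qed.

(** A half-space cuts every covering box into two boxes whose volumes add up. *)
Lemma half_space_caratheodory n (i : 'I_n.+1) (c : R) :
  (@lebesgue_outer R n.+1).-caratheodory [set x | (x 0%R i <= c)%R].
Proof.
apply: le_caratheodory_measurable => X /=.
apply: le_ereal_inf_tmp => _ [A cov <-].
pose up j : 'rV[R]_n.+1 := \row_l (if l == i then Num.min ((A j).2 0%R l) c else (A j).2 0%R l)%R.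
pose lo j : 'rV[R]_n.+1 := \row_l (if l == i then Num.max ((A j).1 0%R l) c else (A j).1 0%R l)%R.
apply: (@le_trans _ _ (\sum_(0 <= j <oo) (box_volume (A j).1 (up j))%:E +
   \sum_(0 <= j <oo) (box_volume (lo j) (A j).2)%:E)).
  apply: leeD.
    apply: (lebesgue_outer_cover (A := fun j => ((A j).1, up j))) => x [/cov [j _ xj] xc].
    exists j => // l /=; have := xj l; rewrite mxE; case: eqP => [->|//] /andP[-> /=].
    by rewrite le_min => ->.
  apply: (lebesgue_outer_cover (A := fun j => (lo j, (A j).2))) => x [/cov [j _ xj] /= /negP].
  rewrite -ltNge => xc.
  exists j => // l /=; have := xj l; rewrite mxE; case: eqP => [->|//] /andP[+ -> /=].
  by rewrite ge_max => -> /=; rewrite ltW.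
rewrite -nneseriesD; last 2 first.
- by move=> j _ _; rewrite lee_fin box_volume_ge0.
- by move=> j _ _; rewrite lee_fin box_volume_ge0.
apply: lee_nneseries => j _ => [_|]; first by rewrite adde_ge0 ?lee_fin ?box_volume_ge0.
have volE (a b : 'rV[R]_n.+1) : box_volume a b = (Num.max 0 (b 0 i - a 0 i) *
    \prod_(l < n.+1 | l != i) Num.max 0 (b 0 l - a 0 l))%R.
  by rewrite /box_volume (bigD1 i).
rewrite -EFinD lee_fin !volE !mxE eqxx.
set V := (\prod_(l < n.+1 | l != i) Num.max 0 ((A j).2 0%R l - (A j).1 0%R l))%R.
have V0 : (0 <= V)%R by apply: prodr_ge0 => l _; rewrite le_max lexx.
rewrite (eq_bigr (fun l => Num.max 0 ((A j).2 0%R l - (A j).1 0%R l))%R); last first.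
  by move=> l /negbTE li; rewrite mxE li.
rewrite -/V [X in (_ + _ * X)%R](eq_bigr (fun l => Num.max 0 ((A j).2 0%R l - (A j).1 0%R l))%R); last first.
  by move=> l /negbTE li; rewrite mxE li.
rewrite -/V -mulrDl ler_wpM2r//.
set x := (A j).1 _ _; set y := (A j).2 _ _.
by rewrite /Num.max /Num.min; case: (ltP y c); case: (ltP x c) => ? ?;
  do ?case: ifP; lra.
Qed.

End OuterMeasure.

(** * Lebesgue measure on the Borel sets of row vectors *)

Section BorelRowVectors.
Variable R : realType.

Definition rVB n := g_sigma_algebraType (@open 'rV[R]_n).

(** Every open set is a countable union of half-open boxes with rational corners,
    which are built from half-spaces. *)
Lemma preimage_open_measurable d (T : measurableType d) n (f : T -> 'rV[R]_n) :
  (forall i c, measurable [set t | f t 0 i <= c]) ->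
  forall U, open U -> measurable (f @^-1` U).
Proof.
move=> mf U oU.
pose B (a b : 'rV[rat]_n) : set 'rV[R]_n :=
  [set x | forall i, ratr (a 0 i) < x 0 i <= ratr (b 0 i)].
pose F (ab : 'rV[rat]_n * 'rV[rat]_n) : set T :=
  if `[< B ab.1 ab.2 `<=` U >] then f @^-1` B ab.1 ab.2 else set0.
have -> : f @^-1` U = \bigcup_ab F ab.
  apply/seteqP; split => [t Uft|t [ab _]]; last by rewrite /F; case: asboolP => // /[apply].
  have /nbhs_ballP[e /= e0 eU] := open_nbhs_nbhs (conj oU Uft).
  have exl i : exists a : rat, f t 0 i - e < ratr a < f t 0 i.
    have [|a] := @rat_in_itvoo _ (f t 0 i - e) (f t 0 i); first by rewrite ltrBlDr ltrDl.
    by rewrite in_itv /=; exists a.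
  have exr i : exists a : rat, f t 0 i < ratr a < f t 0 i + e.
    have [|a] := @rat_in_itvoo _ (f t 0 i) (f t 0 i + e); first by rewrite ltrDl.
    by rewrite in_itv /=; exists a.
  have [a Ha] := choice exl; have [b Hb] := choice exr.
  exists (\row_i a i, \row_i b i) => //; rewrite /F.
  case: asboolP => /= [_|[]].
    by move=> i; rewrite !mxE; have /andP[_ ->] := Ha i; have /andP[/ltW -> _] := Hb i.
  move=> x /= xB; apply: eU; split=> // i j; rewrite (ord1 i) /ball /= /ball_.
  have := xB j; rewrite !mxE => /andP[x1 x2].
  have /andP[a1 a2] := Ha j; have /andP[b1 b2] := Hb j.
  by rewrite distrC ltr_norml; apply/andP; split; lra.
apply: countable_bigcupT_measurable => [|[a b]]; first exact: countableP.
rewrite /F; case: asboolP => // _.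
have -> : f @^-1` B a b = \bigcap_(i in [set: 'I_n])
    ([set t | f t 0 i <= ratr (b 0 i)] `\` [set t | f t 0 i <= ratr (a 0 i)]).
  apply/seteqP; split => [t Bt i _ | t Bt i] /=.
    by have /andP[t1 t2] := Bt i; split => //; apply/negP; rewrite -ltNge.
  by have [/= ? /negP] := Bt i I; rewrite -ltNge => ?; apply/andP.
by apply: fin_bigcap_measurable => // i _; apply: measurableD.
Qed.

Lemma measurable_to_rVB d (T : measurableType d) n (f : T -> rVB n) :
  (forall i, measurable_fun [set: T] (fun t => (f t : 'rV[R]_n) 0 i)) ->
  measurable_fun [set: T] f.
Proof.
move=> mf; apply: (measurability _ (erefl : @measurable _ (rVB n) = <<s @open 'rV[R]_n >>)).
move=> _ [U oU <-]; rewrite setTI; apply: preimage_open_measurable => // i c.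
rewrite -[X in measurable X]setTI.
exact: (mf i measurableT _ (measurable_itv `]-oo, c])).
Qed.

Lemma continuous_measurable_rVB n (f : 'rV[R]_n -> R) :
  continuous f -> measurable_fun [set: rVB n] (f : rVB n -> R).
Proof.
move=> cf; apply: (measurability _ (RGenOpens.measurableE R)).
move=> _ [_ [a [b ->]] <-]; rewrite setTI; apply: sub_sigma_algebra.
by move/continuousP: cf; apply; exact: interval_open.
Qed.

Lemma measurable_coord n i :
  measurable_fun [set: rVB n] (fun x : rVB n => (x : 'rV[R]_n) 0 i).
Proof. by apply: continuous_measurable_rVB => x; exact: coord_continuous. Qed.

End BorelRowVectors.

Section LebesgueMeasure.
Variables (R : realType) (n : nat).
Local Open Scope ereal_scope.
Local Notation mu := (@lebesgue_outer R n.+1).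

Definition lebesgue_rV (E : set (rVB R n.+1)) : \bar R := lebesgue_outer E.

(** Half-spaces are Caratheodory measurable, and they generate the Borel sets. *)
Lemma open_caratheodory (E : set (rVB R n.+1)) :
  measurable E -> mu.-caratheodory E.
Proof.
move=> mE.
have : measurable_fun [set: caratheodory_type mu] (id : caratheodory_type mu -> rVB R n.+1).
  apply: (measurability _ (erefl : @measurable _ (rVB R n.+1) = <<s @open 'rV[R]_n.+1 >>)).
  move=> _ [U oU <-]; rewrite setTI.
  apply: preimage_open_measurable => // i c; exact: half_space_caratheodory.
by move=> /(_ measurableT _ mE); rewrite setTI.
Qed.

Lemma lebesgue_rV0 : lebesgue_rV set0 = 0. Proof. exact: lebesgue_outer0. Qed.

Lemma lebesgue_rV_ge0 E : 0 <= lebesgue_rV E. Proof. exact: lebesgue_outer_ge0. Qed.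

Lemma lebesgue_rV_sigma_additive : semi_sigma_additive lebesgue_rV.
Proof.
move=> A mA tA _; apply: (@caratheodory_measure_sigma_additive R _ mu) => //.
  by move=> i; exact: open_caratheodory.
apply: bigcup_measurable => i _; exact: open_caratheodory.
Qed.

HB.instance Definition _ := isMeasure.Build _ (rVB R n.+1) R lebesgue_rV
  lebesgue_rV0 lebesgue_rV_ge0 lebesgue_rV_sigma_additive.

End LebesgueMeasure.

(** * Uniqueness of invariant measures *)

Section HaarUniqueness.
Local Open Scope ereal_scope.

Section Pack.
Context d (T : measurableType d) (R : realType) (m : {measure set T -> \bar R}).

(** An alias indexed by the proof, so that a structure can be attached to it. *)
Definition sigma_finite_copy of sigma_finite setT m := m : set T -> \bar R.

Hypothesis sf : sigma_finite setT m.

HB.instance Definition _ := Measure.on (sigma_finite_copy sf).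
HB.instance Definition _ :=
  Measure_isSigmaFinite.Build _ _ _ (sigma_finite_copy sf) sf.

Lemma sigma_finite_pack :
  exists m' : {sigma_finite_measure set T -> \bar R}, forall E, m' E = m E.
Proof. by exists (sigma_finite_copy sf). Qed.

End Pack.

(** Fubini on the set of (x, y) with x + y in E and y in C: its sections at fixed
    y have m1-measure m1 E, while the shift of y by x turns it into the set of
    (x, y) with y in E and y - x in C, whose sections have m1-measure m1 C by the
    symmetry of C. The group structure is given by its operations alone, so that
    the lemma applies to pairs of vectors. *)
Lemma haar_unique d (T : measurableType d) (R : realType)
    (m1 m2 : {sigma_finite_measure set T -> \bar R})
    (add : T -> T -> T) (opp : T -> T) (E C : set T) :
  measurable_fun setT (fun z : T * T => add z.1 z.2) -> measurable_fun setT opp ->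
  (forall x y, add x (add y (opp x)) = y) ->
  (forall y F, measurable F -> m1 [set x | F (add x y)] = m1 F) ->
  (forall y F, measurable F -> m2 [set x | F (add x y)] = m2 F) ->
  (forall x y, C (add x (opp y)) <-> C (add y (opp x))) ->
  measurable E -> measurable C ->
  m1 E * m2 C = m2 E * m1 C.
Proof.
move=> madd mopp addK inv1 inv2 symC mE mC.
have msub : measurable_fun setT (fun z : T * T => add z.2 (opp z.1)).
  apply: (measurableT_comp madd (g := fun z : T * T => (z.2, opp z.1))).
  apply: measurable_fun_pair; first exact: measurable_snd.
  exact: measurableT_comp mopp measurable_fst.
pose S := [set z : T * T | E (add z.1 z.2) /\ C z.2].
pose S' := [set z : T * T | E z.2 /\ C (add z.2 (opp z.1))].
have mS : measurable S.
  rewrite (_ : S = ((fun z : T * T => add z.1 z.2) @^-1` E) `&` (snd @^-1` C))//.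
  apply: measurableI; rewrite -[X in measurable X]setTI; first exact: madd.
  exact: measurable_snd.
have mS' : measurable S'.
  rewrite (_ : S' = (snd @^-1` E) `&` ((fun z : T * T => add z.2 (opp z.1)) @^-1` C))//.
  apply: measurableI; rewrite -[X in measurable X]setTI; last exact: msub.
  exact: measurable_snd.
have fub (U : set (T * T)) : measurable U ->
    \int[m1]_x m2 (xsection U x) = \int[m2]_y m1 (ysection U y).
  move=> mU; have := indic_fubini_tonelli m1 m2 mU.
  by rewrite indic_fubini_tonelli_FE// indic_fubini_tonelli_GE.
have int_indic (m : {measure set T -> \bar R}) (c : \bar R) (U : set T) : 0 <= c -> measurable U ->
    \int[m]_x (c * (\1_U x)%:E) = c * m U.
  move=> c0 mU; have mI : measurable_fun [set: T] (fun x => (\1_U x)%:E : \bar R).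
    by apply/measurable_EFinP/measurable_indic.
  by rewrite (ge0_integralZl m measurableT mI) ?integral_indic ?setIT// => x _; rewrite lee_fin.
(* The sections of S at points of C are translates of E. *)
transitivity (\int[m2]_y m1 (ysection S y)).
  rewrite -(int_indic m2 (m1 E) C (measure_ge0 _ _) mC).
  apply: eq_integral => y _; rewrite indicE; case: (boolP (y \in C)) => yC.
    rewrite mule1 -(inv1 y)//; congr (m1 _); apply/seteqP; split => x /=.
      by move=> Exy; rewrite /ysection /= inE /S /=; split => //; rewrite inE in yC.
    by rewrite /ysection /= inE => -[].
  rewrite mule0 (_ : ysection S y = set0) ?measure0//.
  apply/seteqP; split => x //; rewrite /ysection /= inE => -[_ /= Cy].
  by move/negP: yC; rewrite inE.
rewrite -fub//.
transitivity (\int[m1]_x m2 (xsection S' x)).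
  apply: eq_integral => x _.
  rewrite -(inv2 (opp x)) //; last exact: measurable_xsection.
  congr (m2 _); apply/seteqP; split => y /=; rewrite /xsection /= !inE /S /S' /=.
    by rewrite addK.
  by rewrite addK.
rewrite fub// muleC -(int_indic m2 (m1 C) E (measure_ge0 _ _) mE).
apply: eq_integral => y _.
rewrite indicE; case: (boolP (y \in E)) => yE.
  rewrite mule1; have mCy : measurable [set x | C (add x (opp y))].
    rewrite (_ : [set x | _] = ysection ((fun z : T * T => add z.1 (opp z.2)) @^-1` C) y).
      apply: measurable_ysection; rewrite -[X in measurable X]setTI.
      apply: (measurableT_comp madd (g := fun z : T * T => (z.1, opp z.2))) => //.
      apply: measurable_fun_pair; first exact: measurable_fst.
      exact: measurableT_comp mopp measurable_snd.
    by apply/seteqP; split => x; rewrite /ysection /= inE.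
  rewrite -(inv1 (opp y) C)//; congr (m1 _); apply/seteqP; split => x /=.
    by rewrite /ysection /= inE => -[_ /= ?]; apply/symC.
  by rewrite /ysection /= inE => ?; split; [rewrite inE in yE | apply/symC].
rewrite mule0 (_ : ysection S' y = set0) ?measure0//.
apply/seteqP; split => x //; rewrite /ysection /= inE => -[/= Ey _].
by move/negP: yE; rewrite inE.
Qed.
End HaarUniqueness.

Section Scaling.
Variables (R : realType) (n : nat).
Local Open Scope ereal_scope.
Local Notation V := (rVB R n.+1).
Local Notation leb := (@lebesgue_rV R n : set V -> \bar R).

Lemma measurable_rV_add m :
  measurable_fun setT (fun z : rVB R m * rVB R m => ((z.1 : 'rV_m) + z.2)%R : rVB R m).
Proof.
apply: measurable_to_rVB => i.
under eq_fun do rewrite mxE.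
apply: measurable_funD; apply: (measurableT_comp (measurable_coord i)).
  exact: measurable_fst.
exact: measurable_snd.
Qed.

Lemma measurable_rV_opp m :
  measurable_fun setT (fun z : rVB R m => (- (z : 'rV_m))%R : rVB R m).
Proof.
apply: measurable_to_rVB => i.
under eq_fun do rewrite mxE.
by apply: measurableT_comp => //; exact: measurable_coord.
Qed.

Lemma measurable_rV_lin m p (T : 'M[R]_(m, p)) :
  measurable_fun setT (fun z : rVB R m => ((z : 'rV_m) *m T)%R : rVB R p).
Proof.
apply: measurable_to_rVB => i.
under eq_fun do rewrite mxE.
apply: measurable_sum => j; apply: measurable_funM; last exact: measurable_cst.
exact: measurable_coord.
Qed.

Lemma measurable_box m (a b : 'rV[R]_m) : measurable (box a b : set (rVB R m)).
Proof.
rewrite (_ : box a b = \bigcap_(i in [set: 'I_m])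
  [set x : rVB R m | (a 0 i <= (x : 'rV_m) 0 i <= b 0 i)%R]).
  apply: fin_bigcap_measurable => // i _.
  rewrite -[X in measurable X]setTI.
  have := measurable_coord i measurableT (measurable_itv `[a 0 i, b 0 i]%R).
  exact.
by apply/seteqP; split => [x xab i _|x xab i]; [exact: xab|exact: (xab i I)].
Qed.

Lemma lebesgue_rV_box (a b : 'rV[R]_n.+1) : leb (box a b) = (box_volume a b)%:E.
Proof. exact: lebesgue_outer_box. Qed.

Lemma lebesgue_rV_translate (v : 'rV[R]_n.+1) (E : set V) :
  leb [set x : V | E ((x : 'rV_n.+1) + v)%R] = leb E.
Proof. exact: lebesgue_outer_translate. Qed.

Definition cube m (r : R) : set 'rV[R]_m := box (const_mx (- r)%R) (const_mx r).
Arguments cube : clear implicits.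

Lemma cubeP m r (x : 'rV[R]_m) : cube m r x <-> (forall i, `|x 0%R i| <= r)%R.
Proof. by split=> h i; have := h i; rewrite !mxE ler_norml. Qed.

Lemma bigcup_cube m : \bigcup_k cube m k%:R = setT.
Proof.
apply/seteqP; split => // x _.
exists (Num.truncn (\sum_(i < m) `|x 0%R i|)%R).+1 => //; apply/cubeP => i.
apply: (le_trans _ (ltW (Num.Theory.truncnS_gt _))).
by rewrite (bigD1 i)//= lerDl sumr_ge0.
Qed.

Lemma lebesgue_cube r : (0 <= r)%R -> leb (cube n.+1 r) = ((2 * r) ^+ n.+1)%:E.
Proof.
move=> r0; rewrite lebesgue_rV_box /box_volume; congr EFin.
rewrite (eq_bigr (fun=> 2 * r)%R) ?prodr_const ?card_ord// => i _.
by rewrite !mxE opprK max_r -?mulr2n ?mulr_natl// mulrn_wge0.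
Qed.

Lemma lebesgue_sigma_finite : sigma_finite setT leb.
Proof.
exists (fun k => cube n.+1 k%:R); first by rewrite bigcup_cube.
move=> k; split; first exact: measurable_box.
by rewrite lebesgue_cube// ltry.
Qed.

HB.instance Definition _ := Measure_isSigmaFinite.Build _ V R leb lebesgue_sigma_finite.

Lemma finite_on_cubes_sigma_finite m (mu : {measure set (rVB R m) -> \bar R}) :
  (forall k, mu (cube m k%:R) < +oo) -> sigma_finite setT mu.
Proof.
move=> fin; exists (fun k => cube m k%:R); first by rewrite bigcup_cube.
by move=> k; split => //; exact: measurable_box.
Qed.

(** The constant is read off on the cube of half-side 1. *)
Lemma haar_lebesgue (mu : {measure set V -> \bar R}) :
  (forall k, mu (cube n.+1 k%:R) < +oo) ->
  (forall (v : 'rV_n.+1) (E : set V), measurable E -> mu [set x : V | E ((x : 'rV_n.+1) + v)%R] = mu E) ->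
  exists2 c : R, (0 <= c)%R & forall E : set V, measurable E -> mu E = c%:E * leb E.
Proof.
move=> fin inv.
have [mu' mu'E] := sigma_finite_pack (finite_on_cubes_sigma_finite fin).
have c1 := lebesgue_cube ler01; rewrite mulr1 in c1.
have fin1 : mu (cube n.+1 1) \is a fin_num by rewrite ge0_fin_numE; [exact: (fin 1%N)|exact: measure_ge0].
exists (fine (mu (cube n.+1 1)) / 2 ^+ n.+1)%R.
  by rewrite divr_ge0 ?exprn_ge0// fine_ge0.
move=> E mE.
have := @haar_unique _ V R mu' (lebesgue_rV (n := n))
  (fun x y => ((x : 'rV_n.+1) + (y : 'rV_n.+1))%R) (fun x => (- (x : 'rV_n.+1))%R)
  E (cube n.+1 1) (@measurable_rV_add _) (@measurable_rV_opp _).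
move=> /(_ _ _ _ _ mE (measurable_box _ _)) H.
have {}H : mu E * (2 ^+ n.+1)%:E = leb E * mu (cube n.+1 1).
  rewrite -c1 -!mu'E; apply: H => [x y|y F mF|y F mF|x y].
  - by rewrite addrCA subrr addr0.
  - by rewrite !mu'E; exact: inv.
  - exact: lebesgue_rV_translate.
  - by split=> /cubeP H; apply/cubeP => i; have := H i; rewrite !mxE distrC.
have p2 : (0 < (2 ^+ n.+1 : R))%R by rewrite exprn_gt0.
rewrite EFinM fineK// muleC muleA -H -muleA -EFinM divff ?mule1//.
Qed.

End Scaling.
Arguments cube {R} m r.

(** * Lebesgue measure and determinants *)

Section Determinant.
Variables (R : realType) (n : nat).
Local Notation V := (rVB R n.+1).
Local Notation leb := (@lebesgue_rV R n).

(** The preimage of a set under x |-> x T is measured, so c stands for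
    1 / |det T|. *)
Definition scales (T : 'M[R]_n.+1) (c : R) := forall E : set V, measurable E ->
  leb [set x : V | E (((x : 'rV_n.+1) *m T)%R : V)] = (c%:E * leb E)%E.

(** The pullback of Lebesgue measure is again invariant under translations. *)
Lemma scales_ex T : T \in unitmx -> exists2 c, (0 <= c)%R & scales T c.
Proof.
move=> uT.
pose mu := measure_function_pushforward__canonical__measure_function_Measure
  leb (measurable_rV_lin T).
have [||c c0 Hc] := @haar_lebesgue R n mu; last by exists c.
  move=> k.
  pose M := (\sum_i \sum_j `|invmx T i j|)%R.
  have M0 : (0 <= M)%R by apply: sumr_ge0 => i _; exact: sumr_ge0.
  apply: (@le_lt_trans _ _ (leb (cube n.+1 (k%:R * M)))).
    apply: le_lebesgue_outer => x /= /cubeP xk; apply/cubeP => i.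
    rewrite -[x](mulmxK uT) mxE (le_trans (ler_norm_sum _ _ _))// mulr_sumr ler_sum// => j _.
    rewrite normrM ler_pM// (bigD1 i)//= lerDl sumr_ge0//.
  by rewrite lebesgue_cube ?mulr_ge0// ltry.
move=> v E mE; rewrite /mu /= /pushforward.
rewrite -[RHS](lebesgue_rV_translate (v *m invmx T)); congr lebesgue_rV.
by apply/seteqP; split => x /=; rewrite mulmxDl mulmxKV.
Qed.

Lemma lebesgue_cube1 : leb (cube n.+1 1) = (2 ^+ n.+1)%:E.
Proof. by rewrite lebesgue_cube// mulr1. Qed.

Lemma scales_uniq T c c' : scales T c -> scales T c' -> c = c'.
Proof.
move=> h h'; have mC := measurable_box (const_mx (- 1)%R : 'rV[R]_n.+1) (const_mx 1%R).
have := h _ mC; rewrite (h' _ mC) -/(cube n.+1 1) lebesgue_cube1 -!EFinM => -[].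
by move/mulIf => -> //; rewrite expf_neq0.
Qed.

Lemma preimage_lin_measurable (T : 'M[R]_n.+1) (E : set V) :
  measurable E -> measurable [set x : V | E (((x : 'rV_n.+1) *m T)%R : V)].
Proof. by move=> mE; rewrite -[X in measurable X]setTI; exact: measurable_rV_lin. Qed.

Lemma scalesM T S c c' : scales T c -> scales S c' -> scales (T *m S)%R (c * c')%R.
Proof.
move=> hT hS E mE; have := hT _ (preimage_lin_measurable S mE).
by rewrite /= hS// muleA -EFinM => <-; congr leb; apply/seteqP; split => x /=; rewrite mulmxA.
Qed.

Lemma scales1 : scales 1%:M%R 1%R.
Proof.
by move=> E mE; rewrite mul1e; congr leb; apply/seteqP; split => x /=; rewrite mulmx1.
Qed.

Lemma bernoulli_le (e : R) k : (0 <= e <= 1)%R -> (1 - k%:R * e <= (1 - e) ^+ k)%R.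
Proof.
move=> /andP[e0 e1]; elim: k => [|k IH]; first by rewrite mul0r subr0 expr0.
have k0 : (0 <= k%:R * e * e)%R by rewrite !mulr_ge0.
rewrite exprS; have : ((1 - e) * (1 - k%:R * e) <= (1 - e) * (1 - e) ^+ k)%R.
  by rewrite ler_wpM2l// subr_ge0.
apply: le_trans; rewrite -natr1; nra.
Qed.

(** Conjugation by diag(t ^ w) does not change the factor and, as t tends to 0,
    makes the off-diagonal entries as small as wanted. The preimage of the unit
    cube then contains the box of half-sides (1 - e) / |T i i|. *)
Lemma scales_triangular (w : 'I_n.+1 -> nat) (T : 'M[R]_n.+1) c :
  (forall i j, i != j -> T i j != 0%R -> (w j < w i)%N) ->
  (forall i, T i i != 0%R) -> T \in unitmx -> (0 <= c)%R ->
  scales T c -> (\prod_i `|T i i|^-1 <= c)%R.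
Proof.
move=> wT Tii uT c0 hc.
set P := (\prod_i _)%R.
have P0 : (0 < P)%R by apply: prodr_gt0 => i _; rewrite invr_gt0 normr_gt0.
suff key e : (0 < e <= 1)%R -> ((1 - e) ^+ n.+1 * P <= c)%R.
  apply/ler_addgt0Pl => d d0.
  pose e := Num.min 1%R (d / (n.+1%:R * P)).
  have nP : (0 < n.+1%:R * P)%R by rewrite mulr_gt0.
  have e01 : (0 < e <= 1)%R.
    by rewrite /e lt_min ltr01 divr_gt0//= ge_min lexx.
  apply: (@le_trans _ _ ((1 - n.+1%:R * e) * P + d)%R).
    rewrite mulrBl mul1r -addrA lerDl addrC subr_ge0 mulrAC mulrC.
    have : (e <= d / (n.+1%:R * P))%R by rewrite /e ge_min lexx orbT.
    by rewrite ler_pdivlMr.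
  rewrite addrC lerD2l; apply: le_trans (key _ e01); rewrite (ler_wpM2r (ltW P0))//.
  by apply: bernoulli_le; case/andP: e01 => /ltW -> ->.
move=> /andP[e0 e1].
pose M := (\sum_i \sum_j `|T i i|^-1 * `|T i j|)%R.
(* M bounds the off-diagonal entries relative to the diagonal ones. *)
have M0 : (0 <= M)%R.
  by apply: sumr_ge0 => i _; apply: sumr_ge0 => j _; rewrite mulr_ge0// invr_ge0.
have [t /andP[t0 t1] tM] : exists2 t : R, (0 < t < 1)%R & (t * M <= e)%R.
  exists (Num.min (1 / 2) (e / (M + 1)))%R.
    rewrite lt_min gt_min divr_gt0//= divr_gt0 ?ltr_wpDl//=.
    by apply/orP; left; lra.
  apply: (@le_trans _ _ (e / (M + 1) * M)%R).
    by rewrite ler_wpM2r// ge_min lexx orbT.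
  rewrite mulrAC ler_pdivrMr ?ltr_wpDl// ler_wpM2l ?(ltW e0)//.
  by rewrite lerDl.
pose D : 'M[R]_n.+1 := diag_mx (\row_i t ^+ w i)%R.
pose D' : 'M[R]_n.+1 := diag_mx (\row_i (t ^+ w i)^-1)%R.
have DD' : (D *m D' = 1%:M)%R.
  rewrite mulmx_diag -diag_const_mx; congr diag_mx; apply/rowP => i.
  by rewrite !mxE divff// expf_neq0// gt_eqF.
have [uD uD'] : D \in unitmx /\ D' \in unitmx by exact: mulmx1_unit.
have [d d0 hd] := scales_ex uD; have [d' d'0 hd'] := scales_ex uD'.
have dd' : (d * d' = 1)%R.
  by apply: (scales_uniq (T := 1%:M%R)) scales1; rewrite -DD'; exact: scalesM.
pose T' := (D *m T *m D')%R.
have hT' : scales T' c.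
  have -> : c = (d * c * d')%R by rewrite mulrAC dd' mul1r.
  by apply: scalesM => //; exact: scalesM.
have T'E i j : T' i j = (t ^+ w i * T i j / t ^+ w j)%R.
  by rewrite /T' mul_mx_diag mxE mul_diag_mx !mxE.
have T'ii i : T' i i = T i i by rewrite T'E mulrAC divff ?mul1r// expf_neq0// gt_eqF.
have T'ij i j : i != j -> (`|T' i j| <= t * `|T i j|)%R.
  move=> ij; have [T0|Tij] := eqVneq (T i j) 0%R.
    by rewrite T'E T0 mulr0 mul0r normr0 mulr0.
  have wij := wT _ _ ij Tij.
  rewrite T'E mulrAC normrM ler_wpM2r// -expfB// ger0_norm ?exprn_ge0 ?(ltW t0)//.
  have -> : (w i - w j = (w i - w j).-1.+1)%N by rewrite prednK// subn_gt0.
  by rewrite exprS ler_piMr ?(ltW t0)// exprn_ile1// ltW.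
pose h : 'rV[R]_n.+1 := (\row_i ((1 - e) / `|T i i|))%R.
have h0 i : (0 <= h 0%R i)%R by rewrite mxE divr_ge0// subr_ge0.
have sub : box (- h)%R h `<=` [set x | cube n.+1 1 (x *m T')%R].
  move=> x xh; apply/cubeP => j.
  have {}xh i : (`|x 0%R i| <= h 0%R i)%R by have := xh i; rewrite mxE ler_norml.
  rewrite mxE (bigD1 j)//= (le_trans (ler_normD _ _))// T'ii.
  apply: (@le_trans _ _ ((1 - e) + t * M)%R); last first.
    by rewrite -lerBrDl opprB addrCA subrr addr0.
  apply: lerD.
    by rewrite normrM -ler_pdivlMr ?normr_gt0//; have := xh j; rewrite mxE.
  rewrite (le_trans (ler_norm_sum _ _ _))//.
  apply: (@le_trans _ _ (\sum_(i | i != j) t * (`|T i i|^-1 * `|T i j|))%R).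
    apply: ler_sum => i ij; rewrite normrM mulrCA; apply: ler_pM => //; last exact: T'ij.
    apply: (le_trans (xh i)); rewrite mxE ler_piMl ?invr_ge0//.
    by rewrite gerBl ltW.
  rewrite -mulr_sumr ler_wpM2l ?(ltW t0)//.
  rewrite /M exchange_big/= (bigD1 (F := fun j => \sum_i _) j)//=.
  rewrite ler_wpDr//.
    apply: sumr_ge0 => i _; apply: sumr_ge0 => l _; rewrite mulr_ge0// invr_ge0//.
  rewrite [leRHS](bigD1 j)//= lerDr mulr_ge0// invr_ge0//.
have := le_lebesgue_outer sub.
have mC : measurable (cube n.+1 1 : set V) by exact: measurable_box.
rewrite lebesgue_outer_box -[X in (_ <= X)%E -> _]/(leb [set x : V | cube n.+1 1 (((x : 'rV_n.+1) *m T')%R : V)]).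
rewrite hT'// lebesgue_cube1 -EFinM lee_fin /box_volume.
rewrite (eq_bigr (fun i => 2 * ((1 - e) * `|T i i|^-1)))%R; last first.
  by move=> i _; have := h0 i; rewrite !mxE opprK => hi; rewrite max_r ?addr_ge0// -mulr2n mulr_natl.
rewrite !big_split/= !prodr_const !card_ord -/P mulrC ler_pM2r ?exprn_gt0//.
Qed.

(** LUP factorization: permutations preserve the unit cube, and both triangular
    factors obey the previous bound. *)
Lemma scales_det_le T c : T \in unitmx -> (0 <= c)%R -> scales T c ->
  `|\det T|^-1 <= c.
Proof.
move=> uT c0 hc.
have [P [L [U [PT detL Llow Uupp [s Ps]]]]] : exists P L U : 'M[R]_n.+1,
    [/\ P *m T = L *m U, \det L = 1, forall i j : 'I_n.+1, (i <= j)%N -> L i j = (i == j)%:R,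
        forall i j : 'I_n.+1, (j < i)%N -> U i j = 0 & exists s, P = perm_mx s].
  exists (cormen_lup T).1.1, (cormen_lup T).1.2, (cormen_lup T).2; split.
  - by have := cormen_lup_correct T; case: cormen_lup => [[]].
  - exact: cormen_lup_detL.
  - exact: cormen_lup_lower.
  - exact: cormen_lup_upper.
  - by have /is_perm_mxP := cormen_lup_perm T.
have uP : P \in unitmx by rewrite Ps unitmx_perm.
have uL : L \in unitmx by rewrite unitmxE detL unitr1.
have detLU : \det P * \det T = \det U by rewrite -det_mulmx PT det_mulmx detL mul1r.
have uU : U \in unitmx.
  by rewrite unitmxE -detLU unitrM -!unitmxE uP uT.
have [l l0 hl] := scales_ex uL; have [u u0 hu] := scales_ex uU.
have hP : scales P 1.
  have [c' c'0 hc'] := scales_ex uP.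
  rewrite (_ : 1 = c')//; have := hc' (cube n.+1 1) (measurable_box _ _).
  rewrite (_ : [set x | _] = cube n.+1 1).
    by rewrite lebesgue_cube1 -EFinM => -[/esym/(canRL (mulfK _)) -> ]; rewrite ?divff// expf_neq0.
  have xP (x : 'rV[R]_n.+1) i : (x *m P) 0 i = x 0 ((s^-1)%g i).
    by rewrite Ps -[in LHS](invgK s) -col_permE mxE.
  apply/seteqP; split => x /= /cubeP x1; apply/cubeP => i.
    by have := x1 (s i); rewrite xP permK.
  by rewrite xP.
have lu : l * u = c.
  have := scalesM hP hc; rewrite PT mul1r => h; exact: scales_uniq (scalesM hl hu) h.
have l1 : 1 <= l.
  have := scales_triangular (w := fun i : 'I_n.+1 => i : nat) _ _ uL l0 hl.
  rewrite big1 => [|i _]; last by rewrite Llow// eqxx normr1 invr1.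
  apply=> [i j ij|i]; last by rewrite Llow// eqxx oner_neq0.
  by apply: contraR; rewrite -leqNgt => /Llow ->; rewrite (negbTE ij).
have detU : \det U = \prod_i U i i.
  rewrite -det_tr det_trig; last first.
    by apply/is_trig_mxP => i j ij; rewrite mxE Uupp.
  by apply: eq_bigr => i _; rewrite mxE.
have Uii i : U i i != 0.
  have : \det U != 0 by move: uU; rewrite unitmxE unitfE.
  by rewrite detU; apply: contraNneq => Ui; rewrite (bigD1 i)//= Ui mul0r.
have u1 : \prod_i `|U i i|^-1 <= u.
  apply: (scales_triangular (w := fun i : 'I_n.+1 => (n - i)%N)) hu => // i j ij.
  have [ji|ij' _] := ltnP j i; first by rewrite Uupp// eqxx.
  apply: ltn_sub2l; last by rewrite ltn_neqAle ij.
  by rewrite (leq_trans _ (ltn_ord j : (j <= n)%N))// ltn_neqAle ij.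
have -> : `|\det T| = `|\det U|.
  by rewrite -detLU Ps det_perm normrM normrX normrN1 expr1n mul1r.
rewrite -lu detU normr_prod -prodfV (le_trans u1)//.
by rewrite ler_peMl.
Qed.

(** The factor is multiplicative, so the lower bounds for T and for its inverse
    force equality. *)
Lemma lebesgue_rV_lin (T : 'M[R]_n.+1) : T \in unitmx -> scales T `|\det T|^-1.
Proof.
move=> uT; have [c c0 hc] := scales_ex uT.
have uT' : invmx T \in unitmx by rewrite unitmx_inv.
have [c' c'0 hc'] := scales_ex uT'.
have cc' : c * c' = 1.
  by apply: (scales_uniq (T := 1%:M)) scales1; rewrite -(mulmxV uT); exact: scalesM.
have d0 : 0 < `|\det T| by rewrite normr_gt0 -unitfE -unitmxE.
have h1 := scales_det_le uT c0 hc.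
have h2 := scales_det_le uT' c'0 hc'; rewrite det_inv normfV invrK in h2.
suff -> : `|\det T|^-1 = c by [].
apply/eqP; rewrite eq_le h1 /= -[leRHS]mul1r ler_pdivlMr// -cc'.
by rewrite ler_wpM2l.
Qed.

(** For arbitrary sets, covers are transported: a box becomes a Borel set of known
    measure. *)
Lemma lebesgue_outer_lin (T : 'M[R]_n.+1) (E : set 'rV[R]_n.+1) : T \in unitmx ->
  lebesgue_outer [set x | E (x *m T)] = (`|\det T|^-1%:E * lebesgue_outer E)%E.
Proof.
have le (S : 'M[R]_n.+1) (F : set 'rV[R]_n.+1) : S \in unitmx ->
    (`|\det S|%:E * lebesgue_outer [set x | F (x *m S)] <= lebesgue_outer F)%E.
  move=> uS; apply: le_ereal_inf_tmp => _ [A cov <-].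
  have d0 : 0 < `|\det S| by rewrite normr_gt0 -unitfE -unitmxE.
  rewrite muleC -lee_pdivlMr//.
  rewrite muleC -nneseriesZl//; last by move=> j _; rewrite lee_fin box_volume_ge0.
  apply: (@le_trans _ _ (lebesgue_outer (\bigcup_j [set x | box (A j).1 (A j).2 (x *m S)]))).
    by apply: le_lebesgue_outer => x /= /cov [j _ xj]; exists j.
  apply: (le_trans (lebesgue_outer_sigma_subadditive _)).
  apply: lee_nneseries => j _ => [_|]; first exact: lebesgue_outer_ge0.
  by have := lebesgue_rV_lin uS (measurable_box (A j).1 (A j).2); rewrite lebesgue_rV_box => <-.
move=> uT; have d0 : 0 < `|\det T| by rewrite normr_gt0 -unitfE -unitmxE.
apply/eqP; rewrite eq_le; apply/andP; split.
  by rewrite muleC lee_pdivlMr// muleC le.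
have uT' : invmx T \in unitmx by rewrite unitmx_inv.
have := le _ [set x | E (x *m T)] uT'; rewrite det_inv normfV.
by rewrite (_ : [set x | _] = E)//; apply/seteqP; split => x /=; rewrite mulmxKV.
Qed.

(** The coordinate hyperplane is covered by boxes of zero volume. *)
Lemma lebesgue_outer_hyperplane (i : 'I_n.+1) :
  lebesgue_outer [set x : 'rV[R]_n.+1 | x 0 i = 0] = 0%E.
Proof.
apply/eqP; rewrite eq_le lebesgue_outer_ge0 andbT.
pose b k : 'rV[R]_n.+1 := \row_j if j == i then 0 else k%:R.
apply: (le_trans (lebesgue_outer_cover (A := fun k => (- b k, b k)) _)).
  move=> x /= xi0; have : (\bigcup_k cube n.+1 k%:R) x by rewrite bigcup_cube.
  case=> k _ /cubeP xk; exists k => //= j; rewrite !mxE -ler_norml.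
  by case: eqP => [->|]; rewrite ?xi0 ?normr0 ?xk.
rewrite eseries0// => k _ _; rewrite /box_volume (bigD1 i)//=.
by rewrite !mxE eqxx oppr0 subr0 max_l// mul0r.
Qed.

(** Gaussian elimination moves the range into a coordinate hyperplane. *)
Lemma lebesgue_outer_singular (T : 'M[R]_n.+1) : T \notin unitmx ->
  lebesgue_outer (range (fun x : 'rV[R]_n.+1 => x *m T)) = 0%E.
Proof.
move=> sT; apply/eqP; rewrite eq_le lebesgue_outer_ge0 andbT.
have rT : (\rank T < n.+1)%N.
  by rewrite ltn_neqAle rank_leq_row andbT; move: sT; rewrite -row_free_unit.
pose H := [set x : 'rV[R]_n.+1 | x 0 ord_max = 0].
have uU := row_ebase_unit T.
apply: (@le_trans _ _ (lebesgue_outer [set x | H (x *m invmx (row_ebase T))])).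
  apply: le_lebesgue_outer => _ [x _ <-] /=.
  rewrite -{1}(mulmx_ebase T) !mulmxA mulmxK// /H /=.
  rewrite mxE big1// => j _; rewrite [pid_mx _ _ _]mxE.
  case: eqP => /= [->|_]; last by rewrite mulr0.
  by rewrite ltnNge -ltnS rT mulr0.
by rewrite lebesgue_outer_lin ?unitmx_inv// lebesgue_outer_hyperplane mule0.
Qed.

End Determinant.

(** * Conjugation and real coordinates of scalars *)

Section ScalarFacts.
Variable R : realType.
Variable k : scalar_kind.
Local Notation K := (scalars R k).
Local Notation d := (dimR k).
Local Notation re := (@of_real R k).
Local Notation conj := (@conjs R k).

Definition realpart : forall k, scalars R k -> R := fun k =>
  match k with
  | RealS => fun x => x
  | ComplexS => fun x => complex.Re x
  | QuaternionS => fun x => qre x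
  end.

Definition sqnorm (x : K) : R := \sum_i (scoord x 0 i) ^+ 2.

Lemma dimR_gt0 : (0 < d)%N. Proof. by case: k. Qed.

Lemma conjsK : involutive conj.
Proof.
case: k => [x|[x y]|[x y z t]] //=; first by rewrite /conjc opprK.
by rewrite /conjq /= !opprK.
Qed.

Lemma conjsD x y : conj (x + y) = conj x + conj y.
Proof.
case: k x y => [x y|x y|[????] [????]] //=; first by rewrite rmorphD.
by rewrite /conjq; congr Quat => /=; rewrite ?opprD.
Qed.

Lemma conjs0 : conj 0 = 0.
Proof. by apply: (@addrI _ (conj 0)); rewrite -conjsD !addr0. Qed.

Lemma conjsN x : conj (- x) = - conj x.
Proof. by apply: (@addrI _ (conj x)); rewrite -conjsD !subrr conjs0. Qed.

Lemma conjs_sum I r (P : pred I) (F : I -> K) :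
  conj (\sum_(i <- r | P i) F i) = \sum_(i <- r | P i) conj (F i).
Proof. exact: (big_morph _ conjsD conjs0). Qed.

Lemma conjsM x y : conj (x * y) = conj y * conj x.
Proof.
case: k x y => [x y|x y|[????] [????]] /=; first exact: (mulrC (x : R)).
  by rewrite rmorphM mulrC.
by congr Quat => /=; ring.
Qed.

Lemma conjs1 : conj 1 = 1.
Proof.
by case: k => //=; [congr Complex; exact: oppr0 | congr Quat => /=; rewrite oppr0].
Qed.

Lemma of_realD x y : re (x + y) = re x + re y.
Proof.
by case: k => //=; [rewrite rmorphD | congr Quat => /=; rewrite addr0].
Qed.

Lemma of_realM x y : re (x * y) = re x * re y.
Proof.
by case: k => //=; [rewrite rmorphM | congr Quat => /=; ring].
Qed.

Lemma of_real1 : re 1 = 1.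
Proof. by case: k. Qed.

Lemma of_real0 : re 0 = 0.
Proof. by apply: (@addrI _ (re 0)); rewrite -of_realD !addr0. Qed.

Lemma of_realC r x : re r * x = x * re r.
Proof.
case: k x => [x|x|[????]] /=; [exact: (mulrC r) | by rewrite mulrC |].
by congr Quat => /=; ring.
Qed.

Lemma conjs_of_real r : conj (re r) = re r.
Proof.
by case: k => //=; [rewrite /conjc oppr0 | congr Quat => /=; rewrite oppr0].
Qed.

Lemma scoordD x y : @scoord R k (x + y) = @scoord R k x + @scoord R k y.
Proof.
case: k x y => [x y|x y|[????] [????]] /=; apply/rowP => i; rewrite !mxE//.
- by case: x y => [??] [??] /=; case: i => -[|[|]].
- by case: i => -[|[|[|[|]]]].
Qed.

Lemma scoordZ r x : @scoord R k (re r * x) = r *: @scoord R k x.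
Proof.
case: k x => [x|x|[????]] /=; apply/rowP => i; rewrite !mxE//.
- by case: x => [??] /=; case: i => -[|[|]] //= _; ring.
- by case: i => -[|[|[|[|]]]] //= _; ring.
Qed.

Lemma realpartD x y : @realpart k (x + y) = @realpart k x + @realpart k y.
Proof. by case: k x y => [x y|[??] [??]|[????] [????]]. Qed.

Lemma realpart0 : @realpart k (0 : K) = 0.
Proof. by apply: (@addrI _ (@realpart k (0 : K))); rewrite -realpartD !addr0. Qed.

Lemma realpart_sum I r (P : pred I) (F : I -> K) :
  @realpart k (\sum_(i <- r | P i) F i) = \sum_(i <- r | P i) @realpart k (F i).
Proof. exact: (big_morph _ realpartD realpart0). Qed.

Lemma realpart_of_real r : @realpart k (re r) = r.
Proof. by case: k. Qed.

Lemma realpart_dot (x y : K) :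
  @realpart k (conj x * y) = \sum_i @scoord R k x 0 i * @scoord R k y 0 i.
Proof.
case: k x y => [x y|[??] [??]|[????] [????]] /=;
  rewrite !big_ord_recl big_ord0 !mxE /= ?addr0 //; ring.
Qed.

Lemma sqnorm_ge0 x : 0 <= sqnorm x.
Proof. by apply: sumr_ge0 => i _; exact: sqr_ge0. Qed.

Lemma conjs_mul x : conj x * x = re (sqnorm x).
Proof.
rewrite /sqnorm; case: k x => [x|[x y]|[????]] /=;
  rewrite !big_ord_recl big_ord0 !mxE /= ?addr0 //.
  by apply/eqP; rewrite eq_complex /=; apply/andP; split; apply/eqP; ring.
by congr Quat => /=; ring.
Qed.

Lemma sqnorm_eq0 x : sqnorm x = 0 -> x = 0.
Proof.
move=> x0; apply: (can_inj (@scoordK R k)); apply/rowP => i.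
have : (@scoord R k x 0 i) ^+ 2 = 0.
  have /psumr_eq0P := x0; apply => // j _; exact: sqr_ge0.
move/eqP; rewrite sqrf_eq0 => /eqP ->.
by rewrite -(of_real0) -[of_real k 0]mulr1 scoordZ scale0r mxE.
Qed.

(** The phase of x is x / |x|, and 1 when x = 0. *)
Lemma phase_exists (x : K) : exists u t,
  [/\ conj u * u = 1, 0 <= t & conj u * x = re t].
Proof.
have [->|x0] := eqVneq (x : K) 0.
  by exists 1, 0; rewrite conjs1 mulr1 mulr0 of_real0.
have s0 : 0 < sqnorm x.
  by rewrite lt_neqAle sqnorm_ge0 andbT eq_sym; apply: contra_neq x0 => /sqnorm_eq0.
set t := Num.sqrt (sqnorm x).
have t0 : 0 < t by rewrite sqrtr_gt0.
have tt : t * t = sqnorm x by rewrite -expr2 sqr_sqrtr// ltW.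
exists (x * re t^-1), t; rewrite (ltW t0) conjsM conjs_of_real.
split=> //; rewrite -mulrA.
  by rewrite [conj x * _]mulrA conjs_mul -!of_realM -tt mulfK ?gt_eqF// mulVf ?gt_eqF// of_real1.
by rewrite conjs_mul -!of_realM -tt mulrA mulVf ?gt_eqF// mul1r.
Qed.

End ScalarFacts.

(** * Adjoints, real forms and real determinants *)

Lemma det_conj (R : comNzRingType) m n (e : m = n) (J : 'M[R]_(m, n)) (J' : 'M[_]_(n, m)) M :
  J *m J' = 1%:M -> \det (J *m M *m J') = \det M.
Proof.
case: n / e J J' M => J J' M JJ'.
by rewrite !det_mulmx mulrAC -det_mulmx JJ' det1 mul1r.
Qed.

Lemma det_mx_size0 (R : comNzRingType) m (M : 'M[R]_m) : m = 0%N -> \det M = 1.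
Proof. by move=> m0; move: M; rewrite m0 => M; rewrite det_mx00. Qed.

Lemma eq_mulmxl (R : nzRingType) m n (A B : 'M[R]_(m, n)) :
  (forall v : 'rV_m, v *m A = v *m B) -> A = B.
Proof. by move=> AB; apply/row_matrixP => i; rewrite !rowE AB. Qed.

Lemma sum_mxvec (V : nmodType) m n (F : 'I_(m * n) -> V) :
  \sum_x F x = \sum_i \sum_j F (mxvec_index i j).
Proof.
rewrite pair_bigA /= (reindex _ (curry_mxvec_bij m n)) /=.
by apply: eq_bigr => -[i j] _.
Qed.

Section RealForms.
Variables (R : realType) (k : scalar_kind).
Local Notation K := (scalars R k).
Local Notation d := (dimR k).
Local Notation re r := (@of_real R k r)%:M.

Lemma adjK m n (X : 'M[K]_(m, n)) : adj (adj X) = X.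
Proof. by apply/matrixP => i j; rewrite !mxE conjsK. Qed.

Lemma adjD m n (X Y : 'M[K]_(m, n)) : adj (X + Y) = adj X + adj Y.
Proof. by apply/matrixP => i j; rewrite !mxE conjsD. Qed.

Lemma adjN m n (X : 'M[K]_(m, n)) : adj (- X) = - adj X.
Proof. by apply/matrixP => i j; rewrite !mxE conjsN. Qed.

Lemma adj0 m n : adj (0 : 'M[K]_(m, n)) = 0.
Proof. by apply/matrixP => i j; rewrite !mxE conjs0. Qed.

Lemma adjM m n p (X : 'M[K]_(m, n)) (Y : 'M[K]_(n, p)) :
  adj (X *m Y) = adj Y *m adj X.
Proof.
apply/matrixP => i j; rewrite !mxE conjs_sum; apply: eq_bigr => l _.
by rewrite !mxE conjsM.
Qed.

Lemma adj_scalar n (x : K) : adj (x%:M : 'M[_]_n) = (conjs x)%:M.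
Proof. by apply/matrixP => i j; rewrite !mxE eq_sym; case: eqP => // _; rewrite conjs0. Qed.

Lemma adj1 n : adj (1%:M : 'M[K]_n) = 1%:M.
Proof. by rewrite adj_scalar conjs1. Qed.

Lemma adj_re n r : adj (re r : 'M[K]_n) = re r.
Proof. by rewrite adj_scalar conjs_of_real. Qed.

Lemma adj_col_mx m1 m2 n (X : 'M[K]_(m1, n)) (Y : 'M[_]_(m2, n)) :
  adj (col_mx X Y) = row_mx (adj X) (adj Y).
Proof. by rewrite /adj tr_col_mx map_row_mx. Qed.

Lemma adj_row_mx m n1 n2 (X : 'M[K]_(m, n1)) (Y : 'M[_]_(m, n2)) :
  adj (row_mx X Y) = col_mx (adj X) (adj Y).
Proof. by rewrite /adj tr_row_mx map_col_mx. Qed.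

Lemma adj_block_mx m1 m2 n1 n2 (a : 'M[K]_(m1, n1)) (b : 'M[_]_(m1, n2)) (c : 'M[_]_(m2, n1)) (e : 'M[_]_(m2, n2)) :
  adj (block_mx a b c e) = block_mx (adj a) (adj c) (adj b) (adj e).
Proof. by rewrite /adj tr_block_mx map_block_mx. Qed.

Lemma re_comm m n r (X : 'M[K]_(m, n)) : re r *m X = X *m re r.
Proof.
apply/matrixP => i j; rewrite mul_scalar_mx !mxE (bigD1 j)//= mxE eqxx mulr1n.
rewrite big1 => [|l lj]; first by rewrite addr0 of_realC.
by rewrite mxE (negbTE lj) mulr0.
Qed.

Lemma reM n r s : re (r * s) = re r *m re s :> 'M[K]_n.
Proof. by rewrite of_realM scalar_mxM. Qed.

Lemma re1 n : re 1 = 1%:M :> 'M[K]_n.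
Proof. by rewrite of_real1. Qed.

Lemma reE m n r (X : 'M[K]_(m, n)) i j : (re r *m X) i j = of_real k r * X i j.
Proof. by rewrite mul_scalar_mx mxE. Qed.

Lemma toRE m n (X : 'M[K]_(m, n)) i j l :
  toR X 0 (mxvec_index (mxvec_index i j) l) = scoord (X i j) 0 l.
Proof. by rewrite /toR mxvecE mxE mxvecE. Qed.

Lemma toR_index m n (x : 'I_(m * n * d)) :
  exists i j l, x = mxvec_index (mxvec_index i j) l.
Proof. by case/mxvec_indexP: x => ij l; case/mxvec_indexP: ij => i j; exists i, j, l. Qed.

Lemma toR_lin m n r (X Y : 'M[K]_(m, n)) :
  toR (re r *m X + Y) = r *: toR X + toR Y.
Proof.
apply/rowP => x; have [i [j [l ->]]] := toR_index x.
by rewrite [RHS]mxE [X in _ = X + _]mxE !toRE mxE reE scoordD scoordZ !mxE.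
Qed.

Definition real_linear m n m' n' (F : 'M[K]_(m, n) -> 'M[K]_(m', n')) :=
  forall r X Y, F (re r *m X + Y) = re r *m F X + F Y.

(** The matrix of F in the real coordinates, acting on the right of rows. *)
Definition rmx m n m' n' (F : 'M[K]_(m, n) -> 'M[K]_(m', n')) :=
  lin1_mx (fun v : 'rV[R]_(m * n * d) => toR (F (ofR v))).

Lemma toR_rmx m n m' n' (F : 'M[K]_(m, n) -> 'M[K]_(m', n')) X :
  real_linear F -> toR (F X) = toR X *m rmx F.
Proof.
move=> linF.
have lin : linear (fun v : 'rV[R]_(m * n * d) => toR (F (ofR v))).
  move=> r u v; rewrite -toR_lin -linF; congr (toR (F _)).
  by apply: (can_inj (@toRK R k m n)); rewrite toR_lin !ofRK.
pose G : {linear 'rV[R]_(m * n * d) -> 'rV[R]_(m' * n' * d)} :=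
  HB.pack (fun v => toR (F (ofR v))) (GRing.isLinear.Build R _ _ _ _ lin).
by rewrite /rmx -/(G : _ -> _) (mul_rV_lin1 G) /= toRK.
Qed.

Lemma eq_rmx m n m' n' (F G : 'M[K]_(m, n) -> 'M[K]_(m', n')) :
  F =1 G -> rmx F = rmx G.
Proof. by move=> FG; congr rmx; apply/funext. Qed.

Lemma rmx_comp m n m' n' m'' n'' (F : 'M[K]_(m, n) -> 'M[K]_(m', n'))
    (G : 'M[K]_(m', n') -> 'M[K]_(m'', n'')) :
  real_linear F -> real_linear G -> rmx (G \o F) = rmx F *m rmx G.
Proof.
move=> lF lG; have lGF : real_linear (G \o F) by move=> r X Y /=; rewrite lF lG.
apply: eq_mulmxl => v; rewrite -[v]ofRK mulmxA.
by rewrite -(toR_rmx _ lF) -(toR_rmx _ lG) -(toR_rmx _ lGF).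
Qed.

Lemma real_linear_comp m n m' n' m'' n'' (F : 'M[K]_(m, n) -> 'M[K]_(m', n'))
    (G : 'M[K]_(m', n') -> 'M[K]_(m'', n'')) :
  real_linear F -> real_linear G -> real_linear (G \o F).
Proof. by move=> lF lG r X Y /=; rewrite lF lG. Qed.

Lemma rmx_id m n : rmx (@id 'M[K]_(m, n)) = 1%:M.
Proof.
apply: eq_mulmxl => v; rewrite mulmx1 -{1}[v]ofRK -toR_rmx ?ofRK//.
Qed.

Lemma real_linear_mulmx m n p (x : 'M[K]_(m, n)) :
  real_linear (fun X : 'M[_]_(n, p) => x *m X).
Proof. by move=> r X Y; rewrite mulmxDr mulmxA -re_comm -!mulmxA. Qed.

Lemma real_linear_mulmxr m n p (x : 'M[K]_(n, p)) :
  real_linear (fun X : 'M[_]_(m, n) => X *m x).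
Proof. by move=> r X Y; rewrite mulmxDl !mulmxA. Qed.

Lemma real_linear_adj m n : real_linear (@adj R k m n).
Proof. by move=> r X Y; rewrite adjD adjM adj_re re_comm. Qed.

Lemma real_linear0 m n m' n' : real_linear (fun _ : 'M[K]_(m, n) => 0 : 'M[K]_(m', n')).
Proof. by move=> r X Y; rewrite mulmx0 addr0. Qed.

Lemma rmx0 m n m' n' : rmx (fun _ : 'M[K]_(m, n) => 0 : 'M[K]_(m', n')) = 0.
Proof.
apply: eq_mulmxl => v; rewrite -[v]ofRK -toR_rmx; last exact: real_linear0.
rewrite mulmx0; apply/rowP => x; have [i [j [l ->]]] := toR_index x.
rewrite toRE !mxE; have -> : (0 : K) = of_real k 0 * 0 by rewrite mulr0.
by rewrite scoordZ scale0r mxE.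
Qed.

Lemma toR0 m n : toR (0 : 'M[K]_(m, n)) = 0.
Proof. by have := @toR_rmx _ _ m n (fun _ : 'M[K]_(1, 1) => 0) 0 (@real_linear0 _ _ _ _); rewrite rmx0 mulmx0. Qed.

(** The image of iA is stable under F, which is therefore block triangular for the
    splitting of its domain by iA and iB. *)
Lemma det_rmx_split n1 p1 n2 p2 n p
    (iA : 'M[K]_(n1, p1) -> 'M[K]_(n, p)) (iB : 'M[K]_(n2, p2) -> 'M[K]_(n, p))
    (pA : 'M[K]_(n, p) -> 'M[K]_(n1, p1)) (pB : 'M[K]_(n, p) -> 'M[K]_(n2, p2))
    (F : 'M[K]_(n, p) -> 'M[K]_(n, p)) :
  (n1 * p1 * d + n2 * p2 * d = n * p * d)%N ->
  real_linear iA -> real_linear iB -> real_linear pA -> real_linear pB -> real_linear F ->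
  cancel iA pA -> cancel iB pB -> (forall X, pA (iB X) = 0) -> (forall X, pB (iA X) = 0) ->
  (forall X, pB (F (iA X)) = 0) ->
  \det (rmx F) = \det (rmx (pA \o F \o iA)) * \det (rmx (pB \o F \o iB)).
Proof.
move=> e liA liB lpA lpB lF Ai Bi AB BA FBA.
have lA := real_linear_comp liA lF; have lB := real_linear_comp liB lF.
rewrite -(det_conj e (rmx F) (J := col_mx (rmx iA) (rmx iB)) (J' := row_mx (rmx pA) (rmx pB))).
  rewrite mul_col_mx mul_col_row -!rmx_comp//; do ?exact: real_linear_comp.
  rewrite (eq_rmx (FBA : (pB \o (F \o iA)) =1 (fun _ => 0))) rmx0 det_lblock.
  by [].
rewrite mul_col_row -!rmx_comp// (eq_rmx (Ai : (pA \o iA) =1 id)) (eq_rmx (Bi : (pB \o iB) =1 id)).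
rewrite (eq_rmx (AB : (pA \o iB) =1 (fun _ => 0))) (eq_rmx (BA : (pB \o iA) =1 (fun _ => 0))).
by rewrite !rmx0 !rmx_id -scalar_mx_block.
Qed.

Local Notation iota x := (rmx (fun v : 'cV[K]_ _ => x *m v)).

Lemma detRE n (x : 'M[K]_n) : detR x = \det (iota x). Proof. by []. Qed.

Lemma iotaM m n p (x : 'M[K]_(m, n)) (y : 'M[K]_(n, p)) :
  iota (x *m y) = iota y *m iota x.
Proof.
rewrite -(rmx_comp (@real_linear_mulmx _ _ _ y) (@real_linear_mulmx _ _ _ x)).
by apply: eq_rmx => v /=; rewrite mulmxA.
Qed.

Lemma iota1 n : iota (1%:M : 'M[_]_n) = 1%:M.
Proof. by rewrite -rmx_id; apply: eq_rmx => v; rewrite mul1mx. Qed.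

Lemma detRM n (x y : 'M[K]_n) : detR (x *m y) = detR x * detR y.
Proof. by rewrite !detRE iotaM det_mulmx mulrC. Qed.

Lemma detR1 n : detR (1%:M : 'M[K]_n) = 1.
Proof. by rewrite detRE iota1 det1. Qed.

Lemma toR_dot m n (X Y : 'M[K]_(m, n)) :
  (toR X *m (toR Y)^T) 0 0 = @realpart R k (\tr (adj X *m Y)).
Proof.
rewrite mxE /mxtrace realpart_sum.
under [RHS]eq_bigr => j _.
  rewrite mxE realpart_sum.
  under eq_bigr => i _ do rewrite !mxE realpart_dot.
  over.
rewrite exchange_big /=.
rewrite sum_mxvec sum_mxvec.
apply: eq_bigr => i _; apply: eq_bigr => j _; apply: eq_bigr => l _.
by rewrite mxE !toRE.
Qed.

(** The real part of the trace of X^* Y is the Euclidean inner product of the real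
    coordinates, so the adjoint becomes the transpose. *)
Lemma iota_adj m n (x : 'M[K]_(m, n)) : iota (adj x) = (iota x)^T.
Proof.
have dotC (u v : 'cV[K]_m) : (toR u *m (toR v)^T) = (toR v *m (toR u)^T).
  by apply/matrixP => i j; rewrite !ord1 !mxE; apply: eq_bigr => l _; rewrite !mxE mulrC.
apply: eq_mulmxl => v; apply: trmx_inj; apply: eq_mulmxl => w.
rewrite -[v]ofRK -[w]ofRK -toR_rmx; last exact: real_linear_mulmx.
rewrite trmx_mul trmxK mulmxA -toR_rmx; last exact: real_linear_mulmx.
by apply/matrixP => i j; rewrite !ord1 !toR_dot adjM -mulmxA.
Qed.

Lemma detR_adj n (x : 'M[K]_n) : detR (adj x) = detR x.
Proof. by rewrite !detRE iota_adj det_tr. Qed.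

Lemma iota_inj m n (x y : 'M[K]_(m, n)) : iota x = iota y -> x = y.
Proof.
move=> xy; apply/matrixP => i j.
have : x *m delta_mx j 0 = y *m delta_mx j 0 :> 'cV_m.
  apply: (can_inj (@toRK R k m 1)).
  rewrite (toR_rmx _ (@real_linear_mulmx _ _ _ x)) xy.
  by rewrite -(toR_rmx _ (@real_linear_mulmx _ _ _ y)).
by rewrite -!colE => /colP /(_ i); rewrite !mxE.
Qed.

(** Over a noncommutative ring this needs the embedding into real matrices. *)
Lemma mulmx1_sym n (x y : 'M[K]_n) : x *m y = 1%:M -> y *m x = 1%:M.
Proof.
move=> xy; apply: iota_inj; rewrite iotaM iota1; apply: mulmx1C.
by rewrite -iotaM xy iota1.
Qed.

(** Read off from the adjugate of the real form and divided by the determinant, so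
    that the coordinates are polynomial up to this one division and depend
    measurably on x everywhere. *)
Definition invK n (x : 'M[K]_n) : 'M[K]_n :=
  \matrix_(i, j) (ofR (toR (delta_mx j 0 : 'cV[K]_n) *m ((detR x)^-1 *: \adj (iota x))) : 'cV_n) i 0.

Lemma mulmx_invK n (x : 'M[K]_n) : detR x != 0 -> x *m invK x = 1%:M.
Proof.
move=> dx; have ux : iota x \in unitmx by rewrite unitmxE unitfE.
apply/matrixP => i j.
transitivity ((x *m col j (invK x)) i 0).
  by rewrite !mxE; apply: eq_bigr => l _; congr (_ * _); rewrite !mxE.
have -> : col j (invK x) = ofR (toR (delta_mx j 0 : 'cV[K]_n) *m invmx (iota x)).
  by apply/colP => l; rewrite !mxE /invmx ux.
have -> : x *m ofR (toR (delta_mx j 0 : 'cV[K]_n) *m invmx (iota x)) = delta_mx j 0.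
  apply: (can_inj (@toRK R k n 1)).
  by rewrite (toR_rmx _ (@real_linear_mulmx _ _ _ x)) ofRK mulmxKV.
by rewrite !mxE eqxx andbT.
Qed.

Lemma mulKmx n (x : 'M[K]_n) : detR x != 0 -> invK x *m x = 1%:M.
Proof. by move=> dx; apply: mulmx1_sym; exact: mulmx_invK. Qed.

Lemma GL_detR n (x : 'M[K]_n) : GL x <-> detR x != 0.
Proof.
split=> [[y [xy _]]|dx]; last by exists (invK x); rewrite mulmx_invK// mulKmx.
by have := detR1 n; rewrite -xy detRM => /eqP; apply: contraTneq => ->; rewrite mul0r eq_sym oner_eq0.
Qed.

(** The columns of X are transformed independently. *)
Lemma det_mulmxl n p (x : 'M[K]_n) :
  \det (rmx (fun X : 'M[_]_(n, p) => x *m X)) = detR x ^+ p.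
Proof.
elim: p => [|p IH]; first by rewrite expr0 det_mx_size0// muln0.
rewrite exprS -IH detRE.
have e : (n * 1 * d + n * p * d = n * (1 + p) * d)%N by rewrite -mulnDl -mulnDr.
rewrite (det_rmx_split (iA := fun v => row_mx v 0) (iB := fun X => row_mx 0 X)
   (pA := @lsubmx _ _ _ _) (pB := @rsubmx _ _ _ _) (F := fun X : 'M[_]_(n, 1 + p) => x *m X) e).
- congr (_ * _); congr determinant; apply: eq_rmx => v /=; by rewrite mul_mx_row ?row_mxKl ?row_mxKr.
- by move=> r X Y; rewrite mul_mx_row mulmx0 add_row_mx addr0.
- by move=> r X Y; rewrite mul_mx_row mulmx0 add_row_mx addr0.
- by move=> r X Y; rewrite -{1}[X]hsubmxK -{1}[Y]hsubmxK mul_mx_row add_row_mx row_mxKl.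
- by move=> r X Y; rewrite -{1}[X]hsubmxK -{1}[Y]hsubmxK mul_mx_row add_row_mx row_mxKr.
- exact: real_linear_mulmx.
- by move=> X; rewrite row_mxKl.
- by move=> X; rewrite row_mxKr.
- by move=> X; rewrite row_mxKl.
- by move=> X; rewrite row_mxKr.
- by move=> X; rewrite mul_mx_row mulmx0 row_mxKr.
Qed.

(** Passing to adjoints turns right multiplication by x into left multiplication by
    the adjoint of x. *)
Lemma det_mulmxr n p (x : 'M[K]_p) :
  \det (rmx (fun X : 'M[_]_(n, p) => X *m x)) = detR x ^+ n.
Proof.
rewrite -detR_adj -(det_mulmxl n (adj x)).
have e : (n * p * d = p * n * d)%N by rewrite (mulnC n).
rewrite -(det_conj e (rmx (fun X : 'M[_]_(p, n) => adj x *m X)) (J := rmx (@adj R k n p)) (J' := rmx (@adj R k p n))).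
  rewrite -!rmx_comp; do ?[exact: real_linear_adj|exact: real_linear_mulmx|apply: real_linear_comp].
  by congr (\det _); apply: eq_rmx => X /=; rewrite adjM !adjK.
rewrite -rmx_comp; do ?exact: real_linear_adj.
by rewrite -rmx_id; apply: eq_rmx => X /=; rewrite adjK.
Qed.

Lemma detR_block p q (a : 'M[K]_p) (x : 'M[_]_(p, q)) (b : 'M[_]_q) :
  detR (block_mx a x 0 b) = detR a * detR b.
Proof.
rewrite !detRE.
have e : (p * 1 * d + q * 1 * d = (p + q) * 1 * d)%N by rewrite -!mulnDl.
rewrite (det_rmx_split (iA := fun v => col_mx v 0) (iB := fun v => col_mx 0 v)
   (pA := @usubmx _ _ _ _) (pB := @dsubmx _ _ _ _) (F := fun v : 'cV_(p + q) => block_mx a x 0 b *m v) e).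
- congr (_ * _); congr determinant; apply: eq_rmx => v /=;
  by rewrite mul_block_col ?mulmx0 ?addr0 ?add0r ?col_mxKu ?col_mxKd.
- by move=> r X Y; rewrite !mul_scalar_mx scale_col_mx scaler0 add_col_mx addr0.
- by move=> r X Y; rewrite !mul_scalar_mx scale_col_mx scaler0 add_col_mx addr0.
- by move=> r X Y; rewrite !mul_scalar_mx linearP.
- by move=> r X Y; rewrite !mul_scalar_mx linearP.
- exact: real_linear_mulmx.
- by move=> X; rewrite col_mxKu.
- by move=> X; rewrite col_mxKd.
- by move=> X; rewrite col_mxKu.
- by move=> X; rewrite col_mxKd.
- by move=> X; rewrite mul_block_col mul0mx !mulmx0 addr0 col_mxKd addr0.
Qed.

End RealForms.

(** * Unitary matrices *)

Section Unitary.
Variables (R : realType) (k : scalar_kind).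
Local Notation K := (scalars R k).
Local Notation d := (dimR k).
Local Notation re r := (@of_real R k r)%:M.
Local Notation iota x := (rmx (fun v : 'cV[K]_ _ => x *m v)).

Definition unitary n (g : 'M[K]_n) := adj g *m g = 1%:M.

Lemma unitary_sym n (g : 'M[K]_n) : unitary g -> g *m adj g = 1%:M.
Proof. exact: mulmx1_sym. Qed.

Lemma unitary1 n : unitary (1%:M : 'M[K]_n).
Proof. by rewrite /unitary adj1 mulmx1. Qed.

Lemma unitaryM n (g h : 'M[K]_n) : unitary g -> unitary h -> unitary (g *m h).
Proof. by rewrite /unitary => ug uh; rewrite adjM mulmxA -(mulmxA _ _ g) ug mulmx1. Qed.

Lemma unitary_adj n (g : 'M[K]_n) : unitary g -> unitary (adj g).
Proof. by move=> ug; rewrite /unitary adjK; exact: unitary_sym. Qed.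

Lemma unitary_block p q (g : 'M[K]_p) (h : 'M[K]_q) :
  unitary g -> unitary h -> unitary (block_mx g 0 0 h).
Proof.
rewrite /unitary => ug uh; rewrite adj_block_mx !adj0 mulmx_block.
by rewrite !mul0mx !mulmx0 !addr0 !add0r ug uh -scalar_mx_block.
Qed.

Lemma detR_unitary n (g : 'M[K]_n) : unitary g -> `|detR g| = 1.
Proof.
move=> ug; have := detR1 R k n; rewrite -ug detRM detR_adj -expr2.
by move=> /eqP; rewrite sqrf_eq1 => /orP[] /eqP ->; rewrite ?normrN normr1.
Qed.

Lemma absdet_ge0 n (x : 'M[K]_n) : 0 <= absdet x.
Proof. exact: powR_ge0. Qed.

Lemma absdetM n (x y : 'M[K]_n) : absdet (x *m y) = absdet x * absdet y.
Proof. by rewrite /absdet detRM normrM powRM. Qed.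

Lemma absdet_expn n (x : 'M[K]_n) : absdet x ^+ d = `|detR x|.
Proof.
rewrite -powR_mulrn ?absdet_ge0// /absdet -powRrM mulVf ?powRr1//.
by rewrite pnatr_eq0 -lt0n dimR_gt0.
Qed.

Lemma absdet_gt0 n (x : 'M[K]_n) : detR x != 0 -> 0 < absdet x.
Proof. by move=> dx; rewrite powR_gt0// normr_gt0. Qed.

Lemma absdet_detR1 n (x : 'M[K]_n) : `|detR x| = 1 -> absdet x = 1.
Proof. by rewrite /absdet => ->; rewrite powR1. Qed.

Lemma absdet1 n : absdet (1%:M : 'M[K]_n) = 1.
Proof. by rewrite absdet_detR1// detR1 normr1. Qed.

Lemma absdet_adj n (x : 'M[K]_n) : absdet (adj x) = absdet x.
Proof. by rewrite /absdet detR_adj. Qed.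

Lemma absdet_block p q (a : 'M[K]_p) (x : 'M[K]_(p, q)) (b : 'M[K]_q) :
  absdet (block_mx a x 0 b) = absdet a * absdet b.
Proof. by rewrite /absdet detR_block normrM powRM. Qed.

Lemma rmx_re m n r : rmx (fun X : 'M[K]_(m, n) => re r *m X) = r%:M.
Proof.
apply: eq_mulmxl => v; rewrite -[v]ofRK -toR_rmx; last exact: real_linear_mulmx.
have := toR_lin r (ofR v) 0; rewrite addr0 => ->.
by rewrite toR0 addr0 ofRK mul_mx_scalar.
Qed.

Lemma absdet_re n r : 0 <= r -> absdet (re r : 'M[K]_n) = r ^+ n.
Proof.
move=> r0; have -> : absdet (re r : 'M[K]_n) = `|r ^+ (n * 1 * d)| `^ d%:R^-1.
  by rewrite /absdet detRE rmx_re det_scalar.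
rewrite muln1 exprM ger0_norm ?exprn_ge0// -powR_mulrn ?exprn_ge0//.
rewrite -powRrM mulfV ?powRr1 ?exprn_ge0//.
by rewrite pnatr_eq0 -lt0n dimR_gt0.
Qed.

Definition nrm2 m n (X : 'M[K]_(m, n)) : R := @realpart R k (\tr (adj X *m X)).

Lemma nrm2E m n (X : 'M[K]_(m, n)) : nrm2 X = \sum_i (toR X 0 i) ^+ 2.
Proof.
rewrite /nrm2 -toR_dot mxE; apply: eq_bigr => i _; by rewrite mxE expr2.
Qed.

Lemma nrm2_ge0 m n (X : 'M[K]_(m, n)) : 0 <= nrm2 X.
Proof. by rewrite nrm2E; apply: sumr_ge0 => i _; exact: sqr_ge0. Qed.

Lemma nrm2_eq0 m n (X : 'M[K]_(m, n)) : nrm2 X = 0 -> X = 0.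
Proof.
move=> X0; apply: (can_inj (@toRK R k m n)); rewrite toR0; apply/rowP => i.
have : (toR X 0 i) ^+ 2 = 0.
  move: X0; rewrite nrm2E => X0.
  have /psumr_eq0P := X0; apply => // j _; exact: sqr_ge0.
by move/eqP; rewrite sqrf_eq0 mxE => /eqP.
Qed.

Lemma nrm2_unitary m n (g : 'M[K]_m) (X : 'M[K]_(m, n)) :
  unitary g -> nrm2 (g *m X) = nrm2 X.
Proof. by rewrite /nrm2 /unitary => ug; rewrite adjM mulmxA -(mulmxA _ _ g) ug mulmx1. Qed.

Lemma gram_cV n (c : 'cV[K]_n) : adj c *m c = re (nrm2 c).
Proof.
have e : adj c *m c = (\sum_i conjs (c i 0) * c i 0)%:M.
  apply/matrixP => i j; rewrite !ord1 !mxE eqxx mulr1n.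
  by apply: eq_bigr => l _; rewrite !mxE.
rewrite {1}e; congr _%:M; rewrite /nrm2 e /mxtrace big_ord1 mxE eqxx mulr1n.
under eq_bigr do rewrite conjs_mul.
have -> : \sum_i @of_real R k (sqnorm (c i 0)) = of_real k (\sum_i sqnorm (c i 0)).
  by rewrite (big_morph _ (@of_realD R k) (@of_real0 R k)).
by rewrite realpart_of_real.
Qed.

(** Reflection in the hyperplane orthogonal to c + r e_1 phi, where r is the norm of
    c and phi is the phase of its first coordinate; this choice of phi keeps the
    vector away from 0. *)
Lemma householder n (c : 'cV[K]_(1 + n)) :
  exists h : 'M[K]_(1 + n), unitary h /\ exists a, h *m c = col_mx a 0.
Proof.
have [->|c0] := eqVneq c 0.
  by exists 1%:M; split; [exact: unitary1 | exists 0; rewrite mulmx0 col_mx0].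
have [phi [t [phi1 t0 phic]]] := phase_exists (c 0 0).
set r := Num.sqrt (nrm2 c).
have n0 : 0 < nrm2 c.
  by rewrite lt_neqAle nrm2_ge0 andbT eq_sym; apply: contra_neq c0 => /nrm2_eq0.
have r0 : 0 < r by rewrite sqrtr_gt0.
have rr : r * r = nrm2 c by rewrite -expr2 sqr_sqrtr// ltW.
pose e : 'cV[K]_(1 + n) := col_mx (re r *m phi%:M) 0.
have ee : adj e *m e = re (nrm2 c).
  rewrite /e adj_col_mx mul_row_col mulmx0 addr0 adjM adj_re adj_scalar.
  by rewrite -mulmxA (mulmxA (re r)) -reM re_comm mulmxA -scalar_mxM phi1 mul1mx rr.
have cE : c = col_mx (usubmx c) (dsubmx c) by rewrite vsubmxK.
have uc : usubmx c = (c 0 0)%:M.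
  apply/matrixP => i j; rewrite !ord1 !mxE eqxx mulr1n; congr (c _ _); exact: val_inj.
have ec : adj e *m c = re (r * t).
  rewrite cE /e adj_col_mx mul_row_col adj0 mul0mx addr0 adjM adj_re adj_scalar uc.
  by rewrite -mulmxA re_comm mulmxA -scalar_mxM phic -reM mulrC.
have ce : adj c *m e = re (r * t) by rewrite -[adj c *m e]adjK adjM adjK ec adj_re.
have cc := gram_cV c.
pose w := c + e; pose s := nrm2 c + r * t.
have s0 : 0 < s by rewrite ltr_pwDl// mulr_ge0// ltW.
have wc : adj w *m c = re s by rewrite /w adjD mulmxDl cc ec /s of_realD raddfD.
have we : adj w *m e = re s by rewrite /w adjD mulmxDl ce ee /s of_realD raddfD addrC.
have ww : adj w *m w = re s + re s by rewrite {2}/w mulmxDr wc we.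
(* As w^* w = 2 s, this is the reflection along w. *)
pose h : 'M[K]_(1 + n) := 1%:M - w *m re s^-1 *m adj w.
have ssV : re s^-1 *m re s = 1%:M :> 'M[K]_1 by rewrite -reM mulVf ?gt_eqF// re1.
have hh : adj h = h.
  by rewrite /h adjD adjN adj1 !adjM adjK adj_re mulmxA.
exists h; split.
  rewrite /unitary hh {2}/h mulmxBr mulmx1 /h mulmxBl mul1mx.
  set z := w *m re s^-1 *m adj w.
  have -> : z *m z = z + z.
    rewrite /z -!mulmxA (mulmxA (adj w) w) ww (mulmxDl (re s)) (mulmxA (re s)).
    by rewrite (mulmx1_sym ssV) mul1mx (mulmxDr (re s^-1)) (mulmxDr w).
  by rewrite opprB addrK subrK.
exists (- (re r *m phi%:M)).
rewrite /h mulmxBl mul1mx -!mulmxA wc (mulmxA w) -(mulmxA w) ssV mulmx1 /w.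
by rewrite opprD addrA subrr add0r /e -[in RHS]oppr0 -opp_col_mx.
Qed.

(** Householder reflections clear one column after the other. *)
Lemma qr_exists n p (u : 'M[K]_(n, p)) :
  exists g : 'M[K]_n, unitary g /\ forall (i : 'I_n) (j : 'I_p), (p <= i)%N -> (g *m u) i j = 0.
Proof.
elim: p n u => [|p IH] n u.
  by exists 1%:M; split; [exact: unitary1 | move=> i []].
case: n u => [|n] u; first by exists 1%:M; split; [exact: unitary1 | case].
change ('M[K]_(1 + n, 1 + p)) in u.
have [h [uh [a ha]]] := householder (lsubmx u).
have [g [ug gu]] := IH n (dsubmx (rsubmx (h *m u))).
exists (block_mx 1%:M 0 0 g *m h); split.
  exact: (unitaryM (unitary_block (@unitary1 1) ug) uh).
move=> i j pi.
have hu : h *m u =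
    block_mx a (usubmx (rsubmx (h *m u))) 0 (dsubmx (rsubmx (h *m u))).
  have hl : lsubmx (h *m u) = col_mx a 0.
    by rewrite -ha -{1}[u]hsubmxK mul_mx_row row_mxKl.
  by rewrite block_mxEh vsubmxK -hl hsubmxK.
have E : block_mx 1%:M 0 0 g *m h *m u =
    block_mx a (usubmx (rsubmx (h *m u))) 0 (g *m dsubmx (rsubmx (h *m u))).
  rewrite -[LHS]mulmxA {1}hu mulmx_block.
  by rewrite !mul0mx !mulmx0 !mul1mx !addr0 add0r.
change ((block_mx 1%:M 0 0 g *m h *m u : 'M[K]_(1 + n, 1 + p)) i j = 0).
rewrite E.
have [i' ii'|i' ii'] := @split_ordP 1 n i; first by move: pi; rewrite ii' /= ord1.
move: pi; rewrite ii' /= add1n ltnS => pi.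
have [j' ->|j' ->] := @split_ordP 1 p j; first by rewrite block_mxEdl mxE.
by rewrite block_mxEdr gu.
Qed.

End Unitary.

(** * The groups SL and SU *)

Section SpecialUnitary.
Variables (R : realType) (k : scalar_kind).
Local Notation K := (scalars R k).
Local Notation d := (dimR k).
Local Notation re r := (@of_real R k r)%:M.

Lemma det_is_one1 n : @det_is_one R k n 1%:M.
Proof. by case: k => /=; [exact: det1 | exact: det1 | exact: absdet1]. Qed.

Lemma det_is_oneM n (x y : 'M[K]_n) :
  @det_is_one R k n x -> @det_is_one R k n y -> @det_is_one R k n (x *m y).
Proof.
case: k x y => /= x y.
- move=> dx dy; transitivity (\det (x : 'M[R]_n) * \det (y : 'M[R]_n)).
    exact: det_mulmx.
  by rewrite dx dy mulr1.
- move=> dx dy; transitivity (\det (x : 'M[R[i]]_n) * \det (y : 'M[R[i]]_n)).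
    exact: det_mulmx.
  by rewrite dx dy mulr1.
- by move=> dx dy; rewrite absdetM dx dy mulr1.
Qed.

Lemma det_is_one_adj n (x : 'M[K]_n) : @det_is_one R k n x -> @det_is_one R k n (adj x).
Proof.
case: k x => /= x dx.
- by rewrite -dx -[RHS](det_tr (x : 'M[R]_n)); congr determinant; apply/matrixP => i j; rewrite !mxE.
- transitivity (conjc (\det ((x : 'M[R[i]]_n)^T))); last by rewrite det_tr dx rmorph1.
  by rewrite -det_map_mx.
- by rewrite absdet_adj.
Qed.

Lemma det_is_one_ublock p q (a : 'M[K]_p) (x : 'M[K]_(p, q)) (b : 'M[K]_q) :
  @det_is_one R k (p + q) (block_mx a x 0 b) <-> @det_is_one R k (p + q) (block_mx a 0 0 b).
Proof.
case: k a x b => /= a x b.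
- have := det_ublock (a : 'M[R]_p) x b; have := det_ublock (a : 'M[R]_p) 0 b.
  by move=> /= -> ->.
- have := det_ublock (a : 'M[R[i]]_p) x b; have := det_ublock (a : 'M[R[i]]_p) 0 b.
  by move=> /= -> ->.
- by rewrite !absdet_block.
Qed.

Lemma GL_left n (x y : 'M[K]_n) : y *m x = 1%:M -> GL x.
Proof. by move=> yx; exists y; split => //; exact: mulmx1_sym. Qed.

Lemma GLM n (x y : 'M[K]_n) : GL x -> GL y -> GL (x *m y).
Proof. by move=> /GL_detR dx /GL_detR dy; apply/GL_detR; rewrite detRM mulf_neq0. Qed.

Lemma SLM n (x y : 'M[K]_n) : SL x -> SL y -> SL (x *m y).
Proof. by move=> [gx dx] [gy dy]; split; [exact: GLM | exact: det_is_oneM]. Qed.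

Lemma SL1 n : SL (1%:M : 'M[K]_n).
Proof. by split; [apply: (GL_left (y := 1%:M)); rewrite mulmx1 | exact: det_is_one1]. Qed.

Lemma SL_adj n (x : 'M[K]_n) : SL x -> SL (adj x).
Proof.
move=> [/GL_detR dx d1]; split; last exact: det_is_one_adj.
by apply/GL_detR; rewrite detR_adj.
Qed.

Lemma SL_nX p q (X : 'M[K]_(p, q)) : SL (nX X).
Proof.
split; last by apply/det_is_one_ublock; rewrite -scalar_mx_block; exact: det_is_one1.
by apply/GL_detR; rewrite detR_block !detR1 mulr1 oner_eq0.
Qed.

Lemma nbar_adj p q (Y : 'M[K]_(q, p)) : nbar Y = adj (nX (adj Y)).
Proof. by rewrite /nX adj_block_mx adjK !adj1 adj0. Qed.

Lemma SL_nbar p q (Y : 'M[K]_(q, p)) : SL (nbar Y).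
Proof. by rewrite nbar_adj; apply: SL_adj; exact: SL_nX. Qed.

Lemma SU_unitary n (x : 'M[K]_n) : SU x -> unitary x.
Proof. by case=> _ []. Qed.

Lemma SU_SL n (x : 'M[K]_n) : SU x -> SL x.
Proof. by case. Qed.

Lemma SU_intro n (x : 'M[K]_n) : unitary x -> @det_is_one R k n x -> SU x.
Proof.
move=> ux dx; split; last by split; [|exact: unitary_sym].
by split => //; exact: (GL_left ux).
Qed.

Lemma SUM n (x y : 'M[K]_n) : SU x -> SU y -> SU (x *m y).
Proof.
move=> ux uy; apply: SU_intro; first by apply: unitaryM; exact: SU_unitary.
by apply: det_is_oneM; [case: ux => -[] | case: uy => -[]].
Qed.

Lemma SU1 n : SU (1%:M : 'M[K]_n).
Proof. by apply: SU_intro; [exact: unitary1 | exact: det_is_one1]. Qed.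

Lemma SU_adj n (x : 'M[K]_n) : SU x -> SU (adj x).
Proof.
move=> ux; apply: SU_intro; first by apply: unitary_adj; exact: SU_unitary.
by apply: det_is_one_adj; case: ux => -[].
Qed.

Lemma absdet_SU n (x : 'M[K]_n) : SU x -> absdet x = 1.
Proof. by move=> /SU_unitary ux; rewrite absdet_detR1// detR_unitary. Qed.

Lemma unitary_scalar n (c : K) : conjs c * c = 1 -> unitary (c%:M : 'M[K]_n).
Proof. by move=> c1; rewrite /unitary adj_scalar -scalar_mxM c1. Qed.

(** A phase in one of the last rows makes the determinant 1; over the quaternions
    the condition on the determinant holds for every unitary matrix. *)
Lemma unitary_to_SU p q (g : 'M[K]_(p + q)) : (0 < q)%N -> unitary g ->
  exists D : 'M[K]_q, unitary D /\ SU (block_mx 1%:M 0 0 D *m g).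
Proof.
case: q g => // q g _ ug.
suff [c [c1 dc]] : exists c : K, conjs c * c = 1 /\
    @det_is_one R k (p + (1 + q)) (block_mx 1%:M 0 0 (block_mx c%:M 0 0 1%:M : 'M[K]_(1 + q)) *m g).
  have uc : unitary (block_mx c%:M 0 0 1%:M : 'M[K]_(1 + q)).
    by apply: unitary_block; [exact: unitary_scalar | exact: unitary1].
  exists (block_mx c%:M 0 0 1%:M : 'M[K]_(1 + q)); split => //.
  by apply: SU_intro => //; exact: (unitaryM (unitary_block (@unitary1 _ _ p) uc) ug).
case: k g ug => /= g ug.
- set D := \det (g : 'M[R]_(p + (1 + q))).
  have DD : D * D = 1.
    have := congr1 (fun x : 'M[R]_(p + (1 + q)) => \det x) ug.
    rewrite det1 => <-; transitivity (\det (adj g : 'M[R]_(p + (1 + q))) * D); last by rewrite -det_mulmx.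
    congr (_ * _); rewrite /D -[LHS]det_tr; congr determinant.
    by apply/matrixP => i j; rewrite !mxE.
  exists D; split => //.
  transitivity (\det (block_mx 1%:M 0 0 (block_mx D%:M 0 0 1%:M : 'M[R]_(1 + q)) : 'M[R]_(p + (1 + q))) * D).
    by rewrite -det_mulmx.
  by rewrite det_ublock (det_ublock (D%:M : 'M[R]_1)) !det1 det_scalar1 mulr1 mul1r.
- set D := \det (g : 'M[R[i]]_(p + (1 + q))).
  have DD : (conjc D) * D = 1.
    have := congr1 (fun x : 'M[R[i]]_(p + (1 + q)) => \det x) ug.
    rewrite det1 => <-; transitivity (\det (adj g : 'M[R[i]]_(p + (1 + q))) * D); last by rewrite -det_mulmx.
    by congr (_ * _); rewrite /D -det_tr -det_map_mx.
  exists (conjc D); split; first by rewrite /= conjcK mulrC.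
  transitivity (\det (block_mx 1%:M 0 0 (block_mx (conjc D)%:M 0 0 1%:M : 'M[R[i]]_(1 + q)) : 'M[R[i]]_(p + (1 + q))) * D).
    by rewrite -det_mulmx.
  by rewrite det_ublock (det_ublock ((conjc D)%:M : 'M[R[i]]_1)) !det1 det_scalar1 mulr1 mul1r.
- exists 1; rewrite mulr1; split; first exact: (conjs1 R QuaternionS).
  rewrite absdetM !absdet_block !absdet1 !mul1r; exact: absdet_detR1 (detR_unitary ug).
Qed.

(** The correction of the determinant acts on the last q rows, which vanish. *)
Lemma qr_SU p q (u : 'M[K]_(p + q, p)) : (0 < q)%N ->
  exists g : 'M[K]_(p + q), SU g /\ exists a, g *m u = col_mx a 0.
Proof.
move=> q0; have [g [ug gu]] := qr_exists u.
have [D [uD SD]] := unitary_to_SU q0 ug.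
exists (block_mx 1%:M 0 0 D *m g); split => //.
have gu0 : g *m u = col_mx (usubmx (g *m u)) 0.
  rewrite -{1}[g *m u]vsubmxK; congr col_mx; apply/matrixP => i j.
  by rewrite mxE [RHS]mxE gu//= leq_addr.
by exists (usubmx (g *m u)); rewrite -mulmxA gu0 mul_block_col col_mxKu !mulmx0 mul0mx mul1mx !addr0.
Qed.

End SpecialUnitary.

(** * The Grassmannian as a homogeneous space *)

Section GrassmannAlgebra.
Variables (R : realType) (k : scalar_kind) (p q : nat).
Local Notation K := (scalars R k).
Local Notation d := (dimR k).
Local Notation re r := (@of_real R k r)%:M.
Local Notation Gr := (Gr R k p q).
Local Notation bo := (b_o R k p q).

Lemma lsubmx_mul m n (g : 'M[K]_(n, m)) (h : 'M[K]_(m, p + q)) :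
  lsubmx (g *m h) = g *m lsubmx h.
Proof. by rewrite -{1}[h]hsubmxK mul_mx_row row_mxKl. Qed.

Lemma Gr_eq (b c : Gr) : gr_set b = gr_set c -> b = c.
Proof.
case: b c => [b hb] [c hc] /= bc; subst c; congr MkGr; exact: Prop_irrelevance.
Qed.

Lemma act_act g h (b : Gr) : GL g -> GL h -> act g (act h b) = act (g *m h) b.
Proof.
move=> gg gh; apply: Gr_eq; rewrite !act_set//; last exact: GLM.
by rewrite image_comp; apply: eq_imagel => v _ /=; rewrite mulmxA.
Qed.

Lemma act1 (b : Gr) : act 1%:M b = b.
Proof.
have [g1 _] := SL1 R k (p + q).
apply: Gr_eq; rewrite act_set//; apply/seteqP; split => v /=.
  by move=> [w bw <-]; rewrite mul1mx.
by move=> bv; exists v; rewrite ?mul1mx.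
Qed.

Lemma gr_act_bo g : GL g ->
  gr_set (act g bo) = range (fun x : 'cV[K]_p => lsubmx g *m x).
Proof.
move=> gg; rewrite act_set//; apply/seteqP; split => v /=.
  move=> [w w0 <-]; exists (usubmx w) => //.
  by rewrite -{2}[g]hsubmxK -{2}[w]vsubmxK w0 mul_row_col mulmx0 addr0.
move=> [x _ <-]; exists (col_mx x 0); first by rewrite col_mxKd.
by rewrite -{1}[g]hsubmxK mul_row_col mulmx0 addr0.
Qed.

Lemma act_bo_eq g h a : GL g -> GL h -> detR a != 0 ->
  lsubmx g = lsubmx h *m a -> act g bo = act h bo.
Proof.
move=> gg gh da e; apply: Gr_eq; rewrite !gr_act_bo// e.
apply/seteqP; split => v [x _ <-].
  by exists (a *m x); rewrite // mulmxA.
by exists (invK a *m x); rewrite // mulmxA -(mulmxA _ a) mulmx_invK// mulmx1.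
Qed.

Lemma lsubmx_SU (u : 'M[K]_(p + q)) : SU u -> adj (lsubmx u) *m lsubmx u = 1%:M :> 'M[K]_p.
Proof.
move=> /SU_unitary; rewrite /unitary -{1 2}[u]hsubmxK adj_row_mx mul_col_row.
by rewrite scalar_mx_block => /eq_block_mx[].
Qed.

(** QR factorization of a matrix whose columns are a basis of b. *)
Lemma transitive_SU (b : Gr) : (0 < q)%N -> exists2 u, SU u & b = act u bo.
Proof.
move=> q0; have [w [w0 bw]] := gr_basis b.
have [g [Sg [a ga]]] := qr_SU w q0.
have Su := SU_adj Sg; have [Gu _] := SU_SL Su.
have wE : w = lsubmx (adj g) *m a.
  rewrite -[w]mul1mx -(SU_unitary Sg) -mulmxA ga -{1}[adj g]hsubmxK mul_row_col.
  by rewrite mulmx0 addr0.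
have da : detR a != 0.
  apply: contraTneq isT => da.
  have /eqP/det0P [v v0 va] : \det (rmx (fun v : 'cV[K]_p => a *m v)) = 0 by exact: da.
  have : ofR v = 0 :> 'cV[K]_p.
    apply: w0; rewrite wE -mulmxA; have -> : a *m ofR v = 0; last by rewrite mulmx0.
    apply: (can_inj (@toRK R k p 1)).
    by rewrite (toR_rmx _ (@real_linear_mulmx _ _ _ _ _ a)) ofRK va toR0.
  by move=> /(congr1 (@toR R k p 1)); rewrite ofRK toR0 => /eqP; rewrite (negbTE v0).
exists (adj g) => //; apply: Gr_eq; rewrite gr_act_bo// bw wE.
apply/seteqP; split => v [x _ <-].
  by exists (a *m x); rewrite // mulmxA.
by exists (invK a *m x); rewrite // mulmxA -(mulmxA _ a) mulmx_invK// mulmx1.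
Qed.

(** These conditions characterize the orthogonal projection onto b. *)
Definition is_proj (b : Gr) (P : 'M[K]_(p + q)) :=
  [/\ forall v, gr_set b (P *m v), forall v, gr_set b v -> P *m v = v & adj P = P].

Lemma eq_mulmx_cV m n (A B : 'M[K]_(m, n)) :
  (forall v : 'cV[K]_n, A *m v = B *m v) -> A = B.
Proof.
move=> AB; apply/matrixP => i j; have := AB (delta_mx j 0).
by rewrite -!colE => /colP /(_ i); rewrite !mxE.
Qed.

(** PQ = Q and QP = P; the adjoint of the second equation is PQ = P. *)
Lemma is_proj_uniq (b : Gr) P Q : is_proj b P -> is_proj b Q -> P = Q.
Proof.
move=> [bP Pb aP] [bQ Qb aQ].
have PQ : P *m Q = Q by apply: eq_mulmx_cV => v; rewrite -mulmxA Pb.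
have QP : Q *m P = P by apply: eq_mulmx_cV => v; rewrite -mulmxA Qb.
by rewrite -[LHS]aP -QP adjM aP aQ.
Qed.

(** The Gram matrix formula for the projection onto the span of the columns of
    w. *)
Lemma is_proj_basis (b : Gr) (w : 'M[K]_(p + q, p)) : is_basis w b ->
  detR (adj w *m w) != 0 /\ is_proj b (w *m invK (adj w *m w) *m adj w).
Proof.
move=> [w0 bw].
have dw : detR (adj w *m w) != 0.
  apply: contraTneq isT => dw.
  have /eqP/det0P [v v0 va] : \det (rmx (fun v : 'cV[K]_p => (adj w *m w) *m v)) = 0 by exact: dw.
  have wwv : adj w *m w *m (ofR v : 'cV[K]_p) = 0.
    apply: (can_inj (@toRK R k p 1)).
    by rewrite (toR_rmx _ (@real_linear_mulmx _ _ _ _ _ (adj w *m w))) ofRK va toR0.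
  have : ofR v = 0 :> 'cV[K]_p.
    apply: w0; apply: nrm2_eq0; rewrite /nrm2 adjM -mulmxA (mulmxA (adj w)) wwv.
    by rewrite mulmx0 mxtrace0 realpart0.
  by move=> /(congr1 (@toR R k p 1)); rewrite ofRK toR0 => /eqP; rewrite (negbTE v0).
split=> //; set z := invK _; have zz : z *m (adj w *m w) = 1%:M by exact: mulKmx.
split=> [v|v|].
- by rewrite bw; exists (z *m adj w *m v); rewrite // !mulmxA.
- by rewrite bw => -[x _ <-]; rewrite -!mulmxA (mulmxA (adj w)) (mulmxA z) zz mul1mx.
- have az : adj z = z.
    have := congr1 (@adj R k _ _) (mulmx_invK dw); rewrite -/z adjM adjM adjK adj1 => zz'.
    by rewrite -[adj z]mulmx1 -(mulmx_invK dw) -/z mulmxA zz' mul1mx.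
  by rewrite !adjM adjK az mulmxA.
Qed.

Lemma is_basis_act g : GL g -> is_basis (lsubmx g) (act g bo).
Proof.
move=> gg; split; last exact: gr_act_bo.
move=> x gx; have [h [_ hg]] := gg.
have : g *m col_mx x 0 = 0 by rewrite -{1}[g]hsubmxK mul_row_col mulmx0 addr0.
by move=> /(congr1 (mulmx h)); rewrite mulmxA hg mul1mx mulmx0 -col_mx0 => /eq_col_mx[].
Qed.

Definition proj (b : Gr) : 'M[K]_(p + q) := xget 0 [set P | is_proj b P].

Lemma projP (b : Gr) : is_proj b (proj b).
Proof.
rewrite /proj; case: xgetP => [P _ //|none]; have [w bw] := gr_basis b.
by have [_ /none] := is_proj_basis bw.
Qed.

Lemma proj_eq (b : Gr) P : is_proj b P -> proj b = P.
Proof. exact/is_proj_uniq/projP. Qed.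

Lemma proj_gram g : GL g ->
  detR (adj (lsubmx g) *m lsubmx g) != 0 /\
  proj (act g bo) = lsubmx g *m invK (adj (lsubmx g) *m lsubmx g) *m adj (lsubmx g).
Proof.
by move=> gg; have [? ?] := is_proj_basis (is_basis_act gg); split => //; exact: proj_eq.
Qed.

Lemma proj_SU u : SU u -> proj (act u bo) = lsubmx u *m adj (lsubmx u).
Proof.
move=> Su; have [Gu _] := SU_SL Su; have uu := lsubmx_SU Su.
apply: proj_eq; split => [v|v|].
- by rewrite gr_act_bo//; exists (adj (lsubmx u) *m v); rewrite // mulmxA.
- by rewrite gr_act_bo// => -[x _ <-]; rewrite -mulmxA (mulmxA (adj _)) uu mul1mx.
- by rewrite adjM adjK.
Qed.

Lemma proj_act u (b : Gr) : SU u -> proj (act u b) = u *m proj b *m adj u.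
Proof.
move=> Su; have [Gu _] := SU_SL Su; have uu := SU_unitary Su.
have [bP Pb aP] := projP b.
apply: proj_eq; split => [v|v|].
- by rewrite act_set//; exists (proj b *m (adj u *m v)); rewrite // !mulmxA.
- by rewrite act_set// => -[w bw <-]; rewrite -!mulmxA (mulmxA (adj u)) uu mul1mx Pb.
- by rewrite !adjM adjK aP mulmxA.
Qed.

Lemma orth_projE (c : Gr) v : orth_proj c v = proj c *m v.
Proof.
have [cP Pc aP] := projP c.
have PP : proj c *m proj c = proj c.
  by apply: eq_mulmx_cV => x; rewrite -mulmxA Pc.
have dot0 (w : 'cV[K]_(p + q)) : gr_set c w ->
    (forall u, gr_set c u -> adj u *m (v - w) = 0) -> w = proj c *m v.
  move=> cw ortho; rewrite -[w]Pc//; apply/eqP; rewrite eq_sym -subr_eq0 -mulmxBr.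
  apply/eqP/nrm2_eq0; rewrite /nrm2 adjM aP mulmxA -(mulmxA _ (proj c) (proj c)) PP.
  by have := ortho _ (cP (v - w)); rewrite adjM aP => ->; rewrite mxtrace0 realpart0.
rewrite /orth_proj; case: xgetP => [w _ [cw ow]|none]; first exact: dot0.
have [] := none (proj c *m v); split => // u cu.
have -> : adj u = adj u *m proj c by rewrite -{1}aP -adjM Pc.
by rewrite -mulmxA mulmxBr mulmxA PP subrr mulmx0.
Qed.

End GrassmannAlgebra.

Section Iwasawa.
Variables (R : realType) (k : scalar_kind) (p q : nat).
Hypotheses (hp : (0 < p)%N) (hq : (0 < q)%N).
Local Notation K := (scalars R k).
Local Notation re r := (@of_real R k r)%:M.
Local Notation bo := (b_o R k p q).

Lemma det_is_one_scalars (a b : R) : 0 <= a -> 0 <= b -> a ^+ p * b ^+ q = 1 ->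
  @det_is_one R k (p + q) (block_mx (re a) 0 0 (re b)).
Proof.
move=> a0 b0; case: k => /= ab.
- by have := det_ublock (a%:M : 'M[R]_p) 0 (b%:M : 'M[R]_q); rewrite /= !det_scalar => ->.
- have := det_ublock ((a%:C%C)%:M : 'M[R[i]]_p) 0 ((b%:C%C)%:M : 'M[R[i]]_q).
  by rewrite /= !det_scalar => ->; rewrite -!rmorphXn -rmorphM ab rmorph1.
- by rewrite absdet_block !(@absdet_re R QuaternionS).
Qed.

Lemma expH_eq (s : R) :
  expR (s * (q%:R / (p + q)%:R)) ^+ p * expR (- (s * (p%:R / (p + q)%:R))) ^+ q = 1.
Proof.
rewrite -!expRM_natl -expRD -[RHS]expR0; congr expR.
by rewrite mulrN !mulrA [p%:R * s]mulrC [q%:R * s]mulrC -!mulrA [p%:R * _]mulrCA; ring.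
Qed.

Lemma SL_expH s : SL (@expH R k p q s).
Proof.
have e := expH_eq s; split; last by apply: det_is_one_scalars; rewrite ?expR_ge0.
have detR_re n r : 0 < r -> detR (re r : 'M[K]_n) != 0.
  by move=> r0; rewrite detRE rmx_re det_scalar expf_neq0// gt_eqF.
by apply/GL_detR; rewrite detR_block mulf_neq0// detR_re// expR_gt0.
Qed.

(** The value a^lambda at lambda = 1 for a = exp (s H_o). *)
Definition iwasawa_exp (s : R) : R := expR (s * ((p * q)%:R / (p + q)%:R)).

(** QR factorization of the first p columns of nbar Y leaves a block upper triangular
    matrix with diagonal blocks a, b and |det a| |det b| = 1. The A-part rescales the
    blocks to absolute determinant 1 and the N-part removes the upper right
    block. *)
Lemma iwasawa_ex (Y : 'M[K]_(q, p)) : exists s u m X,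
  [/\ SU u, Mgroup m & nbar Y = u *m m *m @expH R k p q s *m nX X].
Proof.
have [g [Sg [a ga]]] := qr_SU (lsubmx (nbar Y)) hq.
set x := usubmx (rsubmx (g *m nbar Y)); set b := dsubmx (rsubmx (g *m nbar Y)).
have gY : g *m nbar Y = block_mx a x 0 b.
  by rewrite block_mxEh vsubmxK -ga -lsubmx_mul hsubmxK.
have SgY := SLM (SU_SL Sg) (SL_nbar Y).
have ab : absdet a * absdet b = 1.
  rewrite -(absdet_block a x b) -gY absdetM (absdet_SU Sg) mul1r.
  by rewrite nbar_adj absdet_adj absdet_block !absdet1 mulr1.
have dab : detR a * detR b != 0.
  by rewrite -(detR_block a x b) -gY; case: SgY => /GL_detR.
have [da db] : detR a != 0 /\ detR b != 0.
  by move: dab; rewrite mulf_eq0 negb_or => /andP.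
have a0 := absdet_gt0 da.
pose t : R := (p * q)%:R / (p + q)%:R.
have t0 : 0 < t by rewrite divr_gt0// ltr0n ?muln_gt0 ?addn_gt0 ?hp ?hq.
(* The exponent for which exp (s q / (n + 1)) ^ p = |det a|. *)
pose s := ln (absdet a) / t.
pose e1 := expR (s * (q%:R / (p + q)%:R)).
pose e2 := expR (- (s * (p%:R / (p + q)%:R))).
have e1p : e1 ^+ p = absdet a.
  rewrite -expRM_natl (_ : _ * _ = ln (absdet a)) ?lnK//.
  rewrite mulrCA (_ : p%:R * _ = t) ?divfK ?gt_eqF//.
  by rewrite mulrA -natrM.
have e10 : 0 < e1 by exact: expR_gt0.
have e20 : 0 < e2 by exact: expR_gt0.
have e2q : e2 ^+ q = absdet b.
  apply: (@mulfI _ (absdet a)); first by rewrite gt_eqF.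
  by rewrite ab -e1p expH_eq.
pose m := g *m nbar Y *m nX (- (invK a *m x)) *m @expH R k p q (- s).
have mE : m = block_mx (a *m re e1^-1) 0 0 (b *m re e2^-1).
  rewrite /m gY /nX /expH !mulmx_block !mulmx0 !mul0mx !mulmx1 !addr0 !add0r.
  rewrite mulmxN mulmxA mulmx_invK// mul1mx addNr mul0mx.
  by rewrite /e1 /e2 -!expRN !mulNr mul0mx.
exists s, (adj g), m, (invK a *m x).
have re_V (r : R) n : 0 < r -> re r *m re r^-1 = 1%:M :> 'M[K]_n.
  by move=> r0; rewrite -reM mulfV ?gt_eqF// re1.
split; first exact: SU_adj.
  split.
    by do ?apply: SLM => //; [exact: SL_nX | exact: SL_expH].
  exists (a *m re e1^-1), (b *m re e2^-1); split; first exact: mE.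
  - by apply/GL_detR; rewrite detRM mulf_neq0//; apply/GL_detR; apply: (@GL_left _ _ _ _ (re e1)); exact: re_V.
  - by apply/GL_detR; rewrite detRM mulf_neq0//; apply/GL_detR; apply: (@GL_left _ _ _ _ (re e2)); exact: re_V.
  - by rewrite absdetM absdet_re ?invr_ge0 ?ltW// exprVn e1p mulfV// gt_eqF.
  - by rewrite absdetM absdet_re ?invr_ge0 ?ltW// exprVn e2q mulfV// -e2q expf_neq0// gt_eqF.
have e : m *m @expH R k p q s = block_mx a 0 0 b.
  rewrite mE /expH -/e1 -/e2 mulmx_block !mulmx0 !mul0mx !addr0 !add0r.
  by rewrite -!mulmxA -!reM !mulVf ?gt_eqF// !re1 !mulmx1.
have e' : m *m @expH R k p q s *m nX (invK a *m x) = g *m nbar Y.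
  rewrite e gY /nX mulmx_block !mulmx0 !mul0mx !mulmx1 !addr0 !add0r.
  by rewrite mulmxA mulmx_invK// mul1mx.
by rewrite -2!mulmxA (mulmxA m) e' mulmxA (SU_unitary Sg) mul1mx.
Qed.

(** The first p columns see only u, the upper left block of M and that of A; the
    absolute determinant of that product recovers log_a, whichever decomposition was
    chosen. *)
Lemma iwasawaP (Y : 'M[K]_(q, p)) : exists u a,
  [/\ SU u, detR a != 0, lsubmx (nbar Y) = lsubmx u *m a,
     absdet a = iwasawa_exp (log_a (nbar Y)) & act (nbar Y) bo = act u bo].
Proof.
have [s0 hs0] := iwasawa_ex Y.
rewrite /log_a; case: xgetP => [s _ [u [m [X [Su [Sm [a [b [mE ga gb a1 b1]]]] gE]]]]|none]; last first.
  by case: (none s0).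
pose e1 := expR (s * (q%:R / (p + q)%:R)).
have e10 : 0 < e1 by exact: expR_gt0.
exists u, (a *m re e1).
have lE : lsubmx (nbar Y) = lsubmx u *m (a *m re e1).
  rewrite gE /nX lsubmx_mul; have -> : lsubmx (block_mx 1%:M X 0 1%:M) = col_mx 1%:M 0 :> 'M[K]_(p + q, p).
    by rewrite block_mxEh row_mxKl.
  rewrite mE /expH -mulmxA mul_block_col !mulmx1 !mulmx0 !addr0.
  rewrite -/e1 -mulmxA mul_block_col !mulmx0 !mul0mx !addr0.
  by rewrite -{1}[u]hsubmxK mul_row_col mulmx0 addr0.
have dae : detR (a *m re e1) != 0.
  rewrite detRM mulf_neq0//; first by apply/GL_detR.
  by rewrite detRE rmx_re det_scalar expf_neq0// gt_eqF.
split => //.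
  rewrite absdetM a1 mul1r absdet_re ?ltW// -expRM_natl; congr expR.
  by rewrite mulrCA [p%:R * _]mulrA natrM.
apply: act_bo_eq lE => //; first by case: (SL_nbar Y).
by case: (SU_SL Su).
Qed.

End Iwasawa.

(** * The cosine of two subspaces *)

Lemma common_value_eq (I : Type) (T : choiceType) (t0 : T) (P : set I) (F : I -> T) i :
  P i -> (forall j, P j -> F j = F i) -> common_value t0 P F = F i.
Proof.
move=> Pi FP; have FPi : F @` P = [set F i].
  by apply/seteqP; split => [_ [j Pj <-]|_ ->]; [exact: FP | exists i].
rewrite /common_value; case: xgetP => [t _ /= | /(_ (F i))//].
by rewrite FPi => /seteqP[/(_ _ erefl)].
Qed.

Section EuclideanVolume.
Variable R : realType.

Lemma lebesgue_outer_linN N (T : 'M[R]_N) (E : set 'rV[R]_N) : (0 < N)%N ->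
  T \in unitmx ->
  lebesgue_outer [set x | E (x *m T)] = (`|\det T|^-1%:E * lebesgue_outer E)%E.
Proof. by case: N T E => // N T E _; exact: lebesgue_outer_lin. Qed.

Lemma lebesgue_outer_image N (T : 'M[R]_N) (E : set 'rV[R]_N) : (0 < N)%N ->
  lebesgue_outer [set x *m T | x in E] = (`|\det T|%:E * lebesgue_outer E)%E.
Proof.
move=> N0; have [uT|sT] := boolP (T \in unitmx).
  have uT' : invmx T \in unitmx by rewrite unitmx_inv.
  rewrite -[`|\det T|]invrK -normfV -det_inv -lebesgue_outer_linN//.
  congr lebesgue_outer; apply/seteqP; split => y /=.
    by move=> [x Ex <-]; rewrite mulmxK.
  by move=> Ey; exists (y *m invmx T) => //; rewrite mulmxKV.
have -> : \det T = 0 by move: sT; rewrite unitmxE unitfE negbK => /eqP.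
rewrite normr0 mul0e; apply/eqP; rewrite eq_le lebesgue_outer_ge0 andbT.
case: N T E N0 sT => // N T E _ sT; rewrite -(lebesgue_outer_singular sT).
by apply: le_lebesgue_outer => _ [x _ <-]; exists x.
Qed.

Lemma lebesgue_outer_kernel N (B : 'M[R]_N) (E : set 'rV[R]_N) : (0 < N)%N ->
  B != 0 -> (forall x, E x -> x *m B = 0) -> lebesgue_outer E = 0%E.
Proof.
move=> N0 B0 EB; apply/eqP; rewrite eq_le lebesgue_outer_ge0 andbT.
have sK : kermx B \notin unitmx.
  rewrite -row_free_unit -row_leq_rank mxrank_ker -ltnNge.
  by rewrite ltn_subrL N0 andbT lt0n mxrank_eq0.
case: N B E N0 B0 EB sK => // N B E _ B0 EB sK.
rewrite -(lebesgue_outer_singular sK); apply: le_lebesgue_outer => x /EB xB.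
by have /sub_kermxP/submxP[y ->] := xB; exists y.
Qed.

(** Independence of the orthonormal basis. For two bases U and V put T = U V^T. If T
    is orthogonal, it preserves volume and carries one set of coordinates to the
    other. Otherwise T T^T is not the identity but fixes every coordinate vector of
    S, so that S lies in a proper subspace and both volumes vanish. *)
Lemma subspace_volumeE m m' N (e : m = m') (S : set 'rV[R]_N) (U : 'M[R]_(m, N)) :
  (0 < m)%N -> U *m U^T = 1%:M -> S `<=` range (fun x : 'rV[R]_m => x *m U) ->
  subspace_volume m' S = lebesgue_outer [set x : 'rV[R]_m | S (x *m U)].
Proof.
case: m' / e => m0 UU SU.
rewrite /subspace_volume (@common_value_eq _ _ _ _ _ U)// => V [VV SV].
pose T := U *m V^T.
have TT : T^T = V *m U^T by rewrite /T trmx_mul trmxK.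
have proj (W : 'M[R]_(m, N)) : W *m W^T = 1%:M -> S `<=` range (fun x : 'rV[R]_m => x *m W) ->
    forall y, S y -> y *m W^T *m W = y.
  by move=> WW SW y /SW [x _ <-]; rewrite -(mulmxA x) WW mulmx1.
have UV x : S (x *m U) -> S (x *m T *m V).
  by move=> Sx; rewrite /T mulmxA (proj V).
have VU x : S (x *m V) -> S (x *m T^T *m U).
  by move=> Sx; rewrite TT mulmxA (proj U).
have UTT x : S (x *m U) -> x *m T *m T^T = x.
  by move=> Sx; rewrite TT /T !mulmxA (proj V VV SV)// -mulmxA UU mulmx1.
have VTT x : S (x *m V) -> x *m T^T *m T = x.
  by move=> Sx; rewrite TT /T !mulmxA (proj U UU SU)// -mulmxA VV mulmx1.
have [T1|T1] := eqVneq (T *m T^T) 1%:M.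
  have uT : T \in unitmx by have [] := mulmx1_unit T1.
  have d1 : `|\det T| = 1.
    have := congr1 determinant T1; rewrite det1 det_mulmx det_tr -expr2 => /eqP.
    by rewrite sqrf_eq1 => /orP[] /eqP ->; rewrite ?normrN normr1.
  rewrite -[LHS]mul1e -[1%E]/((1 : R)%:E) -[in LHS](invr1 R) -d1 -lebesgue_outer_linN//.
  congr lebesgue_outer; apply/seteqP; split => x /=; last exact: UV.
  by move=> /VU; rewrite -(mulmxA x) T1 mulmx1.
have T1' : T^T *m T != 1%:M by apply: contra_neq T1 => /mulmx1C.
rewrite (@lebesgue_outer_kernel _ (T^T *m T - 1%:M))//.
- rewrite (@lebesgue_outer_kernel _ (T *m T^T - 1%:M))//; first by rewrite subr_eq0.
  by move=> x /UTT; rewrite mulmxBr mulmx1 (mulmxA x T) => ->; rewrite subrr.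
- by rewrite subr_eq0.
- by move=> x /VTT; rewrite mulmxBr mulmx1 (mulmxA x T^T) => ->; rewrite subrr.
Qed.

End EuclideanVolume.

Section AbsCos.
Variables (R : realType) (k : scalar_kind) (p q : nat).
Hypothesis hp : (0 < p)%N.
Local Notation K := (scalars R k).
Local Notation d := (dimR k).
Local Notation bo := (b_o R k p q).
Local Notation iota x := (rmx (fun v : 'cV[K]_ _ => x *m v)).

(** The first p columns of a unitary matrix have an isometric real form. *)
Lemma VolRE (u : 'M[K]_(p + q)) (E : set 'cV[K]_(p + q)) : SU u ->
  E `<=` gr_set (act u bo) ->
  VolR E = lebesgue_outer [set x | E (lsubmx u *m (ofR x : 'cV[K]_p))].
Proof.
move=> Su Eu; have [Gu _] := SU_SL Su.
have e : (p * 1 * d = d * p)%N by rewrite muln1 mulnC.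
have m0 : (0 < p * 1 * d)%N by rewrite muln1 muln_gt0 hp dimR_gt0.
have WW : iota (lsubmx u) *m (iota (lsubmx u))^T = 1%:M.
  by rewrite -iota_adj -iotaM lsubmx_SU// iota1.
have iotaE (x : 'rV_(p * 1 * d)) : x *m iota (lsubmx u) = toR (lsubmx u *m (ofR x : 'cV[K]_p)).
  by rewrite (toR_rmx _ (@real_linear_mulmx _ _ _ _ _ (lsubmx u))) ofRK.
rewrite /VolR (subspace_volumeE e m0 WW); last first.
  move=> _ [v /Eu + <-]; rewrite gr_act_bo// => -[x _ <-].
  by exists (toR x); rewrite // iotaE toRK.
congr lebesgue_outer; apply/seteqP; split => x /=; rewrite iotaE.
  by move=> [v Ev] /(can_inj (@toRK R k _ _)) <-.
by move=> Ex; exists (lsubmx u *m (ofR x : 'cV[K]_p)).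
Qed.

Lemma lebesgue_unit_cube N : (0 < N)%N ->
  lebesgue_outer (box (0 : 'rV[R]_N) (const_mx 1)) = 1%E.
Proof.
case: N => // N _; rewrite lebesgue_outer_box /box_volume big1// => i _.
by rewrite !mxE subr0 max_r.
Qed.

(** In the orthonormal coordinates given by u and v the orthogonal projection is left
    multiplication by v_p^* u_p, where the index p stands for the first p columns; it
    multiplies volumes by its real determinant. A unit cube in b is an admissible
    convex set. *)
Lemma abs_CosE (u v : 'M[K]_(p + q)) : SU u -> SU v ->
  abs_Cos (act u bo) (act v bo) = absdet (adj (lsubmx v) *m lsubmx u).
Proof.
move=> Su Sv; have [Gu _] := SU_SL Su; have [Gv _] := SU_SL Sv.
have m0 : (0 < p * 1 * d)%N by rewrite muln1 muln_gt0 hp dimR_gt0.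
pose x1 : set 'rV[R]_(p * 1 * d) := box 0 (const_mx 1).
pose E0 : set 'cV[K]_(p + q) := [set lsubmx u *m (ofR x : 'cV[K]_p) | x in x1].
have val E : E `<=` gr_set (act u bo) -> VolR E = 1%E ->
    fine (VolR (orth_proj (act v bo) @` E)) `^ d%:R^-1 = absdet (adj (lsubmx v) *m lsubmx u).
  move=> Eu E1; rewrite (VolRE Sv); last first.
    by move=> _ [w _ <-]; rewrite orth_projE; have [] := projP (act v bo).
  set z := adj (lsubmx v) *m lsubmx u.
  rewrite (_ : [set x | _] = [set x *m iota z | x in [set x | E (lsubmx u *m (ofR x : 'cV[K]_p))]]).
    by rewrite lebesgue_outer_image// -VolRE// E1 mule1.
  apply/seteqP; split => y /=.
    move=> [w Ew]; rewrite orth_projE (proj_SU Sv) -mulmxA.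
    have /Eu := Ew; rewrite gr_act_bo// => -[x _ xw] wy.
    exists (toR x); first by rewrite toRK xw.
    rewrite -(toR_rmx _ (@real_linear_mulmx _ _ _ _ _ z)); apply: (can_inj (@ofRK R k p 1)).
    rewrite toRK -[RHS]mul1mx -(lsubmx_SU Sv) -[RHS]mulmxA -wy -xw.
    by rewrite !mulmxA (lsubmx_SU Sv) mul1mx.
  move=> [x Ex <-]; exists (lsubmx u *m (ofR x : 'cV[K]_p)) => //.
  rewrite orth_projE (proj_SU Sv) -!mulmxA; congr (_ *m _).
  apply: (can_inj (@toRK R k p 1)).
  by rewrite mulmxA (toR_rmx _ (@real_linear_mulmx _ _ _ _ _ z)) !ofRK.
have E0u : E0 `<=` gr_set (act u bo).
  by move=> _ [x _ <-]; rewrite gr_act_bo//; exists (ofR x).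
have inj (x : 'rV[R]_(p * 1 * d)) : E0 (lsubmx u *m (ofR x : 'cV[K]_p)) -> x1 x.
  move=> [y y1] /(congr1 (mulmx (adj (lsubmx u)))); rewrite !mulmxA (lsubmx_SU Su) !mul1mx.
  by move=> /(can_inj (@ofRK R k p 1)) <-.
have E01 : VolR E0 = 1%E.
  rewrite (VolRE Su E0u) -(lebesgue_unit_cube m0); congr lebesgue_outer.
  by apply/seteqP; split => x /=; [exact: inj | move=> x1x; exists x].
rewrite /abs_Cos (@common_value_eq _ _ _ _ _ E0) ?val//.
  split => //.
    move=> x y l; rewrite !inE => -[_ [a a1 <-] <-] [_ [b b1 <-] <-].
    exists (lsubmx u *m (ofR (l%:num *: a + (1 - l%:num) *: b) : 'cV[K]_p)).
      exists (l%:num *: a + (1 - l%:num) *: b) => // i.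
      have l0 : 0 <= l%:num by exact: ge0.
      have l1 : l%:num <= 1 by exact: le1.
      by have := a1 i; have := b1 i; rewrite !mxE => /andP[? ?] /andP[? ?]; apply/andP; split; nra.
    rewrite !(toR_rmx _ (@real_linear_mulmx _ _ _ _ _ (lsubmx u))) !ofRK mulmxDl -!scalemxAl.
    by [].
  exists 0; last by rewrite -[ofR 0](_ : 0 = _) ?mulmx0//; apply: (can_inj (@toRK R k p 1)); rewrite ofRK toR0.
  by move=> i; rewrite !mxE lexx ler01.
by move=> E [Eu _ _ E1]; rewrite val.
Qed.

(** The projection matrix depends on b alone and continuously, unlike a unitary
    matrix moving b_o to b. *)
Lemma abs_Cos_proj (v : 'M[K]_(p + q)) b : (0 < q)%N -> SU v ->
  abs_Cos b (act v bo) =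
  `|detR (adj (lsubmx v) *m proj b *m lsubmx v)| `^ (2 * d%:R)^-1.
Proof.
move=> q0 Sv; have [u Su ->] := transitive_SU b q0.
rewrite (abs_CosE Su Sv) (proj_SU Su).
set z := adj (lsubmx v) *m lsubmx u.
have -> : adj (lsubmx v) *m (lsubmx u *m adj (lsubmx u)) *m lsubmx v = z *m adj z.
  by rewrite /z adjM adjK !mulmxA.
rewrite detRM detR_adj normrM -expr2 -powR_mulrn// -powRrM /absdet; congr powR.
by rewrite invfM mulrA mulfV// mul1r.
Qed.

Lemma abs_Cos_act (u : 'M[K]_(p + q)) b c : (0 < q)%N -> SU u ->
  abs_Cos (act u b) (act u c) = abs_Cos b c.
Proof.
move=> q0 Su; have [g Sg ->] := transitive_SU b q0; have [h Sh ->] := transitive_SU c q0.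
have [Gu _] := SU_SL Su; have [Gg _] := SU_SL Sg; have [Gh _] := SU_SL Sh.
rewrite (act_act _ Gu Gg) (act_act _ Gu Gh).
rewrite (abs_CosE (SUM Su Sg) (SUM Su Sh)) (abs_CosE Sg Sh).
by rewrite !lsubmx_mul adjM mulmxA -(mulmxA _ _ u) (SU_unitary Su) mulmx1.
Qed.

End AbsCos.

(** * Matrix expressions with coordinates in a function algebra *)

(** Continuity and measurability of the coordinates of a matrix expression are treated
    together: both the continuous and the measurable functions form an algebra. *)
Record is_funalg (R : realType) (T : Type) (A : set (T -> R)) : Prop := IsFunalg {
  funalg_cst : forall c, A (fun=> c);
  funalgD : forall f g, A f -> A g -> A (fun t => f t + g t);
  funalgM : forall f g, A f -> A g -> A (fun t => f t * g t) }.

Section FunctionAlgebra.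
Variables (R : realType) (k : scalar_kind) (T : Type) (A : set (T -> R)).
Hypothesis algA : is_funalg A.
Local Notation K := (scalars R k).
Local Notation d := (dimR k).
Local Notation sc := (@scoord R k).

Lemma funalgN f : A f -> A (fun t => - f t).
Proof.
move=> Af; rewrite (_ : (fun t => _) = (fun t => (-1) * f t)); last first.
  by apply/funext => t; rewrite mulN1r.
by apply: (funalgM algA) => //; exact: (funalg_cst algA).
Qed.

Lemma funalg_sum (I : Type) (r : seq I) (P : pred I) (f : I -> T -> R) :
  (forall i, A (f i)) -> A (fun t => \sum_(i <- r | P i) f i t).
Proof.
move=> Af; elim: r => [|i r IH].
  rewrite (_ : (fun t => _) = (fun=> 0)); last by apply/funext => t; rewrite big_nil.
  exact: (funalg_cst algA).
rewrite (_ : (fun t => _) = (fun t => (if P i then f i t else 0) + \sum_(j <- r | P j) f j t)).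
  apply: (funalgD algA) => //; case: (P i) => //; exact: (funalg_cst algA).
by apply/funext => t; rewrite big_cons; case: (P i); rewrite ?add0r.
Qed.

Lemma funalg_prod (I : Type) (r : seq I) (f : I -> T -> R) :
  (forall i, A (f i)) -> A (fun t => \prod_(i <- r) f i t).
Proof.
move=> Af; elim: r => [|i r IH].
  rewrite (_ : (fun t => _) = (fun=> 1)); last by apply/funext => t; rewrite big_nil.
  exact: (funalg_cst algA).
rewrite (_ : (fun t => _) = (fun t => f i t * \prod_(j <- r) f j t)).
  exact: (funalgM algA).
by apply/funext => t; rewrite big_cons.
Qed.

Lemma funalg_det n (M : T -> 'M[R]_n) : (forall i j, A (fun t => M t i j)) ->
  A (fun t => \det (M t)).
Proof.
move=> AM; rewrite /determinant; apply: funalg_sum => s.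
by apply: (funalgM algA); [exact: (funalg_cst algA) | exact: funalg_prod].
Qed.

Definition mxA m n (X : T -> 'M[K]_(m, n)) :=
  forall i j l, A (fun t => sc (X t i j) 0 l).

Lemma mxA_toR m n (X : T -> 'M[K]_(m, n)) :
  mxA X <-> (forall i, A (fun t => toR (X t) 0 i)).
Proof.
split=> [AX x|AX i j l].
  have [i [j [l ->]]] := toR_index x.
  by rewrite (_ : (fun t => _) = (fun t => sc (X t i j) 0 l)) //; apply/funext => t; rewrite toRE.
by rewrite (_ : (fun t => _) = (fun t => toR (X t) 0 (mxvec_index (mxvec_index i j) l))) //; apply/funext => t; rewrite toRE.
Qed.

Lemma mxA_cst m n (X : 'M[K]_(m, n)) : mxA (fun=> X).
Proof. by move=> i j l; exact: (funalg_cst algA). Qed.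

Lemma mxA_add m n (X Y : T -> 'M[K]_(m, n)) : mxA X -> mxA Y -> mxA (fun t => X t + Y t).
Proof.
move=> AX AY i j l.
rewrite (_ : (fun t => _) = (fun t => sc (X t i j) 0 l + sc (Y t i j) 0 l)).
  exact: (funalgD algA).
by apply/funext => t; rewrite mxE scoordD mxE.
Qed.

Lemma mxA_adj m n (X : T -> 'M[K]_(m, n)) : mxA X -> mxA (fun t => adj (X t)).
Proof.
move=> AX i j l; have {}AX := AX j i.
have [b Hb] : exists b : bool, forall x : K, sc (conjs x) 0 l = (-1) ^+ b * sc x 0 l.
  case: k l => /= l.
  - by exists false => x; rewrite expr0 mul1r.
  - exists (l != 0) => -[x y]; rewrite !mxE /=; case: l => -[|[|]]//= _;
    by rewrite ?expr0 ?expr1 ?mul1r ?mulN1r.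
  - exists (l != 0) => -[x y z w]; rewrite !mxE /=; case: l => -[|[|[|[|]]]]//= _;
    by rewrite ?expr0 ?expr1 ?mul1r ?mulN1r.
rewrite (_ : (fun t => _) = (fun t => (-1) ^+ b * sc (X t j i) 0 l)).
  by apply: (funalgM algA) => //; exact: (funalg_cst algA).
by apply/funext => t; rewrite !mxE Hb.
Qed.

Lemma mulA_scoord (x y : T -> K) : (forall l, A (fun t => sc (x t) 0 l)) ->
  (forall l, A (fun t => sc (y t) 0 l)) -> forall l, A (fun t => sc (x t * y t) 0 l).
Proof.
move=> Ax Ay l.
pose e l' : K := @of_scoord R k (delta_mx 0 l').
have sc0 : sc 0 = 0 by apply: (@addrI _ (sc 0)); rewrite -scoordD !addr0.
have xE z : z = \sum_l @of_real R k (sc z 0 l) * e l.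
  apply: (can_inj (@scoordK R k)); rewrite (big_morph _ (@scoordD R k) sc0).
  rewrite {1}[sc z]row_sum_delta.
  by apply: eq_bigr => l' _; rewrite scoordZ of_scoordK.
rewrite (_ : (fun t => _) = (fun t => \sum_a \sum_b
   sc (x t) 0 a * (sc (y t) 0 b * sc (e a * e b) 0 l))).
  apply: funalg_sum => a; apply: funalg_sum => b.
  apply: (funalgM algA) => //; apply: (funalgM algA) => //; exact: (funalg_cst algA).
apply/funext => t; rewrite {1}(xE (x t)) {1}(xE (y t)).
have scsum (I : finType) (F : I -> K) : sc (\sum_i F i) 0 l = \sum_i sc (F i) 0 l.
  by rewrite (big_morph _ (@scoordD R k) sc0) summxE.
rewrite mulr_suml scsum; apply: eq_bigr => a _.
rewrite mulr_sumr scsum; apply: eq_bigr => b _.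
rewrite mulrA -(mulrA _ (e a)) -of_realC -!mulrA !scoordZ !mxE.
by [].
Qed.

Lemma mxA_mul m n r (X : T -> 'M[K]_(m, n)) (Y : T -> 'M[K]_(n, r)) :
  mxA X -> mxA Y -> mxA (fun t => X t *m Y t).
Proof.
move=> AX AY i j l.
rewrite (_ : (fun t => _) = (fun t => \sum_h sc (X t i h * Y t h j) 0 l)).
  by apply: funalg_sum => h; apply: mulA_scoord.
apply/funext => t; rewrite mxE (big_morph _ (@scoordD R k) (_ : sc 0 = 0)) ?summxE//.
by apply: (@addrI _ (sc 0)); rewrite -scoordD !addr0.
Qed.

(** Each entry of the real form is a coordinate of a product with a constant
    column. *)
Lemma mxA_iota n (X : T -> 'M[K]_n) i j : mxA X ->
  A (fun t => rmx (fun v : 'cV[K]_n => X t *m v) i j).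
Proof.
move=> AX.
rewrite (_ : (fun t => _) = (fun t => toR (X t *m (ofR (delta_mx 0 i) : 'cV[K]_n)) 0 j)).
  by move: j; apply/mxA_toR; apply: mxA_mul => //; exact: mxA_cst.
apply/funext => t; rewrite (toR_rmx _ (@real_linear_mulmx _ _ _ _ _ (X t))) ofRK.
by rewrite -rowE [RHS]mxE.
Qed.

Lemma mxA_detR n (X : T -> 'M[K]_n) : mxA X -> A (fun t => detR (X t)).
Proof. by move=> AX; apply: funalg_det => i j; exact: mxA_iota. Qed.

Lemma mxA_ofR m n (X : T -> 'rV[R]_(m * n * d)) :
  (forall i, A (fun t => X t 0 i)) -> mxA (fun t => ofR (X t) : 'M[K]_(m, n)).
Proof.
move=> AX; apply/mxA_toR => i.
by rewrite (_ : (fun t => _) = (fun t => X t 0 i))//; apply/funext => t; rewrite ofRK.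
Qed.

Lemma mxA_invK n (X : T -> 'M[K]_n) : mxA X -> A (fun t => (detR (X t))^-1) ->
  mxA (fun t => invK (X t)).
Proof.
move=> AX Ad i j l.
pose Z t : 'cV[K]_n := ofR (toR (delta_mx j 0 : 'cV[K]_n) *m
   ((detR (X t))^-1 *: \adj (rmx (fun v : 'cV[K]_n => X t *m v)))).
rewrite (_ : (fun t => _) = (fun t => sc (Z t i 0) 0 l)); last by apply/funext => t; rewrite mxE.
suff : mxA Z by apply.
apply: mxA_ofR => h.
rewrite (_ : (fun t => _) = (fun t => \sum_a toR (delta_mx j 0 : 'cV[K]_n) 0 a *
   ((detR (X t))^-1 * cofactor (rmx (fun v : 'cV[K]_n => X t *m v)) h a))).
  apply: funalg_sum => a; apply: (funalgM algA); first exact: (funalg_cst algA).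
  apply: (funalgM algA) => //; rewrite /cofactor.
  apply: (funalgM algA); first exact: (funalg_cst algA).
  apply: funalg_det => x y.
  rewrite (_ : (fun t => _) = (fun t => rmx (fun v : 'cV[K]_n => X t *m v) (lift h x) (lift a y))).
    exact: mxA_iota.
  by apply/funext => t; rewrite !mxE.
by apply/funext => t; rewrite mxE; apply: eq_bigr => a _; rewrite !mxE.
Qed.

Lemma mxA_nrm2 m n (X : T -> 'M[K]_(m, n)) : mxA X -> A (fun t => nrm2 (X t)).
Proof.
move=> /mxA_toR AX.
rewrite (_ : (fun t => _) = (fun t => \sum_i toR (X t) 0 i * toR (X t) 0 i)).
  by apply: funalg_sum => i; apply: (funalgM algA).
by apply/funext => t; rewrite nrm2E; apply: eq_bigr => i _; rewrite expr2.
Qed.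

End FunctionAlgebra.

Lemma funalg_continuous (R : realType) (T : topologicalType) :
  is_funalg [set f : T -> R | continuous f].
Proof.
split=> [c x|f g cf cg x|f g cf cg x] /=; first exact: cvg_cst.
  by apply: continuousD; [exact: cf | exact: cg].
by apply: continuousM; [exact: cf | exact: cg].
Qed.

Lemma funalg_measurable (R : realType) d (T : measurableType d) :
  is_funalg [set f : T -> R | measurable_fun [set: T] f].
Proof.
split=> [c|f g mf mg|f g mf mg] /=; first exact: measurable_cst.
  exact: measurable_funD.
exact: measurable_funM.
Qed.

(** * Linear changes of variables *)

Lemma ge0_integral_preimage d d' (T1 : measurableType d) (T2 : measurableType d')
    (R : realType) (m1 : {measure set T1 -> \bar R}) (m2 : {measure set T2 -> \bar R})
    (f : T1 -> T2) (c : R) (g : T2 -> \bar R) :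
  measurable_fun [set: T1] f -> 0 <= c ->
  (forall E, measurable E -> m1 (f @^-1` E) = (c%:E * m2 E)%E) ->
  measurable_fun [set: T2] g -> (forall x, (0 <= g x)%E) ->
  (\int[m1]_x g (f x) = c%:E * \int[m2]_x g x)%E.
Proof.
move=> mf c0 H mg g0.
rewrite -(@ge0_integral_pushforward _ _ _ _ _ f mf m1 setT g)//.
pose c' := NngNum c0.
pose m1f := measure_function_pushforward__canonical__measure_function_Measure m1 mf.
rewrite -(ge0_integral_mscale m2 measurableT c' mg)//.
rewrite -[LHS]/(\int[m1f]_y g y)%E.
by apply: eq_measure_integral => E mE _; exact: H.
Qed.

Section LebesgueExists.
Variable R : realType.

(** What is needed of Lebesgue measure on a nonzero finite-dimensional space, in a form
    where the dimension may be any expression. *)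
Record is_lebesgue N (l : {sigma_finite_measure set (rVB R N) -> \bar R}) : Prop := {
  lebesgueT : forall (v : 'rV[R]_N) (E : set (rVB R N)), measurable E ->
    l [set x : rVB R N | E ((x : 'rV_N) + v)] = l E;
  lebesgue_lin : forall (T : 'M[R]_N) (E : set (rVB R N)), T \in unitmx -> measurable E ->
    l [set x : rVB R N | E (((x : 'rV_N) *m T) : rVB R N)] = (`|\det T|^-1%:E * l E)%E;
  lebesgue_cube_lty : forall r : R, (l (cube N r) < +oo)%E;
  lebesgue_cube_gt0 : forall r : R, 0 < r -> (0 < l (cube N r))%E;
  lebesgue_haar : forall mu : {measure set (rVB R N) -> \bar R},
    (forall r, mu (cube N r) < +oo)%E ->
    (forall (v : 'rV[R]_N) (E : set (rVB R N)), measurable E ->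
       mu [set x : rVB R N | E ((x : 'rV_N) + v)] = mu E) ->
    exists2 c : R, 0 <= c & forall E : set (rVB R N), measurable E -> mu E = (c%:E * l E)%E }.

Lemma lebesgue_exists N : (0 < N)%N ->
  exists l : {sigma_finite_measure set (rVB R N) -> \bar R}, is_lebesgue l.
Proof.
case: N => // n _; exists (@lebesgue_rV R n); split.
- by move=> v E _; exact: lebesgue_rV_translate.
- by move=> T E uT mE; exact: lebesgue_rV_lin.
- move=> r; rewrite (_ : _ (cube n.+1 r) = (box_volume (const_mx (- r) : 'rV[R]_n.+1) (const_mx r))%:E) ?ltry//.
  exact: lebesgue_rV_box.
- move=> r r0; rewrite (_ : _ (cube n.+1 r) = ((2 * r) ^+ n.+1)%:E).
    by rewrite lte_fin exprn_gt0// mulr_gt0.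
  by apply: lebesgue_cube; exact: ltW.
- by move=> mu fin; apply: haar_lebesgue => k'; exact: fin.
Qed.

Lemma measurable_cube N (r : R) : measurable (cube N r : set (rVB R N)).
Proof. exact: measurable_box. Qed.

Section ChangeOfVariables.
Variables (N : nat) (l : {sigma_finite_measure set (rVB R N) -> \bar R}).
Hypothesis hl : is_lebesgue l.

Lemma integral_lin (T : 'M[R]_N) (g : rVB R N -> \bar R) : T \in unitmx ->
  measurable_fun [set: rVB R N] g -> (forall x, (0 <= g x)%E) ->
  (\int[l]_x g x = `|\det T|%:E * \int[l]_x g (((x : 'rV_N) *m T) : rVB R N))%E.
Proof.
move=> uT mg g0.
have d0 : 0 < `|\det T| by rewrite normr_gt0 -unitfE -unitmxE.
rewrite (ge0_integral_preimage (c := `|\det T|^-1) (m2 := l) (measurable_rV_lin T))//.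
  by rewrite muleA -EFinM divff ?mul1e// gt_eqF.
by move=> E mE; exact: (lebesgue_lin hl).
Qed.

Lemma integral_translate (v : 'rV[R]_N) (g : rVB R N -> \bar R) :
  measurable_fun [set: rVB R N] g -> (forall x, (0 <= g x)%E) ->
  (\int[l]_x g ((x : 'rV_N) + v)%R = \int[l]_x g x)%E.
Proof.
move=> mg g0.
have mv : measurable_fun [set: rVB R N] (fun x : rVB R N => ((x : 'rV_N) + v : 'rV_N) : rVB R N).
  apply: (measurableT_comp (@measurable_rV_add R N) (g := fun x : rVB R N => (x, v : rVB R N))).
  by apply: measurable_fun_pair => //; exact: measurable_cst.
rewrite (ge0_integral_preimage (c := 1) (m2 := l) mv)// ?mul1e//.
by move=> E mE; rewrite mul1e; exact: (lebesgueT hl).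
Qed.

End ChangeOfVariables.

End LebesgueExists.

(** * Lebesgue measure on pairs of matrices *)

Notation measurable_mx X := (mxA [set f | measurable_fun [set: _] f] X).

Section Pairs.
Variables (R : realType) (k : scalar_kind) (p q : nat).
Hypotheses (hp : (0 < p)%N) (hq : (0 < q)%N).
Local Notation K := (scalars R k).
Local Notation d := (dimR k).
Local Notation TA := (rVB R (p * p * d)).
Local Notation TB := (rVB R (q * p * d)).
Variables (lA : {sigma_finite_measure set TA -> \bar R})
          (lB : {sigma_finite_measure set TB -> \bar R}).
Hypotheses (hA : is_lebesgue lA) (hB : is_lebesgue lB).
Local Notation gam := (lA \x lB)%E.

(** A pair (A, B) of matrices is the (p + q) x p matrix with upper block A and lower
    block B, that is, generically a frame of a p-dimensional subspace. *)
Definition pmx (z : TA * TB) : 'M[K]_(p + q, p) :=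
  col_mx (ofR (z.1 : 'rV[R]_(p * p * d))) (ofR (z.2 : 'rV[R]_(q * p * d))).

Definition punmx (X : 'M[K]_(p + q, p)) : TA * TB := (toR (usubmx X), toR (dsubmx X)).

Lemma pmxK : cancel pmx punmx.
Proof. by case=> a b; rewrite /punmx /pmx col_mxKu col_mxKd !ofRK. Qed.

Lemma punmxK : cancel punmx pmx.
Proof. by move=> X; rewrite /punmx /pmx /= !toRK vsubmxK. Qed.

Section Measurability.
Context dT (T : measurableType dT).
Let mT := @funalg_measurable R dT T.

Lemma measurable_mx_ofR m n (f : T -> rVB R (m * n * d)) : measurable_fun [set: T] f ->
  measurable_mx (fun t => ofR (f t : 'rV_(m * n * d)) : 'M[K]_(m, n)).
Proof.
move=> mf; apply: mxA_ofR => i.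
exact: (measurableT_comp (measurable_coord i) mf).
Qed.

Lemma measurable_toR m n (X : T -> 'M[K]_(m, n)) : measurable_mx X ->
  measurable_fun [set: T] (fun t => toR (X t) : rVB R (m * n * d)).
Proof. by move=> /mxA_toR mX; apply: measurable_to_rVB => i; exact: mX. Qed.

Lemma measurable_pmx (z : T -> TA * TB) : measurable_fun [set: T] z ->
  measurable_mx (fun t => pmx (z t)).
Proof.
move=> mz; rewrite (_ : (fun t => _) = fun t =>
   col_mx 1%:M 0 *m ofR ((z t).1 : 'rV[R]_(p * p * d)) +
   col_mx 0 1%:M *m ofR ((z t).2 : 'rV[R]_(q * p * d))).
  apply: mxA_add => //; apply: mxA_mul => //; do ?exact: mxA_cst.
    by apply: measurable_mx_ofR; exact: measurableT_comp measurable_fst mz.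
  by apply: measurable_mx_ofR; exact: measurableT_comp measurable_snd mz.
by apply/funext => t; rewrite !mul_col_mx !mul1mx !mul0mx add_col_mx addr0 add0r.
Qed.

Lemma measurable_punmx (X : T -> 'M[K]_(p + q, p)) : measurable_mx X ->
  measurable_fun [set: T] (fun t => punmx (X t)).
Proof.
move=> mX; apply: measurable_fun_pair.
  apply: measurable_toR; rewrite (_ : (fun t => _) = fun t => row_mx 1%:M 0 *m X t).
    by apply: mxA_mul => //; exact: mxA_cst.
  by apply/funext => t; rewrite -{2}[X t]vsubmxK mul_row_col mul1mx mul0mx addr0.
apply: measurable_toR; rewrite (_ : (fun t => _) = fun t => row_mx 0 1%:M *m X t).
  by apply: mxA_mul => //; exact: mxA_cst.
by apply/funext => t; rewrite -{2}[X t]vsubmxK mul_row_col mul1mx mul0mx add0r.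
Qed.

End Measurability.

Definition pact (g : 'M[K]_(p + q)) (z : TA * TB) : TA * TB := punmx (g *m pmx z).

Lemma measurable_pact g : measurable_fun [set: TA * TB] (pact g).
Proof.
apply: measurable_punmx; apply: mxA_mul; [exact: funalg_measurable| |].
  by apply: mxA_cst; exact: funalg_measurable.
by apply: measurable_pmx; exact: measurable_id.
Qed.

Lemma pmx_pact g z : pmx (pact g z) = g *m pmx z.
Proof. by rewrite /pact punmxK. Qed.

Lemma pactM g h z : pact g (pact h z) = pact (g *m h) z.
Proof. by rewrite /pact punmxK mulmxA. Qed.

Definition padd (z w : TA * TB) : TA * TB :=
  ((z.1 : 'rV[R]_(p * p * d)) + (w.1 : 'rV_(p * p * d)),
   (z.2 : 'rV[R]_(q * p * d)) + (w.2 : 'rV_(q * p * d))).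

Definition popp (z : TA * TB) : TA * TB :=
  (- (z.1 : 'rV[R]_(p * p * d)), - (z.2 : 'rV[R]_(q * p * d))).

Lemma ofRD m n (x y : 'rV[R]_(m * n * d)) : ofR (x + y) = ofR x + ofR y :> 'M[K]_(m, n).
Proof.
apply: (can_inj (@toRK R k m n)); rewrite ofRK.
by have := toR_lin 1 (ofR x) (ofR y); rewrite re1 mul1mx => ->; rewrite !ofRK scale1r.
Qed.

Lemma ofRN m n (x : 'rV[R]_(m * n * d)) : ofR (- x) = - ofR x :> 'M[K]_(m, n).
Proof.
apply: (@addrI _ (ofR x)); rewrite -ofRD !subrr.
by apply: (can_inj (@toRK R k m n)); rewrite ofRK toR0.
Qed.

Lemma pmxD z w : pmx (padd z w) = pmx z + pmx w.
Proof. by rewrite /pmx /= !ofRD add_col_mx. Qed.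

Lemma pmxN z : pmx (popp z) = - pmx z.
Proof. by rewrite /pmx /= !ofRN opp_col_mx. Qed.

Lemma pact_add g z w : pact g (padd z w) = padd (pact g z) (pact g w).
Proof. by apply: (can_inj pmxK); rewrite pmxD !pmx_pact pmxD mulmxDr. Qed.

Lemma measurable_padd :
  measurable_fun [set: (TA * TB) * (TA * TB)] (fun z => padd z.1 z.2).
Proof.
rewrite (_ : (fun z => _) = (fun z => punmx (pmx z.1 + pmx z.2))).
  apply: measurable_punmx; apply: mxA_add; first exact: funalg_measurable.
    by apply: measurable_pmx; exact: measurable_fst.
  by apply: measurable_pmx; exact: measurable_snd.
by apply/funext => z; apply: (can_inj pmxK); rewrite pmxD punmxK.
Qed.

Lemma measurable_popp : measurable_fun [set: TA * TB] popp.
Proof.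
by apply: measurable_fun_pair;
   apply: (measurableT_comp (@measurable_rV_opp R _));
   [exact: measurable_fst | exact: measurable_snd].
Qed.

Lemma gam_translate w E : measurable E -> gam [set z | E (padd z w)] = gam E.
Proof.
case: w => a b mE; rewrite /product_measure1 /=.
have mxs := measurable_fun_xsection lB mE.
rewrite -(integral_translate hA a mxs)//.
apply: eq_integral => x _ /=.
rewrite -[RHS](lebesgueT hB b); last exact: measurable_xsection.
by congr (lB _); apply/seteqP; split => y /=; rewrite /xsection /= !inE.
Qed.

Lemma nrm2_col m1 m2 n (X : 'M[K]_(m1, n)) (Y : 'M[K]_(m2, n)) :
  nrm2 (col_mx X Y) = nrm2 X + nrm2 Y.
Proof. by rewrite /nrm2 adj_col_mx mul_row_col raddfD realpartD. Qed.

Lemma nrm2_cube m n (x : 'rV[R]_(m * n * d)) (r : R) :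
  nrm2 (ofR x : 'M[K]_(m, n)) <= r -> cube (m * n * d) (1 + r) x.
Proof.
move=> xr; apply/cubeP => i.
have xi : (x 0 i) ^+ 2 <= r.
  apply: le_trans xr; rewrite nrm2E ofRK (bigD1 i)//= lerDl sumr_ge0// => j _.
  exact: sqr_ge0.
have r0 : 0 <= r by apply: le_trans xi; exact: sqr_ge0.
by rewrite ler_norml; nra.
Qed.

Lemma cube_nrm2 m n (r : R) : 0 < r -> exists2 s, 0 < s &
  cube (m * n * d) s `<=` [set x | nrm2 (ofR x : 'M[K]_(m, n)) <= r].
Proof.
move=> r0; set N := (m * n * d)%N.
pose s := Num.min 1 (r / (N%:R + 1)).
have N1 : 0 < (N%:R + 1 : R) by rewrite ltr_wpDl.
have s0 : 0 < s by rewrite lt_min ltr01 divr_gt0.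
exists s => // x /cubeP xs /=; rewrite nrm2E ofRK.
apply: (@le_trans _ _ (\sum_(i < N) s)).
  apply: ler_sum => i _; rewrite -real_normK ?num_real//.
  have := xs i; have : s <= 1 by rewrite /s ge_min lexx.
  have : 0 <= `|x 0 i| by []. move=> ? ? ?; nra.
rewrite sumr_const card_ord -mulr_natr.
have sr : s * (N%:R + 1) <= r by rewrite -ler_pdivlMr// /s ge_min lexx orbT.
by apply: le_trans sr; rewrite ler_wpM2l ?(ltW s0)// lerDl.
Qed.

Lemma measurable_nrm2_le dT (T : measurableType dT) m n (X : T -> 'M[K]_(m, n)) r :
  measurable_mx X -> measurable [set t | nrm2 (X t) <= r].
Proof.
move=> mX; have := mxA_nrm2 (@funalg_measurable R _ T) mX.
move=> /(_ measurableT _ (measurable_itv `]-oo, r])); rewrite setTI.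
by congr measurable; apply/seteqP; split => z /=; rewrite in_itv.
Qed.

Definition pball (r : R) : set (TA * TB) := [set z | nrm2 (pmx z) <= r].

Lemma measurable_pball r : measurable (pball r).
Proof.
apply: measurable_nrm2_le; apply: measurable_pmx; exact: measurable_id.
Qed.

Lemma pball_lty r : (gam (pball r) < +oo)%E.
Proof.
apply: (@le_lt_trans _ _ (gam (cube (p * p * d) (1 + r) `*` cube (q * p * d) (1 + r)))).
  apply: le_measure; rewrite ?inE; first exact: measurable_pball.
    by apply: measurableX; exact: measurable_cube.
  move=> [a b]; rewrite /pball /= /pmx nrm2_col /= => abr.
  have a0 := nrm2_ge0 (ofR (a : 'rV[R]_(p * p * d)) : 'M[K]_(p, p)).
  have b0 := nrm2_ge0 (ofR (b : 'rV[R]_(q * p * d)) : 'M[K]_(q, p)).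
  by split => /=; apply: nrm2_cube; lra.
rewrite product_measure1E ?lte_mul_pinfty//; do ?exact: measurable_cube.
- by rewrite ge0_fin_numE// (lebesgue_cube_lty hA).
- exact: (lebesgue_cube_lty hB).
Qed.

Definition prect (r s : R) : set (TA * TB) :=
  [set z | nrm2 (ofR (z.1 : 'rV[R]_(p * p * d)) : 'M[K]_(p, p)) <= r /\
           nrm2 (ofR (z.2 : 'rV[R]_(q * p * d)) : 'M[K]_(q, p)) <= s].

Lemma measurable_prect r s : measurable (prect r s).
Proof.
apply: measurableI; apply: measurable_nrm2_le; apply: measurable_mx_ofR.
  exact: measurable_fst.
exact: measurable_snd.
Qed.

Lemma gam_rect_gt0 r : 0 < r -> (0 < gam (prect r r))%E.
Proof.
move=> r0; have [s s0 Hs] := cube_nrm2 p p r0; have [t t0 Ht] := cube_nrm2 q p r0.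
apply: (@lt_le_trans _ _ (gam (cube (p * p * d) s `*` cube (q * p * d) t))).
  rewrite product_measure1E ?mule_gt0//; do ?exact: measurable_cube.
    exact: (lebesgue_cube_gt0 hA).
  exact: (lebesgue_cube_gt0 hB).
apply: le_measure; rewrite ?inE; last by move=> [a b] [/= ha hb]; split; [exact: Hs | exact: Ht].
  by apply: measurableX; exact: measurable_cube.
exact: measurable_prect.
Qed.

Lemma bigcup_pball : \bigcup_n pball n%:R = setT.
Proof.
apply/seteqP; split => // z _; exists (Num.truncn (nrm2 (pmx z))).+1 => //.
by apply: ltW; exact: Num.Theory.truncnS_gt.
Qed.

Lemma gam_sigma_finite : sigma_finite setT gam.
Proof.
exists (fun n => pball n%:R); first by rewrite bigcup_pball.
by move=> n; split; [exact: measurable_pball | exact: pball_lty].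
Qed.

(** The image measure is translation invariant, hence proportional, and a ball is
    preserved. *)
Lemma gam_pact g E : unitary g -> measurable E -> gam (pact g @^-1` E) = gam E.
Proof.
move=> ug mE.
pose m1 := measure_function_pushforward__canonical__measure_function_Measure gam (measurable_pact g).
have ballK r : pact g @^-1` pball r = pball r.
  by apply/seteqP; split => z; rewrite /pball /= pmx_pact nrm2_unitary.
have sf : sigma_finite setT m1.
  exists (fun n => pball n%:R).
    by rewrite bigcup_pball.
  move=> n; split; first exact: measurable_pball.
  by rewrite /m1 /= /pushforward ballK; exact: pball_lty.
have [m1' m1E] := sigma_finite_pack sf.
have [gS gSE] := sigma_finite_pack gam_sigma_finite.
have H := @haar_unique _ _ R m1' gS padd popp E (pball 1) measurable_padd measurable_popp.
have {}H : (m1' E * gam (pball 1) = gam E * m1' (pball 1))%E.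
  rewrite -!gSE; apply: H => //; last exact: measurable_pball.
  - by move=> x y; apply: (can_inj pmxK); rewrite !pmxD pmxN addrCA subrr addr0.
  - move=> y F mF; rewrite !m1E /m1 /= /pushforward.
    rewrite -[RHS](gam_translate (pact (adj g) y)); last first.
      by rewrite -[X in measurable X]setTI; exact: measurable_pact.
    congr (product_measure1 _ _ _); apply/seteqP; split => z /=;
      by rewrite pact_add pactM unitary_sym// /pact mul1mx pmxK.
  - by move=> y F mF; rewrite !gSE; exact: gam_translate.
  - move=> x y; rewrite /pball /= !pmxD !pmxN.
    have -> : pmx y - pmx x = - (pmx x - pmx y) by rewrite opprB.
    by rewrite {2}/nrm2 adjN mulNmx mulmxN opprK.
move: H; rewrite !m1E /m1 /= /pushforward ballK muleC [RHS]muleC.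
have fin : gam (pball 1) \is a fin_num by rewrite ge0_fin_numE// pball_lty.
have gt0 : (0 < gam (pball 1))%E.
  have h2 : 0 < 1 / 2 :> R by lra.
  apply: (lt_le_trans (gam_rect_gt0 h2)).
  apply: le_measure; rewrite ?inE; [exact: measurable_prect | exact: measurable_pball |].
  by move=> [a b]; rewrite /prect /pball /= /pmx nrm2_col /=; lra.
move=> /(congr1 (fun x => (fine (gam (pball 1)))^-1%:E * x)%E).
have e : ((fine (gam (pball 1)))^-1%:E * gam (pball 1) = 1)%E.
  by rewrite -{2}(fineK fin) -EFinM mulVf// gt_eqF// fine_gt0// gt0 ltey_eq fin.
by rewrite !muleA e !mul1e.
Qed.

Lemma integral_pact g (f : TA * TB -> \bar R) : unitary g ->
  measurable_fun [set: TA * TB] f -> (forall z, (0 <= f z)%E) ->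
  (\int[gam]_z f (pact g z) = \int[gam]_z f z)%E.
Proof.
move=> ug mf f0.
rewrite (ge0_integral_preimage (c := 1) (m2 := gam) (measurable_pact g))// ?mul1e//.
by move=> E mE; rewrite mul1e; exact: gam_pact.
Qed.

End Pairs.

(** * Singular matrices are negligible *)

Lemma finite_roots (R : realType) (P : {poly R}) : P != 0 -> finite_set [set t | root P t].
Proof.
move=> P0; apply: contrapT => inf.
have [B BP] := infinite_set_fset (size P) inf.
rewrite leqNgt => /negP; apply; apply: max_poly_roots => //.
  by apply/allP => t tB; exact: BP.
exact: finmap.fset_uniq.
Qed.

Section Null.
Variables (R : realType) (k : scalar_kind) (p : nat).
Hypothesis hp : (0 < p)%N.
Local Notation K := (scalars R k).
Local Notation d := (dimR k).
Local Notation TA := (rVB R (p * p * d)).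
Local Notation re r := (@of_real R k r)%:M.
Variable lA : {sigma_finite_measure set TA -> \bar R}.
Hypothesis hA : is_lebesgue lA.

(** The function of t is a characteristic polynomial of the real form. *)
Lemma detR_shift_finite (X : 'M[K]_p) : finite_set [set t : R | detR (X + re t) = 0].
Proof.
pose M := - rmx (fun v : 'cV[K]_p => X *m v).
apply: (@sub_finite_set _ _ [set t | root (char_poly M) t]); last first.
  by apply: finite_roots; apply: monic_neq0; exact: char_poly_monic.
move=> t /=.
have -> : detR (X + re t) = \det (t%:M - M).
  rewrite detRE /M opprK; congr determinant.
  apply: eq_mulmxl => v; rewrite mulmxDr -[v]ofRK -toR_rmx; last exact: real_linear_mulmx.
  rewrite -toR_rmx; last exact: real_linear_mulmx.
  by rewrite mulmxDl addrC toR_lin mul_mx_scalar.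
move=> /eqP/det0P [v v0]; rewrite mulmxBr mul_mx_scalar => /eqP; rewrite subr_eq0 => /eqP vM.
by rewrite -eigenvalue_root_char; apply/eigenvalueP; exists v.
Qed.

(** Fubini along the lines a + t 1: each meets the set in finitely many points, while
    by translation invariance its measure would be multiplied by the infinite length of
    the line. *)
Lemma detR_null : lA [set a : TA | detR (ofR (a : 'rV[R]_(p * p * d)) : 'M[K]_p) = 0] = 0%E.
Proof.
pose v t : 'rV[R]_(p * p * d) := toR (re t : 'M[K]_p).
pose D (a : TA) := detR (ofR (a : 'rV[R]_(p * p * d)) : 'M[K]_p).
have mD : measurable_fun [set: TA] D.
  apply: mxA_detR; first exact: funalg_measurable.
  by apply: measurable_mx_ofR; exact: measurable_id.
pose Z : set (TA * measurableTypeR R)%type :=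
  [set z | D (((z.1 : 'rV[R]_(p * p * d)) + v z.2) : TA) = 0].
have mv : measurable_fun [set: measurableTypeR R] (fun t => v t : TA).
  apply: measurable_to_rVB => i.
  rewrite (_ : (fun t => _) = (fun t : R => t * v 1 0 i)); first exact: measurable_funM.
  apply/funext => t; rewrite /v; have := toR_lin t (1%:M : 'M[K]_p) 0.
  by rewrite addr0 mulmx1 toR0 addr0 re1 => ->; rewrite mxE.
have mS : measurable_fun [set: TA * measurableTypeR R]
    (fun z => ((z.1 : 'rV[R]_(p * p * d)) + v z.2 : 'rV[R]_(p * p * d)) : TA).
  apply: (measurableT_comp (@measurable_rV_add R _) (g := fun z : TA * measurableTypeR R => (z.1, v z.2 : TA))).
  apply: measurable_fun_pair; first exact: measurable_fst.
  exact: measurableT_comp mv measurable_snd.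
have mE0 : measurable [set a | D a = 0].
  have := mD measurableT _ (measurable_set1 0); rewrite setTI.
  exact.
have mZ : measurable Z.
  have := measurableT_comp mD mS => /(_ measurableT _ (measurable_set1 0)).
  by rewrite setTI.
have := indic_fubini_tonelli lA (@lebesgue_measure R) mZ.
rewrite indic_fubini_tonelli_FE// indic_fubini_tonelli_GE//.
rewrite integral0_eq; last first.
  move=> a _ /=; apply: countable_lebesgue_measure0; apply: finite_set_countable.
  have := detR_shift_finite (ofR (a : 'rV[R]_(p * p * d)) : 'M[K]_p).
  congr finite_set; apply/seteqP; split => t; rewrite /xsection /= !inE /Z /D /=;
    by rewrite ofRD /v toRK.
rewrite (eq_integral (cst (lA [set a | D a = 0]))) => [|t _]; last first.
  rewrite /= -[RHS](lebesgueT hA (v t))//; congr (lA _).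
  by apply/seteqP; split => a; rewrite /ysection /= !inE.
rewrite integral_cst// => /esym/eqP; rewrite mule_eq0 => /orP[/eqP //|].
have e : (@lebesgue_measure R [set: measurableTypeR R] = +oo)%E.
  by have := lebesgue_measure_itv (`]-oo, +oo[ : interval R); rewrite set_itvNyy /=.
by move=> /eqP h; have := etrans (esym h) e.
Qed.

End Null.

(** * Continuous functions on the Grassmannian *)

Lemma continuous_inv (R : realType) (T : topologicalType) (f : T -> R) :
  continuous f -> (forall x, f x != 0) -> continuous (fun x => (f x)^-1).
Proof. by move=> cf f0 x; apply: continuousV; [exact: f0 | exact: cf]. Qed.

Lemma measurable_inv (R : realType) d (T : measurableType d) (f : T -> R) :
  measurable_fun [set: T] f -> measurable_fun [set: T] (fun x => (f x)^-1).
Proof.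
move=> mf; rewrite (_ : (fun x => _) = (fun x => f x * (f x * f x) `^ (-1))).
  apply: measurable_funM => //.
  apply: (measurableT_comp (measurable_powR _)); exact: measurable_funM.
apply/funext => x; have [->|fx0] := eqVneq (f x) 0; first by rewrite mul0r invr0.
rewrite powR_inv1; last by rewrite -expr2 sqr_ge0.
by rewrite invfM mulrA mulfV// mul1r.
Qed.

Section GrassmannMeasurable.
Variables (R : realType) (k : scalar_kind) (p q : nat).
Local Notation K := (scalars R k).
Local Notation d := (dimR k).
Local Notation Gr := (Gr R k p q).
Local Notation GrB := (GrBorel R k p q).
Local Notation bo := (b_o R k p q).
Local Notation TA := (rVB R (p * p * d)).
Local Notation TB := (rVB R (q * p * d)).

(** Continuity for the topology of the charts. *)
Definition gcont (F : Gr -> R) : Prop :=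
  forall g, SL g -> continuous (fun x : 'rV[R]_(q * p * d) => F (chart g x)).

Lemma funalg_gcont : is_funalg gcont.
Proof.
split=> [c g Sg|f h cf ch g Sg|f h cf ch g Sg].
- exact: (funalg_cst (funalg_continuous R _)).
- apply: (funalgD (funalg_continuous R _)); [exact: cf | exact: ch].
- apply: (funalgM (funalg_continuous R _)); [exact: cf | exact: ch].
Qed.

Lemma gcont_measurable F : gcont F -> measurable_fun [set: GrB] (F : GrB -> R).
Proof.
move=> cF; apply: (measurability _ (RGenOpens.measurableE R)).
move=> _ [_ [a [b ->]] <-]; rewrite setTI; apply: sub_sigma_algebra => g Sg.
by have /continuousP := cF _ Sg; apply; exact: interval_open.
Qed.

Lemma act_chart u g (x : 'rV[R]_(q * p * d)) : SL u -> SL g ->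
  act u (chart g x : Gr) = chart (u *m g) x.
Proof.
move=> [Gu _] [Gg _]; have [Gn _] := SL_nbar (ofR x : 'M[K]_(q, p)).
by rewrite /chart act_act// ?mulmxA//; exact: GLM.
Qed.

Lemma gcont_act u F : SL u -> gcont F -> gcont (F \o act u).
Proof.
move=> Su cF g Sg; rewrite (_ : (fun x => _) = (fun x => F (chart (u *m g) x))).
  by apply: cF; exact: SLM.
by apply/funext => x /=; rewrite act_chart.
Qed.

Lemma measurable_act u : SL u -> measurable_fun [set: GrB] (act u : GrB -> GrB).
Proof.
move=> Su; apply: (measurability _ (erefl : @measurable _ GrB = <<s @gr_open R k p q >>)).
move=> _ [U oU <-]; rewrite setTI; apply: sub_sigma_algebra => g Sg.
have := oU _ (SLM Su Sg); congr open; apply/seteqP; split => x /=;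
  by rewrite act_chart.
Qed.

Lemma measurable_chart g : SL g -> measurable_fun [set: TB] (chart g : TB -> GrB).
Proof.
move=> Sg; apply: (measurability _ (erefl : @measurable _ GrB = <<s @gr_open R k p q >>)).
move=> _ [U oU <-]; rewrite setTI; apply: sub_sigma_algebra; exact: oU.
Qed.

(** In a chart a basis of the subspace is affine in the coordinates, and the
    projection is a rational expression in it. *)
Lemma gcont_proj : mxA gcont (@proj R k p q).
Proof.
move=> i j l g Sg.
set C := [set f : 'rV[R]_(q * p * d) -> R | continuous f].
have aC : is_funalg C by exact: funalg_continuous.
pose w (x : 'rV[R]_(q * p * d)) : 'M[K]_(p + q, p) := g *m lsubmx (nbar (ofR x : 'M[K]_(q, p))).
have wE x : w x = lsubmx (g *m nbar (ofR x : 'M[K]_(q, p))) by rewrite lsubmx_mul.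
have Cw : mxA C w.
  rewrite (_ : w = fun x => g *m (col_mx 1%:M 0 + col_mx 0 1%:M *m (ofR x : 'M[K]_(q, p)))).
    apply: mxA_mul => //; first exact: mxA_cst.
    apply: mxA_add => //; first exact: mxA_cst.
    apply: mxA_mul => //; first exact: mxA_cst.
    apply: mxA_ofR => h; exact: coord_continuous.
  apply/funext => x; rewrite /w /nbar block_mxEh row_mxKl; congr (_ *m _).
  by rewrite mul_col_mx mul0mx mul1mx add_col_mx addr0 add0r.
have Gx x : GL (g *m nbar (ofR x : 'M[K]_(q, p))).
  by apply: GLM; [case: Sg | case: (SL_nbar (ofR x : 'M[K]_(q, p)))].
have Cww : mxA C (fun x => adj (w x) *m w x) by apply: mxA_mul => //; exact: mxA_adj.
have d0 x : detR (adj (w x) *m w x) != 0 by rewrite wE; have [] := proj_gram (Gx x).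
rewrite (_ : (fun x => _) = (fun x => scoord ((w x *m invK (adj (w x) *m w x) *m adj (w x)) i j) 0 l)).
  suff : mxA C (fun x => w x *m invK (adj (w x) *m w x) *m adj (w x)) by apply.
  apply: mxA_mul => //; last exact: mxA_adj.
  apply: mxA_mul => //; apply: mxA_invK => //; rewrite /C /=.
  by apply: continuous_inv; [exact: (mxA_detR aC Cww) | exact: d0].
by apply/funext => x; rewrite /chart; have [_ ->] := proj_gram (Gx x); rewrite wE.
Qed.

Lemma measurable_proj dT (T : measurableType dT) (b : T -> GrB) :
  measurable_fun [set: T] b -> measurable_mx (fun t => proj (b t)).
Proof.
move=> mb i j l.
have h := gcont_measurable (@gcont_proj i j l).
exact: (@measurableT_comp _ _ _ _ _ _ (fun c : GrB => scoord (proj c i j) 0 l) setT b h mb).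
Qed.

(** F at the subspace spanned by the frame (A; B), which is the point with
    coordinate B A^-1 of the big cell. The value 0 is given to the negligible set of
    pairs with A singular. *)
Definition frame_fun (F : Gr -> R) (z : TA * TB) : R :=
  if detR (ofR (z.1 : 'rV[R]_(p * p * d)) : 'M[K]_p) == 0 then 0 else
  F (chart 1%:M (toR (ofR (z.2 : 'rV[R]_(q * p * d)) *m
       invK (ofR (z.1 : 'rV[R]_(p * p * d)) : 'M[K]_p)))).

Lemma measurable_detR dT (T : measurableType dT) n (X : T -> 'M[K]_n) :
  measurable_mx X -> measurable_fun [set: T] (fun t => detR (X t)).
Proof. by move=> mX; apply: mxA_detR => //; exact: funalg_measurable. Qed.

Lemma measurable_detR_inv dT (T : measurableType dT) n (X : T -> 'M[K]_n) :
  measurable_mx X -> measurable_fun [set: T] (fun t => (detR (X t))^-1).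
Proof.
by move=> mX; apply: measurable_inv; exact: measurable_detR.
Qed.

Lemma measurable_frame_fun F : gcont F -> measurable_fun [set: TA * TB] (frame_fun F).
Proof.
move=> cF; apply: measurable_fun_ifT => /=.
- apply: measurable_fun_eqr.
    by apply: measurable_detR; apply: measurable_mx_ofR; exact: measurable_fst.
  exact: measurable_cst.
- exact: measurable_cst.
- apply: (measurableT_comp (gcont_measurable cF)).
  apply: (measurableT_comp (measurable_chart (SL1 R k _))).
  apply: measurable_toR; apply: mxA_mul; first exact: funalg_measurable.
    by apply: measurable_mx_ofR; exact: measurable_snd.
  have mA : measurable_mx (fun z : TA * TB => ofR (z.1 : 'rV[R]_(p * p * d)) : 'M[K]_p).
    by apply: measurable_mx_ofR; exact: measurable_fst.
  apply: mxA_invK => //; first exact: funalg_measurable.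
  exact: measurable_detR_inv.
Qed.

(** The component of the frame along b is bounded and the one orthogonal to b is
    small: for small r the frame nearly spans b. The condition is invariant under
    simultaneous rotation of the frame and of b. *)
Definition near_set (r : R) : set ((TA * TB) * GrB) :=
  [set zb | nrm2 (proj zb.2 *m pmx zb.1) <= 1 /\
            nrm2 (pmx zb.1 - proj zb.2 *m pmx zb.1) <= r].

Lemma measurable_near_set r : measurable (near_set r).
Proof.
have mT := @funalg_measurable R _ ((TA * TB) * GrB)%type.
have m1 : measurable_mx (fun zb : (TA * TB) * GrB => pmx zb.1 : 'M[K]_(p + q, p)).
  by apply: measurable_pmx; exact: measurable_fst.
have m2 : measurable_mx (fun zb : (TA * TB) * GrB => proj zb.2).
  by apply: measurable_proj; exact: measurable_snd.
apply: measurableI; apply: measurable_nrm2_le; first exact: mxA_mul.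
rewrite (_ : (fun t => _) = (fun zb : (TA * TB) * GrB => pmx zb.1 + (- 1%:M) *m (proj zb.2 *m pmx zb.1))).
  by apply: mxA_add => //; apply: mxA_mul => //; [exact: mxA_cst | exact: mxA_mul].
by apply/funext => zb; rewrite mulNmx mul1mx.
Qed.

Lemma near_set_act r g z b : SU g ->
  near_set r (pact g z, act g b) <-> near_set r (z, b).
Proof.
move=> Sg; have ug := SU_unitary Sg; rewrite /near_set /= pmx_pact proj_act//.
have -> : g *m proj b *m adj g *m (g *m pmx z) = g *m (proj b *m pmx z).
  by rewrite !mulmxA -(mulmxA _ (adj g)) ug mulmx1.
rewrite -mulmxBr !(nrm2_unitary _ ug); exact: iff_refl.
Qed.

Lemma near_set_bo r z : near_set r (z, bo) <-> prect 1 r z.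
Proof.
have E1 : lsubmx (1%:M : 'M[K]_(p + q)) = col_mx 1%:M 0.
  by rewrite scalar_mx_block block_mxEh row_mxKl.
have -> : bo = act 1%:M bo by rewrite act1.
rewrite /near_set /prect /= proj_SU; last exact: SU1.
rewrite E1 adj_col_mx adj1 adj0 /pmx -mulmxA mul_row_col mul1mx mul0mx addr0.
rewrite mul_col_mx mul1mx mul0mx opp_col_mx add_col_mx subrr subr0.
rewrite !nrm2_col /nrm2 !adj0 !mulmx0 mxtrace0 realpart0 addr0 add0r; exact: iff_refl.
Qed.

End GrassmannMeasurable.

(** * Integrating out the subspace first *)

Lemma ge0_integral_scale d (T : measurableType d) (R : realType)
    (m : {measure set T -> \bar R}) (h : T -> \bar R) (c : R) :
  measurable_fun [set: T] h -> (forall x, (0 <= h x)%E) -> 0 <= c ->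
  (\int[m]_x (c%:E * h x) = c%:E * \int[m]_x h x)%E.
Proof. by move=> mh h0 c0; rewrite ge0_integralZl_EFin. Qed.

Section FrameSide.
Variables (R : realType) (k : scalar_kind) (p q : nat).
Hypotheses (hp : (0 < p)%N) (hq : (0 < q)%N).
Local Notation K := (scalars R k).
Local Notation d := (dimR k).
Local Notation Gr := (Gr R k p q).
Local Notation GrB := (GrBorel R k p q).
Local Notation bo := (b_o R k p q).
Local Notation TA := (rVB R (p * p * d)).
Local Notation TB := (rVB R (q * p * d)).
Local Notation ofA a := (ofR (a : 'rV[R]_(p * p * d)) : 'M[K]_p).
Local Notation ofB b := (ofR (b : 'rV[R]_(q * p * d)) : 'M[K]_(q, p)).
Variable mu : probability GrB R.
Hypothesis hmu : K_invariant mu.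
Variables (lA : {sigma_finite_measure set TA -> \bar R})
          (lB : {sigma_finite_measure set TB -> \bar R}).
Hypotheses (hA : is_lebesgue lA) (hB : is_lebesgue lB).
Local Notation gam := (lA \x lB)%E.

(** By Iwasawa decomposition this is a(nbar)^(-2 rho). *)
Definition weight (Y : 'M[K]_(q, p)) : R :=
  detR (adj (lsubmx (nbar Y)) *m lsubmx (nbar Y)) `^ (- ((p + q)%:R / 2)).

Lemma weight_iwasawa Y u (a : 'M[K]_p) : SU u -> lsubmx (nbar Y) = lsubmx u *m a ->
  weight Y = (`|detR a| ^+ (p + q))^-1.
Proof.
move=> Su e; rewrite /weight e adjM mulmxA -(mulmxA (adj a)) (lsubmx_SU Su) mulmx1.
rewrite detRM detR_adj -expr2 -real_normK ?num_real// -powR_mulrn//.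
rewrite -powRrM mulrN mulrCA mulfV// mulr1 powRN powR_mulrn//.
Qed.

Lemma weight_ge0 Y : 0 <= weight Y.
Proof. exact: powR_ge0. Qed.

Lemma measurable_weight : measurable_fun [set: TB] (fun y => weight (ofB y)).
Proof.
apply: (measurableT_comp (measurable_powR _)); apply: measurable_detR.
have mT := @funalg_measurable R _ TB.
have mw : measurable_mx (fun y : TB => lsubmx (nbar (ofB y))).
  rewrite (_ : (fun y => _) = fun y => col_mx 1%:M 0 + col_mx 0 1%:M *m ofB y).
    apply: mxA_add => //; first exact: mxA_cst.
    apply: mxA_mul => //; first exact: mxA_cst.
    by apply: measurable_mx_ofR; exact: measurable_id.
  apply/funext => y; rewrite /nbar block_mxEh row_mxKl.
  by rewrite mul_col_mx mul0mx mul1mx add_col_mx addr0 add0r.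
by apply: mxA_mul => //; exact: mxA_adj.
Qed.

Definition hit (r : R) (z : TA * TB) : \bar R := mu (xsection (near_set r) z).

Lemma hit_ge0 r z : (0 <= hit r z)%E. Proof. exact: measure_ge0. Qed.

Lemma measurable_hit r : measurable_fun [set: TA * TB] (hit r).
Proof. exact: (measurable_fun_xsection mu (measurable_near_set r)). Qed.

Lemma hit_pact r g z : SU g -> hit r (pact g z) = hit r z.
Proof.
move=> Sg; rewrite /hit -[LHS](hmu Sg); last by apply: measurable_xsection; exact: measurable_near_set.
have H b := near_set_act r z b Sg.
apply: (congr1 (mu : set GrB -> \bar R)).
apply/seteqP; split => b; rewrite /xsection /= => /set_mem h; apply: mem_set.
  exact: (proj1 (H b) h).
exact: (proj2 (H b) h).
Qed.

Definition frame_int r (F : Gr -> R) : \bar R := (\int[gam]_z ((frame_fun F z)%:E * hit r z))%E.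

Definition frame_cst r : \bar R :=
  (\int[lA]_a ((`|detR (ofA a)| ^+ q)%:E * hit r (a, 0%R : TB)))%E.

Lemma frame_fun_ge0 (F : Gr -> R) z : (forall b, 0 <= F b) -> 0 <= frame_fun F z.
Proof. by move=> F0; rewrite /frame_fun; case: ifP. Qed.

Lemma rmx_mulmxr_unit n (a : 'M[K]_p) : detR a != 0 ->
  rmx (fun X : 'M[K]_(n, p) => X *m a) \in unitmx.
Proof. by move=> da; rewrite unitmxE unitfE det_mulmxr expf_neq0. Qed.

Lemma rmx_mulmxl_unit n (a : 'M[K]_p) : detR a != 0 ->
  rmx (fun X : 'M[K]_(p, n) => a *m X) \in unitmx.
Proof. by move=> da; rewrite unitmxE unitfE det_mulmxl expf_neq0. Qed.

Lemma measurable_absdetA : measurable_fun [set: TA] (fun a => `|detR (ofA a)| ^+ q).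
Proof.
apply: measurable_funX; apply: measurableT_comp => //.
by apply: measurable_detR; apply: measurable_mx_ofR; exact: measurable_id.
Qed.

Lemma measurable_frame r (F : Gr -> R) : gcont F ->
  measurable_fun [set: TA * TB] (fun z => ((frame_fun F z)%:E * hit r z)%E).
Proof.
move=> cF; apply: emeasurable_funM; last exact: measurable_hit.
by apply/measurable_EFinP; exact: measurable_frame_fun.
Qed.

(** Substitution B = Y A, of Jacobian |det A|^q. *)
Lemma frame_inner r (F : Gr -> R) (a : TA) : gcont F -> (forall b, 0 <= F b) ->
  (\int[lB]_b ((frame_fun F (a, b))%:E * hit r (a, b)) =
   \int[lB]_y ((`|detR (ofA a)| ^+ q * F (chart 1%:M (y : 'rV_(q * p * d))))%:E *
               hit r (a, toR (ofB y *m ofA a) : TB)))%E.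
Proof.
move=> cF F0.
have [da|da] := eqVneq (detR (ofA a)) 0.
  rewrite integral0_eq; last by move=> b _; rewrite /frame_fun /= da eqxx mul0e.
  by rewrite integral0_eq// => y _; rewrite da normr0 expr0n gtn_eqF// mul0r mul0e.
pose f (b : TB) := ((frame_fun F (a, b))%:E * hit r (a, b))%E.
have mf : measurable_fun [set: TB] f.
  apply: (measurableT_comp (measurable_frame r cF) (g := fun b : TB => (a, b))).
  by apply: measurable_fun_pair => //; exact: measurable_cst.
have f0 b : (0 <= f b)%E by rewrite mule_ge0 ?lee_fin ?frame_fun_ge0 ?hit_ge0.
pose T := rmx (fun X : 'M[K]_(q, p) => X *m ofA a).
pose g (y : TB) := f (((y : 'rV_(q * p * d)) *m T) : TB).
have mg : measurable_fun [set: TB] g by apply: (measurableT_comp mf); exact: measurable_rV_lin.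
have e := integral_lin hB (rmx_mulmxr_unit q da) mf f0.
rewrite -[LHS]/(\int[lB]_b f b)%E e det_mulmxr normrX -/T.
have -> : (\int[lB]_x f (((x : 'rV_(q * p * d)) *m T) : TB) = \int[lB]_x g x)%E by [].
have g0 y : (0 <= g y)%E by exact: f0.
have c0 : 0 <= `|detR (ofA a)| ^+ q by rewrite exprn_ge0.
rewrite -(ge0_integral_scale lB mg g0 c0).
apply: eq_integral => y _.
have yE : (y : 'rV_(q * p * d)) *m T = toR (ofB y *m ofA a).
  by rewrite (toR_rmx _ (@real_linear_mulmxr _ _ _ _ _ (ofA a))) ofRK.
rewrite /g yE /f EFinM -muleA; congr (_ * (_%:E * _))%E.
by rewrite /frame_fun /= (negbTE da) toRK -mulmxA mulmx_invK// mulmx1 ofRK.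
Qed.

(** The measure of the subspaces near to the frame (A; Y A) depends only on its orbit
    under rotations. Writing (1; Y) = u (a; 0) with u in SU, it is the same as for the
    frame (a A; 0); the substitution of a A for A then separates the variables, and its
    Jacobian together with the power of |det A| is the weight. *)
Lemma frame_int_eq r (F : Gr -> R) : gcont F -> (forall b, 0 <= F b) ->
  frame_int r F =
  (frame_cst r * \int[lB]_y (F (chart 1%:M (y : 'rV_(q * p * d))) * weight (ofB y))%:E)%E.
Proof.
move=> cF F0.
have mtF := measurable_frame_fun cF.
have mh := measurable_hit r.
have mf : measurable_fun [set: TA * TB] (fun z => ((frame_fun F z)%:E * hit r z)%E).
  by apply: emeasurable_funM => //; exact/measurable_EFinP.
have f0 z : (0 <= (frame_fun F z)%:E * hit r z)%E.
  by rewrite mule_ge0 ?lee_fin ?frame_fun_ge0 ?hit_ge0.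
pose prod (z : TA * TB) : TA * TB := (z.1, toR (ofB z.2 *m ofA z.1)).
have mprod : measurable_fun [set: TA * TB] prod.
  apply: measurable_fun_pair; first exact: measurable_fst.
  apply: measurable_toR; apply: mxA_mul; first exact: funalg_measurable.
    by apply: measurable_mx_ofR; exact: measurable_snd.
  by apply: measurable_mx_ofR; exact: measurable_fst.
have mchart := measurable_chart (SL1 R k (p + q)).
have mFc : measurable_fun [set: TB] (fun y : TB => F (chart 1%:M (y : 'rV_(q * p * d)))).
  exact: (measurableT_comp (gcont_measurable cF) mchart).
pose G (z : TA * TB) : \bar R :=
  ((`|detR (ofA z.1)| ^+ q * F (chart 1%:M (z.2 : 'rV_(q * p * d))))%:E * hit r (prod z))%E.
have mG : measurable_fun [set: TA * TB] G.
  apply: emeasurable_funM; last exact: measurableT_comp mh mprod.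
  apply/measurable_EFinP; apply: measurable_funM.
    exact: (measurableT_comp measurable_absdetA measurable_fst).
  exact: (measurableT_comp mFc measurable_snd).
have G0 z : (0 <= G z)%E by rewrite mule_ge0 ?lee_fin ?mulr_ge0 ?hit_ge0.
transitivity (\int[lA]_a \int[lB]_y G (a, y))%E.
  rewrite /frame_int (@fubini_tonelli1 _ _ _ _ _ lA lB _ mf f0); apply: eq_integral => a _.
  exact: frame_inner.
rewrite (@fubini_tonelli _ _ _ _ _ lA lB _ mG G0).
transitivity (\int[lB]_y (frame_cst r * (F (chart 1%:M (y : 'rV_(q * p * d))) * weight (ofB y))%:E))%E; last first.
  rewrite ge0_integralZl//.
  - by apply/measurable_EFinP; apply: measurable_funM => //; exact: measurable_weight.
  - by move=> y _; rewrite lee_fin mulr_ge0// weight_ge0.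
  - by apply: integral_ge0 => a _; rewrite mule_ge0 ?hit_ge0.
apply: eq_integral => y _.
have [u [aY [Su dY eY _ _]]] := iwasawaP hp hq (ofB y).
pose Th (a : TA) : \bar R := ((`|detR (ofA a)| ^+ q)%:E * hit r (a, 0%R : TB))%E.
have mTh : measurable_fun [set: TA] Th.
  apply: emeasurable_funM; first by apply/measurable_EFinP; exact: measurable_absdetA.
  apply: (measurableT_comp mh (g := fun a : TA => (a, 0%R : TB))).
  by apply: measurable_fun_pair => //; exact: measurable_cst.
have Th0 a : (0 <= Th a)%E by rewrite mule_ge0 ?lee_fin ?hit_ge0.
have aE (a : TA) : (a : 'rV_(p * p * d)) *m rmx (fun X : 'M[K]_(p, p) => aY *m X) = toR (aY *m ofA a).
  by rewrite (toR_rmx _ (@real_linear_mulmx _ _ _ _ _ aY)) ofRK.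
have nY : 0 < `|detR aY| by rewrite normr_gt0.
have GTh a : G (a, y) = ((F (chart 1%:M (y : 'rV_(q * p * d))) * (`|detR aY| ^+ q)^-1)%:E *
    Th (((a : 'rV_(p * p * d)) *m rmx (fun X : 'M[K]_(p, p) => aY *m X)) : TA))%E.
  rewrite aE /G /Th toRK detRM normrM exprMn muleA -EFinM.
  have -> : hit r (prod (a, y)) = hit r ((toR (aY *m ofA a) : TA), 0%R : TB).
    rewrite -[RHS](hit_pact r _ Su); congr (hit r _).
    apply: (can_inj (@pmxK R k p q)); rewrite pmx_pact /pmx /prod /= !toRK.
    have -> : ofR 0 = 0 :> 'M[K]_(q, p) by apply: (can_inj (@toRK R k q p)); rewrite ofRK toR0.
    rewrite -{1}[u]hsubmxK mul_row_col mulmx0 addr0 mulmxA -eY.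
    by rewrite /nbar block_mxEh row_mxKl mul_col_mx mul1mx.
  congr (_%:E * _)%E => /=.
  rewrite mulrC -!mulrA; congr (_ * _); rewrite mulrA mulVf ?mul1r//.
  by rewrite expf_neq0// gt_eqF.
under eq_integral do rewrite GTh.
have mThl : measurable_fun [set: TA]
    (fun a : TA => Th (((a : 'rV_(p * p * d)) *m rmx (fun X : 'M[K]_(p, p) => aY *m X)) : TA)).
  by apply: (measurableT_comp mTh); exact: measurable_rV_lin.
rewrite ge0_integralZl_EFin//; last by rewrite mulr_ge0// invr_ge0 exprn_ge0.
have -> : frame_cst r = (\int[lA]_a Th a)%E by [].
rewrite (integral_lin hA (rmx_mulmxl_unit p dY) mTh Th0) det_mulmxl normrX.
rewrite (weight_iwasawa Su eY) muleC -muleA [RHS]muleCA; congr (_ * _)%E.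
rewrite -EFinM; congr EFin; rewrite mulrCA; congr (_ * _).
rewrite exprD invfM mulrA mulfV ?mul1r// expf_neq0// gt_eqF//.
Qed.

End FrameSide.

(** * Integrating out the frame first *)

Section KernelSide.
Variables (R : realType) (k : scalar_kind) (p q : nat).
Hypotheses (hp : (0 < p)%N) (hq : (0 < q)%N).
Local Notation K := (scalars R k).
Local Notation d := (dimR k).
Local Notation Gr := (Gr R k p q).
Local Notation GrB := (GrBorel R k p q).
Local Notation bo := (b_o R k p q).
Local Notation TA := (rVB R (p * p * d)).
Local Notation TB := (rVB R (q * p * d)).
Local Notation ofA a := (ofR (a : 'rV[R]_(p * p * d)) : 'M[K]_p).
Local Notation ofB b := (ofR (b : 'rV[R]_(q * p * d)) : 'M[K]_(q, p)).
Variable mu : probability GrB R.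
Hypothesis hmu : K_invariant mu.
Variables (lA : {sigma_finite_measure set TA -> \bar R})
          (lB : {sigma_finite_measure set TB -> \bar R}).
Hypotheses (hA : is_lebesgue lA) (hB : is_lebesgue lB).
Local Notation gam := (lA \x lB)%E.

Definition kernel_int r (F : Gr -> R) (b : GrB) : \bar R :=
  (\int[gam]_z ((frame_fun F z)%:E * (\1_(near_set r) (z, b))%:E))%E.

Lemma gam_sigma_finite_ex : exists gS : {sigma_finite_measure set (TA * TB)%type -> \bar R},
  (gS : set (TA * TB)%type -> \bar R) = gam.
Proof.
have [gS gSE] := sigma_finite_pack (gam_sigma_finite hA hB).
by exists gS; apply/funext => E; exact: gSE.
Qed.

Lemma measurable_kernel r (F : Gr -> R) : gcont F ->
  measurable_fun [set: (TA * TB) * GrB]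
    (fun zb => ((frame_fun F zb.1)%:E * (\1_(near_set r) zb)%:E)%E).
Proof.
move=> cF; apply: emeasurable_funM; apply/measurable_EFinP.
  exact: (measurableT_comp (measurable_frame_fun cF) measurable_fst).
by apply: measurable_indic; exact: measurable_near_set.
Qed.

Lemma kernel_ge0 r (F : Gr -> R) zb : (forall b, 0 <= F b) ->
  (0 <= (frame_fun F zb.1)%:E * (\1_(@near_set R k p q r) zb)%:E)%E.
Proof. by move=> F0; apply: mule_ge0; rewrite lee_fin //; exact: frame_fun_ge0. Qed.

Lemma frame_int_kernel r (F : Gr -> R) : gcont F -> (forall b, 0 <= F b) ->
  frame_int mu lA lB r F = (\int[mu]_b kernel_int r F b)%E.
Proof.
move=> cF F0; have [gS gSE] := gam_sigma_finite_ex.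
have mf := measurable_kernel r cF.
have f0 zb := kernel_ge0 r zb F0.
have := @fubini_tonelli _ _ _ _ _ gS mu _ mf f0.
rewrite /kernel_int /frame_int -gSE => <-.
apply: eq_integral => z _.
have mx : measurable (xsection (near_set r) z : set GrB).
  by apply: measurable_xsection; exact: measurable_near_set.
have -> : (\int[mu]_b ((frame_fun F z)%:E * (\1_(near_set r) (z, b))%:E) =
           \int[mu]_b ((frame_fun F z)%:E * (\1_(xsection (near_set r) z) b)%:E))%E.
  apply: eq_integral => b _; congr (_ * _%:E)%E; rewrite !indicE /xsection.
  by rewrite [in RHS]mem_setE.
rewrite ge0_integral_scale ?frame_fun_ge0//.
- by rewrite integral_indic// setIT.
- by apply/measurable_EFinP/measurable_indic.
Qed.

Lemma measurable_kernel_int r (F : Gr -> R) : gcont F -> (forall b, 0 <= F b) ->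
  measurable_fun [set: GrB] (kernel_int r F).
Proof.
move=> cF F0; have [gS gSE] := gam_sigma_finite_ex.
have mf := measurable_kernel r cF.
have f0 zb := kernel_ge0 r zb F0.
have := @measurable_fun_fubini_tonelli_G _ _ _ _ _ gS _ mf f0.
by rewrite /fubini_G /kernel_int -gSE.
Qed.

Lemma lsubmx_nbar (Y : 'M[K]_(q, p)) : lsubmx (nbar Y) = col_mx 1%:M Y.
Proof. by rewrite /nbar block_mxEh row_mxKl. Qed.

Lemma pmx_chart (z : TA * TB) : detR (ofA z.1) != 0 ->
  lsubmx (nbar (ofB z.2 *m invK (ofA z.1))) *m ofA z.1 = pmx z.
Proof.
by move=> d0; rewrite lsubmx_nbar mul_col_mx mul1mx -mulmxA mulKmx// mulmx1.
Qed.

Lemma chart_toR g (Y : 'M[K]_(q, p)) : chart g (toR Y) = act (g *m nbar Y) bo.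
Proof. by rewrite /chart toRK. Qed.

(** Both sides are the value of F at the subspace spanned by g times the frame z. *)
Lemma frame_fun_eq (F : Gr -> R) g (z z' : TA * TB) : SU g -> pmx z' = g *m pmx z ->
  detR (ofA z.1) != 0 -> detR (ofA z'.1) != 0 -> frame_fun F z' = frame_fun (F \o act g) z.
Proof.
move=> Sg zz' d0 d1; rewrite /frame_fun (negbTE d0) (negbTE d1) /=; congr F.
have Sg' := SU_SL Sg; rewrite (act_chart _ Sg' (SL1 R k (p + q))) mulmx1.
have z0 := pmx_chart d0; have z1 := pmx_chart d1.
move: z0 z1; move: (ofB z'.2 *m _) (ofB z.2 *m _) => Y1 Y0 z0 z1.
rewrite (chart_toR 1%:M) (chart_toR g) (mul1mx (nbar Y1)).
apply: (@act_bo_eq _ _ _ _ _ _ (ofA z.1 *m invK (ofA z'.1))).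
- by case: (SL_nbar Y1).
- by apply: GLM; [case: Sg' | case: (SL_nbar Y0)].
- rewrite detRM mulf_neq0//; apply/GL_detR.
  by apply: (@GL_left _ _ _ _ (ofA z'.1)); exact: mulmx_invK.
- rewrite lsubmx_mul mulmxA -(mulmxA g) z0 -zz' -z1.
  by rewrite -mulmxA mulmx_invK// mulmx1.
Qed.

Lemma frame_fun_pact (F : Gr -> R) g z : SU g -> detR (ofA z.1) != 0 ->
  detR (ofA (pact g z).1) != 0 -> frame_fun F (pact g z) = frame_fun (F \o act g) z.
Proof. by move=> Sg; apply: frame_fun_eq => //; exact: pmx_pact. Qed.

Lemma measurable_top0 : measurable [set z : TA * TB | detR (ofA z.1) = 0].
Proof.
have mD : measurable_fun [set: TA * TB] (fun z => detR (ofA z.1)).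
  by apply: measurable_detR; apply: measurable_mx_ofR; exact: measurable_fst.
by have := mD measurableT _ (measurable_set1 0); rewrite setTI.
Qed.

Lemma gam_top0 : gam [set z | detR (ofA z.1) = 0] = 0%E.
Proof.
have mD : measurable_fun [set: TA] (fun a => detR (ofA a)).
  by apply: measurable_detR; apply: measurable_mx_ofR; exact: measurable_id.
have mE : measurable [set a : TA | detR (ofA a) = 0].
  by have := mD measurableT _ (measurable_set1 0); rewrite setTI.
have -> : [set z | detR (ofA z.1) = 0] = [set a : TA | detR (ofA a) = 0] `*` [set: TB].
  by apply/seteqP; split => [[a b]|[a b] []].
have e0 : lA [set a : TA | detR (ofA a) = 0] = 0%E by exact: (detR_null hA).
move: mE e0; set Z : set TA := [set a | _] => mE e0.
transitivity (lA Z * lB [set: TB])%E; first exact: product_measure1E.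
by rewrite e0 mul0e.
Qed.

Lemma measurable_frame_fun_prect r (F : Gr -> R) : gcont F ->
  measurable_fun [set: TA * TB] (fun z => ((frame_fun F z)%:E * (\1_(prect 1 r) z)%:E)%E).
Proof.
move=> cF; apply: emeasurable_funM; apply/measurable_EFinP.
  exact: measurable_frame_fun.
by apply: measurable_indic; exact: measurable_prect.
Qed.

(** Rotating the frames moves the subspace to b_o, where the kernel becomes the
    indicator of a product of balls. *)
Lemma kernel_int_act r (F : Gr -> R) g : SU g -> gcont F -> (forall b, 0 <= F b) ->
  kernel_int r F (act g bo) =
  (\int[gam]_z ((frame_fun (F \o act g) z)%:E * (\1_(@prect R k p q 1 r) z)%:E))%E.
Proof.
move=> Sg cF F0; have ug := SU_unitary Sg; have Sg' := SU_SL Sg.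
pose f (z : TA * TB) := ((frame_fun F z)%:E * (\1_(near_set r) (z, act g bo : GrB))%:E)%E.
have mf : measurable_fun [set: TA * TB] f.
  exact: (measurableT_comp (measurable_kernel r cF) (measurable_pair2 (act g bo : GrB))).
have f0 z : (0 <= f z)%E by exact: (kernel_ge0 r (z, act g bo : GrB) F0).
rewrite -[LHS]/(\int[gam]_z f z)%E -(integral_pact hA hB ug mf f0).
apply: ae_eq_integral => //.
- exact: (measurableT_comp mf (measurable_pact g)).
- by apply: measurable_frame_fun_prect; exact: gcont_act.
pose N := [set z : TA * TB | detR (ofA z.1) = 0].
exists (N `|` pact g @^-1` N); split.
- apply: measurableU; first exact: measurable_top0.
  rewrite -[X in measurable X]setTI; apply: measurable_pact => //; exact: measurable_top0.
- have mN' : measurable (pact g @^-1` N).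
    by rewrite -[X in measurable X]setTI; apply: measurable_pact => //; exact: measurable_top0.
  have N'0 : gam (pact g @^-1` N) = 0%E.
    by have := gam_pact hA hB ug measurable_top0; rewrite gam_top0.
  exact: (null_set_setU measurable_top0 mN' gam_top0 N'0).
move=> z; apply: contra_notP => /not_orP[/eqP d0 /eqP d1] _.
rewrite /f (frame_fun_pact F Sg d0 d1); congr (_ * _%:E)%E.
have H1 := near_set_act r z bo Sg; have H2 := near_set_bo r z.
rewrite !indicE; congr (_%:R); congr nat_of_bool; apply/idP/idP => /set_mem h; apply: mem_set.
  by apply: (proj1 H2); exact: (proj1 H1 h).
by apply: (proj2 H1); exact: (proj2 H2 h).
Qed.

Definition pscale (s : R) (z : TA * TB) : TA * TB := (z.1, s *: (z.2 : 'rV[R]_(q * p * d))).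

Lemma measurable_pscale s : measurable_fun [set: TA * TB] (pscale s).
Proof.
apply: measurable_fun_pair; first exact: measurable_fst.
apply: (measurableT_comp (g := snd) (f := fun b : TB => s *: (b : 'rV[R]_(q * p * d)) : TB)); last exact: measurable_snd.
apply: measurable_to_rVB => i; under eq_fun do rewrite mxE.
by apply: measurable_funM; [exact: measurable_cst | exact: measurable_coord].
Qed.

Lemma gam_scale s (f : TA * TB -> \bar R) : 0 < s -> measurable_fun [set: TA * TB] f ->
  (forall z, (0 <= f z)%E) ->
  (\int[gam]_z f z = (s ^+ (q * p * d))%:E * \int[gam]_z f (pscale s z))%E.
Proof.
move=> s0 mf f0.
have mfs : measurable_fun [set: TA * TB] (f \o pscale s).
  exact: (measurableT_comp mf (measurable_pscale s)).
have us : (s%:M : 'M[R]_(q * p * d)) \in unitmx.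
  by rewrite unitmxE det_scalar unitfE expf_neq0// gt_eqF.
have sn0 : 0 <= s ^+ (q * p * d) by rewrite exprn_ge0// ltW.
rewrite (@fubini_tonelli1 _ _ _ _ _ lA lB _ mf f0).
rewrite (@fubini_tonelli1 _ _ _ _ _ lA lB (f \o pscale s) mfs (fun z => f0 _)).
have mF := @measurable_fun_fubini_tonelli_F _ _ TA TB R lB (f \o pscale s) mfs (fun z => f0 _).
rewrite -(ge0_integral_scale lA mF)//; last first.
  by move=> a; apply: integral_ge0 => b _; exact: f0.
apply: eq_integral => a _; rewrite /fubini_F.
have mfa : measurable_fun [set: TB] (fun b => f (a, b)).
  exact: (measurableT_comp mf (measurable_pair1 a)).
rewrite (integral_lin hB us mfa (fun b => f0 (a, b))) det_scalar ger0_norm//.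
congr (_ * _)%E; apply: eq_integral => b _; congr f; congr pair.
by rewrite mul_mx_scalar.
Qed.

(** After rescaling, F is evaluated at the subspaces of slope s B A^-1. *)
Definition mean_int s (F : Gr -> R) : \bar R :=
  (\int[gam]_z ((frame_fun F (pscale s z))%:E * (\1_(@prect R k p q 1 1) z)%:E))%E.

Lemma kernel_int_mean s (F : Gr -> R) g : 0 < s -> SU g -> gcont F -> (forall b, 0 <= F b) ->
  kernel_int (s ^+ 2) F (act g bo) = ((s ^+ (q * p * d))%:E * mean_int s (F \o act g))%E.
Proof.
move=> s0 Sg cF F0; rewrite kernel_int_act//.
have cF' := gcont_act (SU_SL Sg) cF.
rewrite (gam_scale s0); last 2 first.
- exact: measurable_frame_fun_prect.
- by move=> z; apply: mule_ge0; rewrite lee_fin //; apply: frame_fun_ge0 => b; exact: F0.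
have scale_rect z : (\1_(@prect R k p q 1 (s ^+ 2)) (pscale s z) : R) = \1_(@prect R k p q 1 1) z.
  have e : nrm2 (ofB (pscale s z).2) = s ^+ 2 * nrm2 (ofB z.2).
    rewrite !nrm2E !ofRK mulr_sumr; apply: eq_bigr => i _.
    by rewrite mxE exprMn.
  have s2 : 0 < s ^+ 2 by rewrite exprn_gt0.
  have e1 : (nrm2 (ofB (pscale s z).2) <= s ^+ 2) = (nrm2 (ofB z.2) <= 1).
    by rewrite e ger_pMr.
  rewrite !indicE; congr (_%:R); congr nat_of_bool; apply/idP/idP => /set_mem [h1 h2];
    apply: mem_set; split; try exact: h1.
    by rewrite -e1.
  by rewrite e1.
congr (_ * _)%E; apply: eq_integral => z _.
by rewrite -(scale_rect z).
Qed.

End KernelSide.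

(** * Concentration of the kernel *)

Lemma cvg_scale0 (R : realType) N (w : 'rV[R]_N) : (harmonic n : R) *: w @[n --> \oo] --> (0 : 'rV[R]_N).
Proof.
apply/cvg_ballP => e e0.
have H (i : 'I_1) : \forall n \near \oo, forall j, ball (0 : R) e ((harmonic n : R) * w i j).
  apply: filter_forall => j.
  have : (harmonic n : R) * w i j @[n --> \oo] --> (0 : R).
    by rewrite -[X in _ --> X](mul0r (w i j)); apply: cvgMr_tmp; exact: cvg_harmonic.
  by move=> /cvg_ballP; exact.
apply: (@filterS _ \oo _ (fun n => forall (i : 'I_1) (j : 'I_N), ball (0 : R) e ((harmonic n : R) * w i j))).
  by move=> n Hn; split=> // i j; rewrite !mxE; exact: Hn.
exact: (@filter_forall _ _ _ _ eventually_filter H).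
Qed.

Section KernelLimit.
Variables (R : realType) (k : scalar_kind) (p q : nat).
Hypotheses (hp : (0 < p)%N) (hq : (0 < q)%N).
Local Notation K := (scalars R k).
Local Notation d := (dimR k).
Local Notation Gr := (Gr R k p q).
Local Notation GrB := (GrBorel R k p q).
Local Notation bo := (b_o R k p q).
Local Notation TA := (rVB R (p * p * d)).
Local Notation TB := (rVB R (q * p * d)).
Local Notation ofA a := (ofR (a : 'rV[R]_(p * p * d)) : 'M[K]_p).
Local Notation ofB b := (ofR (b : 'rV[R]_(q * p * d)) : 'M[K]_(q, p)).
Local Notation re r := (@of_real R k r)%:M.
Variable mu : probability GrB R.
Hypothesis hmu : K_invariant mu.
Variables (lA : {sigma_finite_measure set TA -> \bar R})
          (lB : {sigma_finite_measure set TB -> \bar R}).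
Hypotheses (hA : is_lebesgue lA) (hB : is_lebesgue lB).
Local Notation gam := (lA \x lB)%E.
Local Notation rect := (@prect R k p q 1 1).
Local Notation v := (gam rect).
Local Notation s := (fun n : nat => harmonic n : R).

Lemma frame_fun_pscale (F : Gr -> R) r (z : TA * TB) : detR (ofA z.1) != 0 ->
  frame_fun F (pscale r z) = F (chart 1%:M (r *: toR (ofB z.2 *m invK (ofA z.1)))).
Proof.
move=> d0; rewrite /frame_fun (negbTE d0); congr (F (chart _ _)).
have e : ofB (pscale r z).2 = re r *m ofB z.2.
  apply: (can_inj (@toRK R k q p)); rewrite ofRK.
  by have := toR_lin r (ofB z.2) 0; rewrite !addr0 ofRK toR0 addr0 => ->.
rewrite e -mulmxA.
by have := toR_lin r (ofB z.2 *m invK (ofA z.1)) 0; rewrite !addr0 toR0 addr0.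
Qed.

Lemma chart10 : chart 1%:M 0 = bo.
Proof.
rewrite -(@toR0 R k q p) chart_toR.
have -> : nbar (0 : 'M[K]_(q, p)) = 1%:M by rewrite /nbar -scalar_mx_block.
by rewrite mulmx1 act1.
Qed.

Lemma frame_fun_cvg (F : Gr -> R) (z : TA * TB) : gcont F -> detR (ofA z.1) != 0 ->
  frame_fun F (pscale (s n) z) @[n --> \oo] --> F bo.
Proof.
move=> cF d0; under eq_fun do rewrite (frame_fun_pscale _ _ d0).
rewrite -chart10.
have c0 := cF _ (SL1 R k (p + q)) 0.
exact: (cvg_comp _ _ (@cvg_scale0 R _ _) c0).
Qed.

Lemma frame_fun_le (F : Gr -> R) M z : 0 <= M -> (forall b, F b <= M) -> frame_fun F z <= M.
Proof. by move=> M0 FM; rewrite /frame_fun; case: ifP. Qed.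

Lemma rect_gt0 : (0 < v)%E. Proof. exact: gam_rect_gt0. Qed.

Lemma rect_lty : (v < +oo)%E.
Proof.
apply: le_lt_trans (pball_lty hA hB 2).
apply: le_measure; rewrite ?inE; [exact: measurable_prect|exact: measurable_pball|].
by move=> z [h1 h2]; rewrite /pball /= /pmx nrm2_col; lra.
Qed.

Lemma rect_fin : v \is a fin_num.
Proof. by rewrite ge0_fin_numE ?rect_lty. Qed.

Lemma integrable_rect M : 0 <= M ->
  gam.-integrable setT (fun z => (M%:E * (\1_rect z)%:E)%E).
Proof.
move=> M0; apply: integrableZl => //; apply/integrableP; split.
  by apply/measurable_EFinP; apply: measurable_indic; exact: measurable_prect.
under eq_integral do rewrite gee0_abs ?lee_fin//.
rewrite integral_indic//; last exact: measurable_prect.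
by rewrite setIT rect_lty.
Qed.

Lemma mean_int_ge0 r (F : Gr -> R) : (forall b, 0 <= F b) -> (0 <= mean_int lA lB r F)%E.
Proof.
by move=> F0; apply: integral_ge0 => z _; rewrite mule_ge0 ?lee_fin ?frame_fun_ge0.
Qed.

Lemma measurable_mean r (F : Gr -> R) : gcont F ->
  measurable_fun [set: TA * TB] (fun z => ((frame_fun F (pscale r z))%:E * (\1_rect z)%:E)%E).
Proof.
move=> cF; apply: emeasurable_funM; apply/measurable_EFinP.
  exact: (measurableT_comp (measurable_frame_fun cF) (measurable_pscale r)).
by apply: measurable_indic; exact: measurable_prect.
Qed.

Lemma integral_rect M : 0 <= M -> (\int[gam]_z (M%:E * (\1_rect z)%:E) = M%:E * v)%E.
Proof.
move=> M0.
rewrite ge0_integral_scale//; last first.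
  by apply/measurable_EFinP; apply: measurable_indic; exact: measurable_prect.
by rewrite integral_indic ?setIT//; exact: measurable_prect.
Qed.

Lemma mean_int_le r (F : Gr -> R) M : gcont F -> (forall b, 0 <= F b) -> (forall b, F b <= M) ->
  (mean_int lA lB r F <= M%:E * v)%E.
Proof.
move=> cF F0 FM; have M0 : 0 <= M by exact: le_trans (F0 bo) (FM bo).
rewrite -(integral_rect M0); apply: ge0_le_integral => //.
- by move=> z _; rewrite mule_ge0 ?lee_fin ?frame_fun_ge0.
- exact: measurable_mean.
- apply: emeasurable_funM; first exact: measurable_cst.
  by apply/measurable_EFinP; apply: measurable_indic; exact: measurable_prect.
- by move=> z _; apply: lee_wpmul2r; rewrite lee_fin// frame_fun_le.
Qed.

(** Away from singular A the slope tends to 0, hence the subspace to b_o. *)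
Lemma mean_int_cvg (F : Gr -> R) M : gcont F -> (forall b, 0 <= F b) -> (forall b, F b <= M) ->
  mean_int lA lB (s n) F @[n --> \oo] --> ((F bo)%:E * v)%E.
Proof.
move=> cF F0 FM; have M0 : 0 <= M by exact: le_trans (F0 bo) (FM bo).
rewrite -(integral_rect (F0 bo)).
pose f_ n (z : TA * TB) := ((frame_fun F (pscale (s n) z))%:E * (\1_rect z)%:E)%E.
pose f (z : TA * TB) := ((F bo)%:E * (\1_rect z)%:E)%E.
pose g (z : TA * TB) := (M%:E * (\1_rect z)%:E)%E.
have mf_ n : measurable_fun setT (f_ n) by exact: measurable_mean.
have mf : measurable_fun setT f.
  apply: emeasurable_funM; first exact: measurable_cst.
  by apply/measurable_EFinP; apply: measurable_indic; exact: measurable_prect.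
have f_f : {ae gam, forall z, setT z -> f_ n z @[n --> \oo] --> f z}.
  exists [set z | detR (ofA z.1) = 0]; split.
  + exact: measurable_top0.
  + exact: gam_top0.
  move=> z; apply: contra_notP => /eqP d0 _.
  apply: cvgeZr => //.
  by apply: cvg_EFin; [exact: nearW | exact: frame_fun_cvg].
have f_g : {ae gam, forall z n, setT z -> (`|f_ n z| <= g z)%E}.
  apply: aeW => z n _; rewrite /f_ /g.
  have t0 := frame_fun_ge0 (pscale (s n) z) F0.
  have h0 : (0 <= (\1_rect z)%:E :> \bar R)%E by rewrite lee_fin.
  have h1 : (0 <= (frame_fun F (pscale (s n) z))%:E * (\1_rect z)%:E)%E by rewrite mule_ge0.
  rewrite (gee0_abs h1); apply: (lee_wpmul2r h0).
  by rewrite lee_fin; exact: frame_fun_le.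
by case: (dominated_convergence measurableT mf_ mf f_f (integrable_rect M0) f_g).
Qed.

End KernelLimit.

(** * Integration over the big cell *)

Lemma cvg_integral_nondecreasing d (T : measurableType d) (R : realType)
    (m : {measure set T -> \bar R}) (g : nat -> T -> \bar R) (f : T -> \bar R) :
  (forall n, measurable_fun [set: T] (g n)) -> (forall n x, (0 <= g n x)%E) ->
  (forall x, {homo g ^~ x : i j / (i <= j)%N >-> (i <= j)%E}) ->
  (forall x, g n x @[n --> \oo] --> f x) ->
  (\int[m]_x g n x)%E @[n --> \oo] --> (\int[m]_x f x)%E.
Proof.
move=> mg g0 ndg gf.
have -> : (\int[m]_x f x = \int[m]_x limn (g ^~ x))%E.
  by apply: eq_integral => x _; apply/esym/(cvg_lim (@ereal_hausdorff R)).
exact: (cvg_monotone_convergence measurableT mg (fun n x _ => g0 n x) (fun x _ => ndg x)).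
Qed.

Section CellIntegral.
Variables (R : realType) (k : scalar_kind) (p q : nat).
Hypotheses (hp : (0 < p)%N) (hq : (0 < q)%N).
Local Notation K := (scalars R k).
Local Notation d := (dimR k).
Local Notation Gr := (Gr R k p q).
Local Notation GrB := (GrBorel R k p q).
Local Notation bo := (b_o R k p q).
Local Notation TA := (rVB R (p * p * d)).
Local Notation TB := (rVB R (q * p * d)).
Local Notation ofB b := (ofR (b : 'rV[R]_(q * p * d)) : 'M[K]_(q, p)).
Variable mu : probability GrB R.
Hypothesis hmu : K_invariant mu.
Variables (lA : {sigma_finite_measure set TA -> \bar R})
          (lB : {sigma_finite_measure set TB -> \bar R}).
Hypotheses (hA : is_lebesgue lA) (hB : is_lebesgue lB).
Local Notation rect := (@prect R k p q 1 1).
Local Notation v := ((lA \x lB)%E rect).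
Local Notation N := (q * p * d)%N.
Local Notation s := (fun n : nat => harmonic n : R).

Let s_gt0 n : 0 < s n.
Proof. by rewrite /harmonic invr_gt0. Qed.

Definition kernel_mean (F : Gr -> R) n (b : GrB) : \bar R :=
  ((s n ^+ N)^-1%:E * kernel_int lA lB (s n ^+ 2) F b)%E.

Lemma kernel_meanE (F : Gr -> R) n g : gcont F -> (forall b, 0 <= F b) -> SU g ->
  kernel_mean F n (act g bo) = mean_int lA lB (s n) (F \o act g).
Proof.
move=> cF F0 Sg; rewrite /kernel_mean (kernel_int_mean hA hB (s_gt0 n) Sg cF F0).
by rewrite muleA -EFinM mulVf ?mul1e// expf_neq0// gt_eqF.
Qed.

Lemma kernel_mean_cvg (F : Gr -> R) M b : gcont F -> (forall b, 0 <= F b) ->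
  (forall b, F b <= M) -> kernel_mean F n b @[n --> \oo] --> ((F b)%:E * v)%E.
Proof.
move=> cF F0 FM; have [g Sg ->] := transitive_SU b hq.
have e : (fun n => kernel_mean F n (act g bo)) = (fun n => mean_int lA lB (s n) (F \o act g)).
  by apply/funext => n; exact: kernel_meanE.
have cFg : gcont (F \o act g) by apply: gcont_act => //; exact: SU_SL.
have := mean_int_cvg hA hB cFg (fun c => F0 (act g c)) (fun c => FM (act g c)).
by rewrite e.
Qed.

Lemma kernel_mean_le (F : Gr -> R) M n b : gcont F -> (forall b, 0 <= F b) ->
  (forall b, F b <= M) -> (0 <= kernel_mean F n b <= M%:E * v)%E.
Proof.
move=> cF F0 FM; have [g Sg ->] := transitive_SU b hq.
rewrite kernel_meanE//; apply/andP; split; first by apply: mean_int_ge0 => c; exact: F0.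
apply: mean_int_le => // [|c|c].
- by apply: gcont_act => //; exact: SU_SL.
- exact: F0.
- exact: FM.
Qed.

Lemma measurable_kernel_mean (F : Gr -> R) n : gcont F -> (forall b, 0 <= F b) ->
  measurable_fun [set: GrB] (kernel_mean F n).
Proof.
move=> cF F0; apply: emeasurable_funM; first exact: measurable_cst.
exact: measurable_kernel_int.
Qed.

(** The factor of the first evaluation, divided by the scaling of the second one. *)
Definition frame_ratio n : \bar R := ((s n ^+ N)^-1%:E * frame_cst mu lA (s n ^+ 2))%E.

Definition cell_int (F : Gr -> R) : \bar R :=
  (\int[lB]_y (F (chart 1%:M (y : 'rV_(q * p * d))) * weight (ofB y))%:E)%E.

Lemma frame_ratioE (F : Gr -> R) n : gcont F -> (forall b, 0 <= F b) ->
  (frame_ratio n * cell_int F = \int[mu]_b kernel_mean F n b)%E.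
Proof.
move=> cF F0; rewrite /frame_ratio -muleA -frame_int_eq// (frame_int_kernel mu hA hB)//.
rewrite /kernel_mean ge0_integral_scale//.
- exact: measurable_kernel_int.
- move=> b; apply: integral_ge0 => z _; exact: (kernel_ge0 (s n ^+ 2) (z, b : GrB) F0).
- by rewrite invr_ge0 exprn_ge0// ltW.
Qed.

(** Dominated convergence over the Grassmannian, by the bound of the kernel means. *)
Lemma frame_ratio_cvg (F : Gr -> R) M : gcont F -> (forall b, 0 <= F b) ->
  (forall b, F b <= M) ->
  (frame_ratio n * cell_int F)%E @[n --> \oo] --> ((\int[mu]_b (F b)%:E) * v)%E.
Proof.
move=> cF F0 FM.
have e : (fun n => frame_ratio n * cell_int F)%E = (fun n => \int[mu]_b kernel_mean F n b)%E.
  by apply/funext => n; exact: frame_ratioE.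
have mF : measurable_fun [set: GrB] (fun b => (F b)%:E).
  by apply/measurable_EFinP; exact: gcont_measurable.
have M0 : 0 <= M by exact: le_trans (F0 bo) (FM bo).
have vf := rect_fin hA hB; have v0 := ltW (rect_gt0 hA hB).
have -> : ((\int[mu]_b (F b)%:E) * v = \int[mu]_b ((F b)%:E * v))%E.
  by rewrite ge0_integralZr// => b _; rewrite lee_fin.
rewrite e.
pose g (b : GrB) := (M%:E * v)%E.
have ig : mu.-integrable setT g.
  have := @finite_measure_integrable_cst _ _ R mu setT (M * fine v) measurableT.
  by rewrite (_ : EFin \o cst _ = g)//; apply/funext => b /=; rewrite EFinM fineK.
apply: (dominated_cvg measurableT (g := g)) => //.
- by move=> n; exact: measurable_kernel_mean.
- by move=> b _; exact: (kernel_mean_cvg cF F0 FM).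
- by move=> b _; rewrite /g fin_numM.
- move=> n b _; have /andP[h0 h1] := kernel_mean_le n b cF F0 FM.
  by rewrite (gee0_abs h0).
Qed.

Definition cell_mass : \bar R := cell_int (fun=> 1).

Lemma gcont1 : gcont (fun _ : Gr => 1 : R).
Proof. by move=> g _; exact: cst_continuous. Qed.

Lemma cell_int_ge0 F : (forall b, 0 <= F b) -> (0 <= cell_int F)%E.
Proof. by move=> F0; apply: integral_ge0 => y _; rewrite lee_fin mulr_ge0 ?weight_ge0. Qed.

Lemma frame_ratio_mass : (frame_ratio n * cell_mass)%E @[n --> \oo] --> v.
Proof.
have := @frame_ratio_cvg (fun=> 1) 1 gcont1 (fun=> ler01) (fun=> lexx 1).
have -> : (\int[mu]_b (1 : R)%:E = 1)%E.
  by rewrite integral_cst// mul1e; exact: probability_setT.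
by rewrite mul1e.
Qed.

(** An infinite mass would satisfy c m = 2 (c m) for every c >= 0, and then so would
    the finite nonzero limit. *)
Lemma cell_mass_fin : cell_mass \is a fin_num.
Proof.
have h0 : (0 <= cell_mass)%E by apply: cell_int_ge0.
rewrite ge0_fin_numE// ltey; apply/eqP => mE.
have h := frame_ratio_mass.
have h2 : (2%:E * (frame_ratio n * cell_mass))%E @[n --> \oo] --> (2%:E * v)%E by exact: cvgeZl.
move: h2; under eq_fun do rewrite muleCA mE gt0_muley ?lte_fin// -mE.
move=> /(cvg_unique (@ereal_hausdorff R) h).
rewrite -(fineK (rect_fin hA hB)) -EFinM => -[] e.
have := rect_gt0 hA hB; rewrite -(fineK (rect_fin hA hB)) lte_fin; lra.
Qed.

Lemma measurable_cell (F : Gr -> R) : gcont F ->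
  measurable_fun [set: TB] (fun y => (F (chart 1%:M (y : 'rV_(q * p * d))) * weight (ofB y))%:E).
Proof.
move=> cF; apply/measurable_EFinP; apply: measurable_funM; last exact: measurable_weight.
exact: (measurableT_comp (gcont_measurable cF) (measurable_chart (SL1 R k (p + q)))).
Qed.

(** The same sequence of factors serves F and the constant 1. Multiplying crosswise
    and passing to the limit avoids dividing by the factors. *)
Lemma cell_int_bounded (F : Gr -> R) M : gcont F -> (forall b, 0 <= F b) ->
  (forall b, F b <= M) -> (cell_int F = cell_mass * \int[mu]_b (F b)%:E)%E.
Proof.
move=> cF F0 FM; have M0 : 0 <= M by exact: le_trans (F0 bo) (FM bo).
have mf := cell_mass_fin.
have vf := rect_fin hA hB; have v0 := rect_gt0 hA hB.
have If : cell_int F \is a fin_num.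
  rewrite ge0_fin_numE ?cell_int_ge0//.
  apply: (@le_lt_trans _ _ (M%:E * cell_mass)%E); last by rewrite ltey_eq fin_numM.
  rewrite -ge0_integral_scale//.
  - apply: ge0_le_integral => //.
    + by move=> y _; rewrite lee_fin mulr_ge0 ?weight_ge0.
    + exact: measurable_cell.
    + apply: emeasurable_funM; first exact: measurable_cst.
      exact: (measurable_cell gcont1).
    + by move=> y _; rewrite mul1r -EFinM lee_fin ler_wpM2r ?weight_ge0.
  - exact: (measurable_cell gcont1).
  - by move=> y; rewrite lee_fin mul1r weight_ge0.
have h1 := cvgeZl mf (frame_ratio_cvg cF F0 FM).
have h2 := cvgeZl If frame_ratio_mass.
(* Both limits are limits of this one sequence. *)
have e : (fun n => cell_mass * (frame_ratio n * cell_int F))%E =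
         (fun n => cell_int F * (frame_ratio n * cell_mass))%E.
  by apply/funext => n; rewrite muleC [RHS]muleC muleAC.
move: h1; rewrite e => /(cvg_unique (@ereal_hausdorff R) h2).
rewrite muleA => /(congr1 (fun x => x * (fine v)^-1%:E)%E).
have V : (v * (fine v)^-1%:E = 1)%E.
  rewrite -[v in LHS](fineK vf) -EFinM mulfV// gt_eqF// fine_gt0// v0 ltey_eq vf//.
by rewrite -!muleA V !mule1.
Qed.

Lemma trunc_cvg (x : R) (c : R) : (Num.min x n%:R * c)%:E @[n --> \oo] --> (x * c)%:E.
Proof.
apply: cvg_near_cst; apply: filterS (nbhs_infty_ger x) => n xn.
by rewrite min_l.
Qed.

(** Truncation at n and monotone convergence. *)
Lemma cell_int_eq (F : Gr -> R) : gcont F -> (forall b, 0 <= F b) ->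
  (cell_int F = cell_mass * \int[mu]_b (F b)%:E)%E.
Proof.
move=> cF F0.
pose G n b := Num.min (F b) n%:R.
have cG n : gcont (G n).
  by move=> g Sg x; exact: (@continuous_min R _ (fun y => F (chart g y)) (fun=> n%:R) x (cF g Sg x) (@cst_continuous _ _ _ x)).
have G0 n b : 0 <= G n b by rewrite /G le_min F0 ler0n.
have GM n b : G n b <= n%:R by rewrite /G ge_min lexx orbT.
have Gmono b n m : (n <= m)%N -> G n b <= G m b.
  by move=> nm; rewrite /G le_min !ge_min lexx/= ler_nat nm orbT.
have h1 : cell_int (G n) @[n --> \oo] --> cell_int F.
  apply: (@cvg_integral_nondecreasing _ _ R lB
    (fun n (y : TB) => (G n (chart 1%:M (y : 'rV_(q * p * d))) * weight (ofB y))%:E)).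
  - by move=> n; exact: measurable_cell.
  - by move=> n y; rewrite lee_fin mulr_ge0 ?weight_ge0.
  - by move=> y n m nm; rewrite lee_fin ler_wpM2r ?weight_ge0 ?Gmono.
  - by move=> y; exact: trunc_cvg.
have h2 : (\int[mu]_b (G n b)%:E)%E @[n --> \oo] --> (\int[mu]_b (F b)%:E)%E.
  apply: (@cvg_integral_nondecreasing _ _ R mu (fun n b => (G n b)%:E)).
  - by move=> n; apply/measurable_EFinP; exact: gcont_measurable.
  - by move=> n b; rewrite lee_fin.
  - by move=> b n m nm; rewrite lee_fin Gmono.
  - by move=> b; have := @trunc_cvg (F b) 1; under eq_fun do rewrite mulr1; rewrite mulr1.
have h3 := cvgeZl cell_mass_fin h2.
apply: (cvg_unique (@ereal_hausdorff R) h1).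
by move: h3; under eq_fun do rewrite -(cell_int_bounded (cG _) (G0 _) (GM _)).
Qed.

End CellIntegral.

(** * The invariant measure in terms of Haar measure on the unipotent group *)

Section HaarSide.
Variables (R : realType) (k : scalar_kind) (p q : nat).
Hypotheses (hp : (0 < p)%N) (hq : (0 < q)%N).
Local Notation K := (scalars R k).
Local Notation d := (dimR k).
Local Notation Gr := (Gr R k p q).
Local Notation GrB := (GrBorel R k p q).
Local Notation NB := (NbarBorel R k p q).
Local Notation bo := (b_o R k p q).
Local Notation TA := (rVB R (p * p * d)).
Local Notation TB := (rVB R (q * p * d)).
Local Notation ofB b := (ofR (b : 'rV[R]_(q * p * d)) : 'M[K]_(q, p)).
Variable mu : probability GrB R.
Hypothesis hmu : K_invariant mu.
Variable nu : {measure set NB -> \bar R}.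
Hypothesis hnu : is_haar nu.
Hypothesis hnu1 : cintegral nu (fun Y : 'M[K]_(q, p) =>
  apow p q (log_a (nbar Y)) (- (2 * rho R k p q)%:C%C)) = 1.

Lemma measurable_toR_Nbar : measurable_fun [set: NB] (@toR R k q p : NB -> TB).
Proof.
apply: (measurability _ (erefl : @measurable _ TB = <<s (@open 'rV[R]_(q * p * d)) >>)).
move=> _ [U oU <-]; rewrite setTI; apply: sub_sigma_algebra => /=.
by rewrite (_ : _ @^-1` _ = U)//; apply/seteqP; split => x /=; rewrite ofRK.
Qed.

Lemma compact_cube n r : compact (cube n r : set 'rV[R]_n).
Proof.
rewrite (_ : cube n r = [set v : 'rV[R]_n | forall i, `[- r, r]%classic (v ord0 i)]).
  exact: (@rV_compact R n (fun=> `[- r, r]%classic) (fun=> @segment_compact R _ _)).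
by apply/seteqP; split => v h i; have := h i; rewrite /= !mxE in_itv.
Qed.

Lemma haar_integral (lB : {sigma_finite_measure set TB -> \bar R}) : is_lebesgue lB ->
  exists2 c : R, 0 <= c & forall g : TB -> \bar R, measurable_fun [set: TB] g ->
    (forall y, (0 <= g y)%E) ->
    (\int[nu]_Y g (toR (Y : 'M[K]_(q, p)) : TB) = c%:E * \int[lB]_y g y)%E.
Proof.
move=> hB; have [nuT nuC _] := hnu.
pose nu' := measure_function_pushforward__canonical__measure_function_Measure nu measurable_toR_Nbar.
have fin r : (nu' (cube (q * p * d) r) < +oo)%E.
  apply: nuC; rewrite (_ : _ @^-1` _ = cube (q * p * d) r); first exact: compact_cube.
  by apply/seteqP; split => x /=; rewrite ofRK.
have inv (v : 'rV[R]_(q * p * d)) (E : set TB) : measurable E ->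
    nu' [set x : TB | E ((x : 'rV_(q * p * d)) + v)] = nu' E.
  move=> mE.
  have mE' : measurable ((@toR R k q p : NB -> TB) @^-1` E).
    by rewrite -[X in measurable X]setTI; exact: measurable_toR_Nbar.
  rewrite /nu' /= /pushforward -[RHS](nuT (ofR v) _ mE'); congr (nu _).
  have e Y : toR (ofR v + Y : 'M[K]_(q, p)) = toR Y + v.
    by apply: (can_inj (@ofRK R k q p)); rewrite toRK ofRD toRK addrC.
  by apply/seteqP; split => Y /=; rewrite e.
have [c c0 hc] := lebesgue_haar hB fin inv.
exists c => // g mg g0.
exact: (ge0_integral_preimage measurable_toR_Nbar c0 hc mg g0).
Qed.

Lemma apow_real (s x : R) : apow p q s (x%:C)%C = ((expR (s * ((p * q)%:R / (p + q)%:R) * x))%:C)%C.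
Proof.
rewrite /apow /cexp /= !mulr0 !mul0r subr0 addr0 cos0 sin0 mulr1 mulr0.
by [].
Qed.

(** 2 rho = d (n + 1) is the exponent of the absolute determinant of the Iwasawa
    block in the weight. *)
Lemma weight_apow (Y : 'M[K]_(q, p)) :
  weight Y = complex.Re (apow p q (log_a (nbar Y)) (- (2 * rho R k p q)%:C%C)).
Proof.
have [u [a [Su da e ea _]]] := iwasawaP hp hq Y.
rewrite -[(- _)%R](rmorphN (@real_complex R)) apow_real /= (weight_iwasawa Su e).
rewrite -absdet_expn ea /iwasawa_exp -!expRM_natl -expRN; congr expR.
rewrite /rho natrM; lra.
Qed.

Lemma integral_weight : (\int[nu]_Y (weight (Y : 'M[K]_(q, p)))%:E = 1)%E.
Proof.
have : (\int[nu]_(Y in setT) weight (Y : 'M[K]_(q, p)))%R = 1.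
  rewrite -[RHS](congr1 (@complex.Re R) hnu1); congr fine.
  by apply: eq_integral => Y _; rewrite weight_apow.
rewrite /Rintegral; case: (\int[nu]_(_ in _) _)%E => [r /= -> //|/eqP|/eqP];
  by rewrite eq_sym oner_eq0.
Qed.

(** Both nu and Lebesgue measure are Haar measures, and the function 1 fixes the
    constant because nu is normalized. *)
Lemma ge0_Gr_integral (F : Gr -> R) : gcont F -> (forall b, 0 <= F b) ->
  (\int[mu]_b (F b)%:E =
   \int[nu]_Y (F (act (nbar (Y : 'M[K]_(q, p))) bo) * weight (Y : 'M[K]_(q, p)))%:E)%E.
Proof.
move=> cF F0.
have [lA hA] : exists l : {sigma_finite_measure set TA -> \bar R}, is_lebesgue l.
  by apply: lebesgue_exists; rewrite !muln_gt0 hp dimR_gt0.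
have [lB hB] : exists l : {sigma_finite_measure set TB -> \bar R}, is_lebesgue l.
  by apply: lebesgue_exists; rewrite !muln_gt0 hp hq dimR_gt0.
have [c c0 Hc] := haar_integral hB.
have H (H : Gr -> R) : gcont H -> (forall b, 0 <= H b) ->
    (\int[nu]_Y (H (act (nbar (Y : 'M[K]_(q, p))) bo) * weight (Y : 'M[K]_(q, p)))%:E =
     c%:E * (cell_mass lB * \int[mu]_b (H b)%:E))%E.
  move=> cH H0; rewrite -(cell_int_eq hp hq hmu hA hB cH H0) -Hc.
  - by apply: eq_integral => Y _; rewrite chart_toR mul1mx toRK.
  - exact: measurable_cell.
  - by move=> y; rewrite lee_fin mulr_ge0 ?weight_ge0.
have := H (fun=> 1) (@gcont1 _ _ _ _) (fun=> ler01).
under eq_integral do rewrite mul1r.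
rewrite integral_weight.
have -> : (\int[mu]_b (1 : R)%:E = 1)%E.
  by rewrite integral_cst// mul1e; exact: probability_setT.
rewrite mule1 => cm.
by rewrite H// muleA -cm mul1e.
Qed.

Lemma gcont_max0 (F : Gr -> R) : gcont F -> gcont (fun b => Num.max (F b) 0).
Proof.
move=> cF g Sg x.
exact: (@continuous_max R _ (fun y => F (chart g y)) (fun=> 0) x (cF g Sg x) (@cst_continuous _ _ _ x)).
Qed.

(** Positive and negative parts separately; the weight is nonnegative and commutes
    with taking them. *)
Lemma Gr_integral (F : Gr -> R) : gcont F ->
  (\int[mu]_b (F b)%:E =
   \int[nu]_Y (F (act (nbar (Y : 'M[K]_(q, p))) bo) * weight (Y : 'M[K]_(q, p)))%:E)%E.
Proof.
move=> cF.
have cN : gcont (fun b => - F b).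
  by move=> g Sg x; apply: continuousN; exact: cF.
rewrite integralE [RHS]integralE; congr (_ - _)%E.
- transitivity (\int[mu]_b (Num.max (F b) 0)%:E)%E.
    by apply: eq_integral => b _; rewrite funeposE EFin_max.
  rewrite ge0_Gr_integral; last 2 first.
  + exact: gcont_max0.
  + by move=> b; rewrite le_max lexx orbT.
  apply: eq_integral => Y _.
  by rewrite funeposE -EFin_max maxr_pMl ?weight_ge0// mul0r.
- transitivity (\int[mu]_b (Num.max (- F b) 0)%:E)%E.
    by apply: eq_integral => b _; rewrite funenegE EFin_max.
  rewrite ge0_Gr_integral; last 2 first.
  + exact: gcont_max0.
  + by move=> b; rewrite le_max lexx orbT.
  apply: eq_integral => Y _.
  by rewrite funenegE -EFinN -EFin_max maxr_pMl ?weight_ge0// mul0r mulNr.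
Qed.

Lemma integral_act_SU (F : Gr -> R) u : SU u -> gcont F ->
  (\int[mu]_b (F (act u b))%:E = \int[mu]_b (F b)%:E)%E.
Proof.
move=> Su cF.
have mF : measurable_fun [set: GrB] (fun b => (F b)%:E).
  by apply/measurable_EFinP; exact: gcont_measurable.
have H (g : GrB -> \bar R) : measurable_fun [set: GrB] g -> (forall b, (0 <= g b)%E) ->
    (\int[mu]_b g (act u b) = \int[mu]_b g b)%E.
  move=> mg g0.
  rewrite (ge0_integral_preimage (c := 1) (m2 := mu) (measurable_act (SU_SL Su)))// ?mul1e//.
  by move=> E mE; rewrite mul1e; exact: hmu.
rewrite integralE [RHS]integralE; congr (_ - _)%E.
- rewrite -(H _ (measurable_funepos mF) (funepos_ge0 _)).
  by apply: eq_integral => b _; rewrite !funeposE.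
- rewrite -(H _ (measurable_funeneg mF) (funeneg_ge0 _)).
  by apply: eq_integral => b _; rewrite !funenegE.
Qed.

End HaarSide.

(** * The cosine kernel *)

Section ComplexPower.
Variable R : realType.

(** For the cosine and the sine these are the real and imaginary parts of
    |t|^(a + i b). The modulus is at most |t|^a, which tends to 0 with t. *)
Lemma continuous_power_wave (C : R -> R) (a b : R) : continuous C -> (forall x, `|C x| <= 1) ->
  0 < a -> continuous (fun t : R => if t == 0 then 0 else expR (a * ln `|t|) * C (b * ln `|t|)).
Proof.
move=> cC C1 a0 t; have [->|t0] := eqVneq t 0.
  rewrite /continuous_at eqxx; apply/cvgr0Pnorm_lt => e e0.
  have d0 : 0 < e `^ a^-1 by rewrite powR_gt0.
  have : \forall x \near (0 : R), `|x| < e `^ a^-1.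
    by have /cvgr0Pnorm_lt := @cvg_id _ (nbhs (0 : R)); apply.
  apply: filterS => x xd; case: eqP => [_|/eqP x0]; first by rewrite normr0.
  rewrite normrM gtr0_norm ?expR_gt0//.
  apply: (@le_lt_trans _ _ (expR (a * ln `|x|))).
    by rewrite ler_piMr// expR_ge0.
  have -> : e = expR (a * ln (e `^ a^-1)).
    by rewrite ln_powR mulrA mulfV ?gt_eqF// mul1r lnK.
  by rewrite ltr_expR ltr_pM2l// ltr_ln// posrE normr_gt0.
rewrite /continuous_at (negbTE t0).
have ne : \forall x \near t, x != 0 by apply: open_nbhs_nbhs; split; [exact: open_neq | exact: t0].
apply: (@cvg_trans _ ((fun x => expR (a * ln `|x|) * C (b * ln `|x|)) x @[x --> t])).
  apply: near_eq_cvg; apply: filterS ne => x x0 /=; by rewrite (negbTE x0).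
have cln : {for t, continuous (fun x : R => ln `|x|)}.
  apply: (@continuous_comp _ _ _ (fun x : R => `|x|) (@ln R)); first exact: norm_continuous.
  by apply: continuous_ln; rewrite normr_gt0.
have ce : {for t, continuous (fun x : R => expR (a * ln `|x|))}.
  apply: (@continuous_comp _ _ _ (fun x : R => a * ln `|x|) (@expR R)); last exact: continuous_expR.
  exact: (continuousM (@cst_continuous _ _ a t) cln).
have cc : {for t, continuous (fun x : R => C (b * ln `|x|))}.
  apply: (@continuous_comp _ _ _ (fun x : R => b * ln `|x|) C); last exact: cC.
  exact: (continuousM (@cst_continuous _ _ b t) cln).
exact: (continuousM ce cc).
Qed.

Lemma cpow_normE (t : R) (z : R[i]) :
  cpow `|t| z =
  ((if t == 0 then 0 else expR (complex.Re z * ln `|t|) * cos (complex.Im z * ln `|t|)) +i*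
   (if t == 0 then 0 else expR (complex.Re z * ln `|t|) * sin (complex.Im z * ln `|t|)))%C.
Proof.
rewrite /cpow normr_eq0; case: eqP => // _; rewrite /cexp.
by case: z => x y /=; rewrite !mul0r subr0 addr0 ![_ * ln _]mulrC.
Qed.

Lemma continuous_Re_cpow (z : R[i]) : 0 < complex.Re z ->
  continuous (fun t : R => complex.Re (cpow `|t| z)).
Proof.
move=> z0; under eq_fun do rewrite cpow_normE /=.
by apply: continuous_power_wave => //; [exact: continuous_cos | by move=> x; rewrite ler_norml cos_geN1 cos_le1].
Qed.

Lemma continuous_Im_cpow (z : R[i]) : 0 < complex.Re z ->
  continuous (fun t : R => complex.Im (cpow `|t| z)).
Proof.
move=> z0; under eq_fun do rewrite cpow_normE /=.
by apply: continuous_power_wave => //; [exact: continuous_sin | by move=> x; rewrite ler_norml sin_geN1 sin_le1].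
Qed.

Lemma cpow_powR (r e : R) (z : R[i]) : 0 <= r -> 0 < e ->
  cpow (r `^ e) z = cpow r (e%:C%C * z).
Proof.
move=> r0 e0; rewrite /cpow powR_eq0 (gt_eqF e0) andbT.
case: eqP => // _; congr cexp; rewrite ln_powR.
by case: z => x y; apply/eqP; rewrite eq_complex /=; apply/andP; split; apply/eqP; lra.
Qed.

Lemma cexpD_real (z : R[i]) (r : R) : cexp z * (expR r)%:C%C = cexp (z + r%:C%C).
Proof.
by case: z => x y; apply/eqP; rewrite eq_complex /= expRD !addr0; apply/andP; split; apply/eqP; lra.
Qed.

End ComplexPower.

Section Intertwining.
Variables (R : realType) (k : scalar_kind) (p q : nat).
Hypotheses (hp : (0 < p)%N) (hq : (0 < q)%N).
Local Notation K := (scalars R k).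
Local Notation d := (dimR k).
Local Notation Gr := (Gr R k p q).
Local Notation GrB := (GrBorel R k p q).
Local Notation NB := (NbarBorel R k p q).
Local Notation bo := (b_o R k p q).
Local Notation rhoc := ((rho R k p q)%:C%C).

(** With (1; Y) = u_p a for the Iwasawa block a, the matrix e_p^* u_p is the inverse of
    a, where e_p is the matrix (1; 0). *)
Lemma abs_Cos_cell (Y : 'M[K]_(q, p)) :
  abs_Cos (act (nbar Y) bo) bo = expR (- (log_a (nbar Y) * ((p * q)%:R / (p + q)%:R))).
Proof.
have [u [a [Su da e ea ->]]] := iwasawaP hp hq Y.
have S1 : SU (1%:M : 'M[K]_(p + q)).
  split; first exact: SL1.
  by rewrite adj1 mul1mx.
rewrite -{2}[bo]act1 (abs_CosE hp Su S1) expRN -/(iwasawa_exp p q _) -ea.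
apply: (mulIf (lt0r_neq0 (absdet_gt0 da))).
rewrite mulVf ?gt_eqF ?absdet_gt0// -absdetM -mulmxA -e lsubmx_nbar.
have -> : lsubmx (1%:M : 'M[K]_(p + q)) = col_mx 1%:M 0.
  by rewrite [X in lsubmx X](scalar_mx_block p q) block_mxEh row_mxKl.
by rewrite adj_col_mx mul_row_col adj1 adj0 mul1mx mul0mx addr0 absdet1.
Qed.

Lemma gcont_cos_kernel (v : 'M[K]_(p + q)) (z : R[i]) : SU v -> 0 < complex.Re z ->
  gcont (fun b => complex.Re (cpow (abs_Cos b (act v bo)) z)) /\
  gcont (fun b => complex.Im (cpow (abs_Cos b (act v bo)) z)).
Proof.
move=> Sv z0.
pose D (b : Gr) := detR (adj (lsubmx v) *m proj b *m lsubmx v).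
have cD : gcont D.
  have aG := @funalg_gcont R k p q.
  apply: (mxA_detR aG); apply: mxA_mul => //; last exact: mxA_cst.
  by apply: mxA_mul => //; [exact: mxA_cst | exact: gcont_proj].
pose e : R := (2 * d%:R)^-1.
have e0 : 0 < e by rewrite invr_gt0 mulr_gt0// ltr0n dimR_gt0.
have w0 : 0 < complex.Re (e%:C%C * z).
  by case: z z0 => x y /= x0; rewrite mul0r subr0 mulr_gt0.
have E b : cpow (abs_Cos b (act v bo)) z = cpow `|D b| (e%:C%C * z).
  by rewrite (abs_Cos_proj hp)// cpow_powR.
split.
- rewrite (_ : (fun b => _) = fun b => complex.Re (cpow `|D b| (e%:C%C * z))); last first.
    by apply/funext => b; rewrite E.
  move=> g Sg x; exact: (continuous_comp (cD g Sg x) (continuous_Re_cpow w0 (x := D (chart g x)))).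
- rewrite (_ : (fun b => _) = fun b => complex.Im (cpow `|D b| (e%:C%C * z))); last first.
    by apply/funext => b; rewrite E.
  move=> g Sg x; exact: (continuous_comp (cD g Sg x) (continuous_Im_cpow w0 (x := D (chart g x)))).
Qed.

Lemma gcont_smooth (f : Gr -> R[i]) : smooth f ->
  gcont (fun b => complex.Re (f b)) /\ gcont (fun b => complex.Im (f b)).
Proof. by move=> hf; split => g Sg; have [h1 h2] := hf g Sg; [exact: (h1 0%N) | exact: (h2 0%N)]. Qed.

Lemma gcont_mulC (f g : Gr -> R[i]) :
  gcont (fun b => complex.Re (f b)) -> gcont (fun b => complex.Im (f b)) ->
  gcont (fun b => complex.Re (g b)) -> gcont (fun b => complex.Im (g b)) ->
  gcont (fun b => complex.Re (f b * g b)) /\ gcont (fun b => complex.Im (f b * g b)).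
Proof.
move=> f1 f2 g1 g2; have aG := @funalg_gcont R k p q; split.
- rewrite (_ : (fun b => _) = fun b => complex.Re (f b) * complex.Re (g b) +
     - (complex.Im (f b) * complex.Im (g b))).
    by apply: (funalgD aG); [|apply: (funalgN aG)]; exact: (funalgM aG).
  by apply/funext => b; case: (f b) (g b) => [? ?] [? ?].
- rewrite (_ : (fun b => _) = fun b => complex.Re (f b) * complex.Im (g b) +
     complex.Im (f b) * complex.Re (g b)).
    by apply: (funalgD aG); exact: (funalgM aG).
  by apply/funext => b; case: (f b) (g b) => [? ?] [? ?].
Qed.

End Intertwining.

(** * The cosine transform and the intertwining operator *)

Section MainProof.
Variables (R : realType) (k : scalar_kind) (p q : nat).
Hypotheses (hp : (0 < p)%N) (hq : (0 < q)%N).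
Local Notation K := (scalars R k).
Local Notation d := (dimR k).
Local Notation Gr := (Gr R k p q).
Local Notation GrB := (GrBorel R k p q).
Local Notation NB := (NbarBorel R k p q).
Local Notation bo := (b_o R k p q).
Local Notation rhoc := ((rho R k p q)%:C%C).

(** a^(-(lambda - rho)) a^(-2 rho) = a^(-lambda - rho). *)
Lemma cpow_cell (Y : 'M[K]_(q, p)) (lambda : R[i]) :
  cpow (abs_Cos (act (nbar Y) bo) bo) (lambda - rhoc) * (weight Y)%:C%C =
  apow p q (log_a (nbar Y)) (- lambda - rhoc).
Proof.
rewrite (abs_Cos_cell hp hq) (weight_apow hp hq).
rewrite -[(- (2 * rho R k p q)%:C%C)%R](rmorphN (@real_complex R)) apow_real /=.
rewrite /cpow gt_eqF ?expR_gt0// expRK cexpD_real /apow; congr cexp.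
case: lambda => x y; apply/eqP; rewrite eq_complex /=; apply/andP; split; apply/eqP; lra.
Qed.

Lemma cell_point (u : 'M[K]_(p + q)) (Y : 'M[K]_(q, p)) : SU u ->
  act (u *m nbar Y) bo = act u (act (nbar Y) bo).
Proof.
by move=> Su; rewrite act_act//; [case: (SU_SL Su) | case: (SL_nbar Y)].
Qed.

(** Rotate c to b_o by invariance of mu, then integrate over the big cell. *)
Lemma cos_transform_cell (mu : probability GrB R) (nu : {measure set NB -> \bar R})
    (lambda : R[i]) (f : Gr -> R[i]) (u : 'M[K]_(p + q)) :
  K_invariant mu -> is_haar nu ->
  cintegral nu (fun Y : 'M[K]_(q, p) =>
    apow p q (log_a (nbar Y)) (- (2 * rho R k p q)%:C%C)) = 1 ->
  rho R k p q < complex.Re lambda -> smooth f -> SU u ->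
  cos_transform mu lambda f (act u bo) =
  cintegral nu (fun Y : 'M[K]_(q, p) =>
    apow p q (log_a (nbar Y)) (- lambda - rhoc) * f (act (u *m nbar Y) bo)).
Proof.
move=> hmu hnu hnu1 hl hf Su.
pose G (b : Gr) := cpow (abs_Cos b (act u bo)) (lambda - rhoc) * f b.
have z0 : 0 < complex.Re (lambda - rhoc) by case: lambda hl @G => x y /= h; rewrite subr_gt0.
have [k1 k2] := gcont_cos_kernel hp hq Su z0.
have [f1 f2] := gcont_smooth hf.
have [cRe cIm] := gcont_mulC k1 k2 f1 f2.
have GE (Y : 'M[K]_(q, p)) : G (act u (act (nbar Y) bo)) * (weight Y)%:C%C =
    apow p q (log_a (nbar Y)) (- lambda - rhoc) * f (act (u *m nbar Y) bo).
  by rewrite /G (abs_Cos_act hp _ _ hq Su) mulrAC cpow_cell cell_point.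
have H (F : Gr -> R) : gcont F -> (\int[mu]_(b in setT) F b)%R =
    (\int[nu]_(Y in setT) (F (act u (act (nbar (Y : 'M[K]_(q, p))) bo)) * weight (Y : 'M[K]_(q, p))))%R.
  move=> cF; congr fine; rewrite -(integral_act_SU hmu Su cF).
  have cFu : gcont (F \o act u) by apply: gcont_act => //; exact: SU_SL.
  exact: (Gr_integral hp hq hmu hnu hnu1 cFu).
rewrite /cos_transform /cintegral (H _ cRe) (H _ cIm); congr (_ +i* _)%C;
  congr fine; apply: eq_integral => Y _; congr EFin; rewrite -GE.
- by rewrite -/(G _); case: (G _) => x y /=; rewrite mulr0 subr0.
- by rewrite -/(G _); case: (G _) => x y /=; rewrite mulr0 add0r mulrC.
Qed.

End MainProof.

Theorem mainTheorem2 (R : realType) (k : scalar_kind) (p q : nat)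
    (hp : (1 <= p)%N) (hpq : (p <= q)%N)
    (mu : probability (GrBorel R k p q) R) (hmu : K_invariant mu)
    (nu : {measure set (NbarBorel R k p q) -> \bar R}) (hnu : is_haar nu)
    (hnu1 : cintegral nu (fun Y : 'M[scalars R k]_(q, p) =>
              apow p q (log_a (nbar Y)) (- (2 * rho R k p q)%:C%C)) = 1)
    (lambda : R[i]) (hlambda : rho R k p q < complex.Re lambda)
    (f : Gr R k p q -> R[i]) (hf : smooth f) :
  cos_transform mu lambda f = intertwining nu lambda f.
Proof.
have hq : (0 < q)%N by exact: leq_trans hp hpq.
apply/funext => c; have [u Su cu] := transitive_SU c hq.
have H v : SU v -> c = act v (b_o R k p q) -> cos_transform mu lambda f c =
    cintegral nu (fun Y : 'M[scalars R k]_(q, p) =>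
      apow p q (log_a (nbar Y)) (- lambda - (rho R k p q)%:C%C) * f (act (v *m nbar Y) (b_o R k p q))).
  by move=> Sv ->; exact: cos_transform_cell.
rewrite (H u Su cu) /intertwining; symmetry.
apply: (@common_value_eq _ _ 0 _ _ u); first by split.
by move=> v [Sv cv]; rewrite -(H v Sv cv) (H u Su cu).
Qed.
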